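(* Let $\mathcal Z$ be the antipodal pointed matched circle for a surface of genus $k$. Then the algebra $\mathcal A(\mathcal Z,-k+1)$ is $\pi$-formal.
   Context: The antipodal pointed matched circle of genus $k\ge1$ has $4k$ points numbered $1,\dots,4k$ along a circle cut at a basepoint, with $j$ matched to $j+2k$ for $1\le j\le 2k$. The summand $\mathcal A(\mathcal Z,-k+1)$ of its bordered Floer algebra (over $\mathbb F_2$) has zero differential, and is the following path algebra with relations over $\mathbb F_2$ (paths composed left to right): vertices $\iota_1,\dots,\iota_{2k}$; arrows $a_i,b_i\colon\iota_i\to\iota_{i+1}$ for $1\le i\le 2k-1$ and one arrow $c\colon\iota_{2k}\to\iota_1$; relations $a_ib_{i+1}=0=b_ia_{i+1}$ for $1\le i\le 2k-2$, $b_{2k-1}c=0$, $ca_1=0$. It is regarded as a dg algebra with zero differential (in degree $0$). $\pi$-formality. Let $A$ be a dg algebra over $\mathbb F_2$ (differentials have degree $-1$; $\otimes$ without subscript is over $\mathbb F_2$). Let $A^e=A\otimes A$ with $a(b\otimes c)d=(ab)\otimes(cd)$. A dg bimodule is free if it is a direct sum of shifts of $A^e$; a cell bimodule is one with a filtration $C_1\subset C_2\subset\cdots$ with free subquotients; a cell retract is a sub-bimodule of a cell bimodule which is a bimodule retract of it; a resolution of $M$ is a quasi-isomorphism $R\to M$ with $R$ a cell retract. Fix a resolution $R\to A$. Put $M\otimes^LN:=M\otimes_AR\otimes_AN$; let $\mathit{HC}(M)$ be the quotient of $R\otimes M$ by $ra\otimes m\sim r\otimes am$, $ar\otimes m\sim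 r\otimes ma$, and $\mathit{HH}_i(M)=H_i(\mathit{HC}(M))$. The map $\tau(r\otimes(m\otimes r'\otimes m'))=r'\otimes(m'\otimes r\otimes m)$ is a chain involution of $\mathit{HC}(M\otimes^LM)$. The Hochschild–Tate bicomplex is $\mathit{HC}^{\mathrm{Tate}}_{p,q}=\mathit{HC}_q(M\otimes^LM)$, $p,q\in\mathbb Z$, with vertical differential $\partial_{\mathit{HC}}$ and horizontal differential $1+\tau\colon(p,q)\to(p-1,q)$; ${}^{hv}E$ is its spectral sequence obtained by taking horizontal homology first (filtration by $q$). A dg bimodule $M$ is $\pi$-formal if ${}^{hv}E$ collapses at $E^3$ (all differentials $d^r$, $r\ge3$, vanish). A homologically smooth and proper dg algebra $A$ is $\pi$-formal if every dg $(A,A)$-bimodule is $\pi$-formal. (Homologically proper: finite-dimensional total homology. Homologically smooth: $A$ has a bimodule resolution by a retract of a cell bimodule with a finite filtration with subquotients free of finite rank.) *)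

(* Defs.v *)
From HB Require Import structures.
From mathcomp Require Import all_boot all_algebra.
From mathcomp Require Import boolp.
From mathcomp.multinomials Require Import freeg.

Set Implicit Arguments.
Unset Strict Implicit.
Unset Printing Implicit Defensive.

Import GRing.Theory.
Local Open Scope ring_scope.
Local Open Scope quotient_scope.

Notation F2 := 'F_2.

Section Linear.
Variables U V W : lmodType F2.

Lemma lin0 (f : U -> V) : linear f -> f 0 = 0.
Proof. by move=> Hf; have := Hf (-1) 0 0; rewrite scaler0 addr0 scaleN1r addNr. Qed.

Lemma linD (f : U -> V) : linear f -> {morph f : x y / x + y}.
Proof. by move=> Hf x y; have := Hf 1 x y; rewrite !scale1r. Qed.

Lemma linZ (f : U -> V) : linear f -> forall a, {morph f : x / a *: x}.
Proof. by move=> Hf a x; have := Hf a x 0; rewrite (lin0 Hf) !addr0. Qed.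

Lemma linB (f : U -> V) : linear f -> {morph f : x y / x - y}.
Proof. by move=> Hf x y; rewrite -!scaleN1r linD // linZ. Qed.

Lemma lin_sum (f : U -> V) I (r : seq I) (F : I -> U) : linear f ->
  f (\sum_(i <- r) F i) = \sum_(i <- r) f (F i).
Proof.
move=> Hf; elim: r => [|i r IH]; first by rewrite !big_nil lin0.
by rewrite !big_cons linD // IH.
Qed.

Definition bilinear (f : U -> V -> W) :=
  (forall y, linear (f^~ y)) /\ (forall x, linear (f x)).

End Linear.

Lemma addxx (V : lmodType F2) (x : V) : x + x = 0.
Proof.
rewrite -[x]scale1r -scalerDl.
have -> : (1 + 1 : F2) = 0 by apply/eqP.
by rewrite scale0r.
Qed.

Lemma oppxx (V : lmodType F2) (x : V) : - x = x.
Proof. by apply/eqP; rewrite -subr_eq0 -opprD addxx oppr0. Qed.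

Lemma additive_linear (U V : lmodType F2) (f : U -> V) :
  {morph f : x y / x + y} -> linear f.
Proof.
move=> fD a x y; rewrite fD; congr (_ + _).
have f0 : f 0 = 0 by apply: (@addrI _ (f 0)); rewrite -fD !addr0.
have [->|a1] := eqVneq a 0; first by rewrite !scale0r.
suff -> : a = 1 by rewrite !scale1r.
by move: a1; case: a => -[|[|n]] // i _; apply/val_inj.
Qed.

Section Span.
Variables (V : lmodType F2) (G : V -> Prop).

Inductive span : V -> Prop :=
| span0 : span 0
| span_cons a g x : G g -> span x -> span (a *: g + x).

Lemma span_gen g : G g -> span g.
Proof. by move=> Gg; rewrite -[g]addr0 -{1}[g]scale1r; apply: span_cons span0. Qed.

Lemma span_lin a x y : span x -> span y -> span (a *: x + y).
Proof.
move=> Sx Sy; elim: Sx => [|b g z Gg _ IH]; first by rewrite scaler0 add0r.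
by rewrite scalerDr scalerA -addrA; apply: span_cons.
Qed.

Lemma spanD x y : span x -> span y -> span (x + y).
Proof. by move=> Sx Sy; rewrite -[x]scale1r; apply: span_lin. Qed.

Lemma spanZ a x : span x -> span (a *: x).
Proof. by move=> Sx; rewrite -[_ *: _]addr0; apply: span_lin Sx span0. Qed.

Lemma spanN x : span x -> span (- x).
Proof. by rewrite -scaleN1r; apply: spanZ. Qed.

End Span.

Lemma span_map (U V : lmodType F2) (f : U -> V) G H : linear f ->
  (forall g, G g -> span H (f g)) -> forall x, span G x -> span H (f x).
Proof.
move=> lf GH x; elim=> [|a g y Gg _ IH]; first by rewrite lin0 //; apply: span0.
by rewrite lf; apply: span_lin (GH _ Gg) IH.
Qed.

Section Quotient.
Variables (V : lmodType F2) (G : V -> Prop).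

Definition qrel (x y : V) := `[< span G (x - y) >].

Lemma qrel_refl : reflexive qrel.
Proof. by move=> x; apply/asboolP; rewrite subrr; apply: span0. Qed.
Lemma qrel_sym : symmetric qrel.
Proof.
suff H x y : qrel x y -> qrel y x by move=> x y; apply/idP/idP; apply: H.
by move=> /asboolP h; apply/asboolP; rewrite -opprB; apply: spanN.
Qed.
Lemma qrel_trans : transitive qrel.
Proof.
move=> y x z /asboolP h1 /asboolP h2; apply/asboolP.
by rewrite -[x - z](subrKA y); apply: spanD.
Qed.
Canonical qrel_equiv := EquivRel qrel qrel_refl qrel_sym qrel_trans.

Definition quot := {eq_quot qrel_equiv}.
HB.instance Definition _ := Choice.on quot.
HB.instance Definition _ := EqQuotient.on quot.

Definition qpi (x : V) : quot := \pi_quot x.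

Lemma qpi_eq x y : qpi x = qpi y <-> span G (x - y).
Proof.
split=> [/eqmodP /asboolP //|h].
by apply/eqmodP/asboolP.
Qed.

Lemma qpi_repr (q : quot) : qpi (repr q) = q.
Proof. exact: reprK. Qed.

Lemma repr_qpi x : span G (repr (qpi x) - x).
Proof. by apply/qpi_eq; rewrite qpi_repr. Qed.

Lemma quotP (P : quot -> Prop) : (forall x, P (qpi x)) -> forall q, P q.
Proof. by move=> h q; rewrite -(qpi_repr q). Qed.

Definition qadd (p q : quot) := qpi (repr p + repr q).
Definition qopp (p : quot) := qpi (- repr p).
Definition qscale (a : F2) (p : quot) := qpi (a *: repr p).

Lemma qaddE x y : qadd (qpi x) (qpi y) = qpi (x + y).
Proof.
apply/qpi_eq; rewrite opprD addrACA.
by apply: spanD; apply: repr_qpi.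
Qed.
Lemma qoppE x : qopp (qpi x) = qpi (- x).
Proof. by apply/qpi_eq; rewrite -opprD; apply: spanN; apply: repr_qpi. Qed.
Lemma qscaleE a x : qscale a (qpi x) = qpi (a *: x).
Proof. by apply/qpi_eq; rewrite -scalerBr; apply: spanZ; apply: repr_qpi. Qed.

Lemma qaddA : associative qadd.
Proof.
by elim/quotP=> x; elim/quotP=> y; elim/quotP=> z; rewrite !qaddE addrA.
Qed.
Lemma qaddC : commutative qadd.
Proof. by elim/quotP=> x; elim/quotP=> y; rewrite !qaddE addrC. Qed.
Lemma qadd0 : left_id (qpi 0) qadd.
Proof. by elim/quotP=> x; rewrite qaddE add0r. Qed.
Lemma qaddN : left_inverse (qpi 0) qopp qadd.
Proof. by elim/quotP=> x; rewrite qoppE qaddE addNr. Qed.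

HB.instance Definition _ := GRing.isZmodule.Build quot qaddA qaddC qadd0 qaddN.

Lemma qpiD x y : qpi x + qpi y = qpi (x + y).
Proof. exact: qaddE. Qed.

Lemma qscaleA a b p : qscale a (qscale b p) = qscale (a * b) p.
Proof. by elim/quotP: p => x; rewrite !qscaleE scalerA. Qed.
Lemma qscale1 : left_id 1 qscale.
Proof. by elim/quotP=> x; rewrite qscaleE scale1r. Qed.
Lemma qscaleDr : right_distributive qscale +%R.
Proof.
move=> a; elim/quotP=> x; elim/quotP=> y.
by rewrite qpiD !qscaleE qpiD scalerDr.
Qed.
Lemma qscaleDl p : {morph qscale^~ p : a b / a + b}.
Proof. by elim/quotP: p => x a b; rewrite !qscaleE qpiD scalerDl. Qed.

HB.instance Definition _ := GRing.Zmodule_isLmodule.Build F2 quot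
  qscaleA qscale1 qscaleDr qscaleDl.

Lemma qpiZ a x : a *: qpi x = qpi (a *: x).
Proof. exact: qscaleE. Qed.

Lemma qpi_lin : linear qpi.
Proof. by move=> a x y; rewrite qpiZ qpiD. Qed.

Lemma qpi0 x : span G x -> qpi x = 0.
Proof. by move=> h; rewrite -(lin0 qpi_lin); apply/qpi_eq; rewrite subr0. Qed.

Lemma qpi_eq0 x : qpi x = 0 -> span G x.
Proof. by rewrite -(lin0 qpi_lin) => /qpi_eq; rewrite subr0. Qed.

Variable W : lmodType F2.

Definition qlift (f : V -> W) (q : quot) : W := f (repr q).

Lemma qliftE (f : V -> W) : linear f -> (forall g, G g -> f g = 0) ->
  forall x, qlift f (qpi x) = f x.
Proof.
move=> lf f0 x; apply/eqP; rewrite /qlift -subr_eq0 -(linB lf); apply/eqP.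
have fS y : span G y -> f y = 0.
  elim=> [|a g z Gg _ IH]; first exact: lin0.
  by rewrite lf f0 // IH scaler0 addr0.
exact/fS/repr_qpi.
Qed.

Lemma qlift_lin (f : V -> W) : linear f -> (forall g, G g -> f g = 0) ->
  linear (qlift f).
Proof.
move=> lf f0 a; elim/quotP=> x; elim/quotP=> y.
by rewrite -qpi_lin !(qliftE lf f0) lf.
Qed.

Lemma quot_ext (f g : quot -> W) :
  (forall x, f (qpi x) = g (qpi x)) -> forall q, f q = g q.
Proof. by move=> h; elim/quotP. Qed.

End Quotient.

Lemma fglift_lin (X : choiceType) (W : lmodType F2) (f : X -> W) :
  linear (fglift f : {freeg X / F2} -> W).
Proof.
apply: additive_linear => x y.
have fB := @lift_is_additive _ _ _ f.
have f0 : fglift f (0 : {freeg X / F2}) = 0 by rewrite -(subrr 0) fB subrr.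
have fN z : fglift f (- z) = - fglift f z by rewrite -sub0r fB f0 sub0r.
by rewrite -{1}[y]opprK fB fN opprK.
Qed.

Lemma fgliftE (X : choiceType) (W : lmodType F2) (f : X -> W) x :
  fglift f (<<x>> : {freeg X / F2}) = f x.
Proof. by rewrite liftU scale1r. Qed.

Lemma freeg_span (X : choiceType) (D : {freeg X / F2}) :
  span (fun y => exists x, y = <<x>>) D.
Proof.
rewrite -[D]freeg_sumE; elim: (dom D) => [|x s IH].
  by rewrite big_nil; apply: span0.
rewrite big_cons; set S := \sum_(_ <- _) _ in IH *.
suff -> : << coeff x D *g x >> = coeff x D *: (<<x>> : {freeg X / F2}).
  by apply: span_cons IH; exists x.
apply/eqP/freeg_eqP=> y; rewrite coeffZ !coeffU.
by rewrite mul1r.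
Qed.

Lemma span_ext (U V : lmodType F2) (f g : U -> V) G : linear f -> linear g ->
  (forall x, G x -> f x = g x) -> forall x, span G x -> f x = g x.
Proof.
move=> lf lg h x; elim=> [|a y z Gy _ IH]; first by rewrite !lin0.
by rewrite lf lg h // IH.
Qed.

(* The tensor product over F2: finite formal sums of pairs modulo the bilinear
   relations. *)
Section Tensor.
Variables M N : lmodType F2.

Inductive tens_rel : {freeg (M * N)%type / F2} -> Prop :=
| tens_rell a x x' y : tens_rel
    (<<(a *: x + x', y)>> - (a *: <<(x, y)>> + <<(x', y)>>))
| tens_relr a x y y' : tens_rel
    (<<(x, a *: y + y')>> - (a *: <<(x, y)>> + <<(x, y')>>)).

Definition tens := quot tens_rel.
HB.instance Definition _ := GRing.Lmodule.on tens.

Definition tpure (x : M) (y : N) : tens := qpi tens_rel <<(x, y)>>.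

Lemma tpure_bilin : bilinear tpure.
Proof.
split=> [y a x x'|x a y y']; rewrite /tpure -qpi_lin; apply/qpi_eq.
  exact/span_gen/tens_rell.
exact/span_gen/tens_relr.
Qed.

Lemma tens_span (t : tens) : span (fun u => exists x y, u = tpure x y) t.
Proof.
elim/quotP: t => D; apply: (span_map (@qpi_lin _ _)) (freeg_span D).
by move=> _ [[x y] ->]; apply: span_gen; exists x, y.
Qed.

Variable W : lmodType F2.

Definition tlift (f : M -> N -> W) : tens -> W :=
  qlift (fglift (fun xy => f xy.1 xy.2)).

Lemma tlift_rel (f : M -> N -> W) : bilinear f -> forall g, tens_rel g ->
  fglift (fun xy => f xy.1 xy.2) g = 0.
Proof.
move=> [f1 f2] g [a x x' y|a x y y'];
  rewrite (linB (fglift_lin _)) fglift_lin !fgliftE /=.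
  by rewrite (f1 y) subrr.
by rewrite (f2 x) subrr.
Qed.

Lemma tliftE (f : M -> N -> W) : bilinear f -> forall x y, tlift f (tpure x y) = f x y.
Proof.
move=> bf x y; rewrite /tlift qliftE ?fgliftE //; first exact: fglift_lin.
exact: tlift_rel.
Qed.

Lemma tlift_lin (f : M -> N -> W) : bilinear f -> linear (tlift f).
Proof. by move=> bf; apply: qlift_lin (fglift_lin _) (tlift_rel bf). Qed.

Lemma tens_ext (f g : tens -> W) : linear f -> linear g ->
  (forall x y, f (tpure x y) = g (tpure x y)) -> forall t, f t = g t.
Proof.
move=> lf lg h t; apply: (span_ext lf lg) (tens_span t).
by move=> _ [x [y ->]].
Qed.

End Tensor.

Section QuotientMap.
Variables (V W : lmodType F2) (G : V -> Prop) (H : W -> Prop) (f : V -> W).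
Hypotheses (lf : linear f) (GH : forall g, G g -> span H (f g)).

Definition qmap : quot G -> quot H := qlift (fun x => qpi H (f x)).

Lemma qmap_pre_lin : linear (fun x => qpi H (f x)).
Proof. by move=> a x y; rewrite lf qpi_lin. Qed.

Lemma qmap_pre0 g : G g -> qpi H (f g) = 0.
Proof. by move=> /GH; apply: qpi0. Qed.

Lemma qmapE x : qmap (qpi G x) = qpi H (f x).
Proof. exact: (qliftE qmap_pre_lin qmap_pre0). Qed.

Lemma qmap_lin : linear qmap.
Proof. exact: (qlift_lin qmap_pre_lin qmap_pre0). Qed.

End QuotientMap.

Section TensorMap.
Variables (M N M' N' : lmodType F2) (f : M -> M') (g : N -> N').
Hypotheses (lf : linear f) (lg : linear g).

Definition tmap : tens M N -> tens M' N' := tlift (fun x y => tpure (f x) (g y)).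

Lemma tmap_bilin : bilinear (fun x y => tpure (f x) (g y)).
Proof.
have [l1 l2] := @tpure_bilin M' N'.
by split=> [y a x x'|x a y y']; rewrite ?lf ?lg ?l1 ?l2.
Qed.

Lemma tmapE x y : tmap (tpure x y) = tpure (f x) (g y).
Proof. exact: (tliftE tmap_bilin). Qed.

Lemma tmap_lin : linear tmap.
Proof. exact: tlift_lin tmap_bilin. Qed.

End TensorMap.

(* Complexes of F2-vector spaces, graded internally: the carrier is the direct
   sum of its homogeneous pieces, and cmp n is the projection onto the piece of
   degree n. *)
Record cplx := Cplx {
  cx :> lmodType F2;
  dif : cx -> cx;
  cmp : int -> cx -> cx;
  dif_lin : linear dif;
  dif_dif : forall x, dif (dif x) = 0;
  cmp_lin : forall n, linear (cmp n);
  cmp_cmp : forall m n x, cmp m (cmp n x) = if m == n then cmp n x else 0;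
  cmp_sum : forall x, exists2 s : seq int, uniq s & x = \sum_(n <- s) cmp n x;
  dif_cmp : forall n x, dif (cmp n x) = cmp (n - 1) (dif x) }.

Arguments dif {c}.
Arguments cmp {c}.

Definition hom (C : cplx) (n : int) (x : C) : Prop := cmp n x = x.

Section Homogeneous.
Variable C : cplx.
Implicit Types (x y : C) (s : seq int).

Lemma hom_cmp n x : hom n (cmp n x).
Proof. by rewrite /hom cmp_cmp eqxx. Qed.

Lemma cmp_hom m n x : hom n x -> cmp m x = if m == n then x else 0.
Proof. by move=> h; rewrite -{1}h cmp_cmp h. Qed.

Lemma hom_lin n a x y : hom n x -> hom n y -> hom n (a *: x + y).
Proof. by rewrite /hom cmp_lin => -> ->. Qed.

Lemma hom0 n : hom n (0 : C).
Proof. exact: (lin0 (cmp_lin n)). Qed.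

Lemma hom_dif n x : hom n x -> hom (n - 1) (dif x).
Proof. by move=> h; rewrite /hom -dif_cmp h. Qed.

Lemma hom_ind (P : C -> Prop) : P 0 ->
  (forall a x y, P x -> P y -> P (a *: x + y)) ->
  (forall n x, hom n x -> P x) -> forall x, P x.
Proof.
move=> P0 Pl Ph x; have [s _ ->] := cmp_sum x.
elim: s => [|n s IH]; first by rewrite big_nil.
rewrite big_cons -[cmp n x]scale1r; apply: Pl IH.
exact/Ph/hom_cmp.
Qed.

Lemma cmp_out s x n : x = \sum_(m <- s) cmp m x -> n \notin s -> cmp n x = 0.
Proof.
move=> -> ns; rewrite lin_sum; last exact: cmp_lin.
rewrite big_seq big1 // => m ms; rewrite cmp_cmp.
by case: eqP ms ns => // -> ->.
Qed.

Variables (W : lmodType F2) (F : int -> C -> W).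
Hypothesis lF : forall n, linear (F n).

Definition hsupp x : seq int := s2val (cid2 (cmp_sum x)).

Definition hsum x : W := \sum_(n <- hsupp x) F n (cmp n x).

Lemma hsumE s x : uniq s -> (forall n, n \notin s -> cmp n x = 0) ->
  hsum x = \sum_(n <- s) F n (cmp n x).
Proof.
move=> us xs; rewrite /hsum /hsupp; case: cid2 => /= t ut xt.
rewrite (bigID (fun n => cmp n x != 0)) /= addrC big1 ?add0r; last first.
  by move=> n /negPn /eqP ->; rewrite lin0.
rewrite [RHS](bigID (fun n => cmp n x != 0)) /= [RHS]addrC [X in _ = X + _]big1.
  rewrite add0r -big_filter -[RHS]big_filter; apply: perm_big.
  apply: uniq_perm; rewrite ?filter_uniq // => n; rewrite !mem_filter.
  case: (eqVneq (cmp n x) 0) => //= nx.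
  case: (boolP (n \in t)) => nt.
    by case: (boolP (n \in s)) => // /xs e; rewrite e eqxx in nx.
  by rewrite (cmp_out xt nt) eqxx in nx.
by move=> n /negPn /eqP ->; rewrite lin0.
Qed.

Lemma hsum_lin : linear hsum.
Proof.
move=> a x y.
have [s us xs] := cmp_sum x; have [t ut yt] := cmp_sum y.
pose u := undup (s ++ t).
have uu : uniq u by exact: undup_uniq.
have ux n : n \notin u -> cmp n x = 0.
  by rewrite mem_undup mem_cat negb_or => /andP [ns _]; apply: cmp_out xs ns.
have uy n : n \notin u -> cmp n y = 0.
  by rewrite mem_undup mem_cat negb_or => /andP [_ nt]; apply: cmp_out yt nt.
rewrite (hsumE uu ux) (hsumE uu uy) (hsumE uu); last first.
  by move=> n nu; rewrite cmp_lin ux // uy // scaler0 addr0.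
rewrite scaler_sumr -big_split; apply: eq_bigr => n _ /=.
by rewrite cmp_lin lF.
Qed.

Lemma hsum_hom n x : hom n x -> hsum x = F n x.
Proof.
move=> h; rewrite (@hsumE [:: n]) ?big_seq1 ?h // => m.
by rewrite inE => /negbTE mn; rewrite (cmp_hom _ h) mn.
Qed.

End Homogeneous.

Lemma span_cmp_sum (V : lmodType F2) (c : int -> V -> V) :
  (forall n, linear (c n)) ->
  (forall m n x, c m (c n x) = if m == n then c n x else 0) ->
  forall x, span (fun y => exists n, c n y = y) x ->
  exists2 s : seq int, uniq s & x = \sum_(n <- s) c n x.
Proof.
move=> lc cc x; elim=> [|a y z [n ny] _ [s us zs]].
  by exists [::]; rewrite ?big_nil.
have cn m : c m y = if m == n then y else 0 by rewrite -{1}ny cc ny.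
exists (undup (n :: s)); first exact: undup_uniq.
under eq_bigr do rewrite lc; rewrite big_split -scaler_sumr.
congr (a *: _ + _).
  rewrite (bigD1_seq n) ?undup_uniq ?mem_undup ?mem_head //= ny big1 ?addr0 //.
  by move=> m /negbTE mn; rewrite cn mn.
rewrite [LHS]zs /=; case: ifP => ns; first by rewrite undup_id.
rewrite big_cons undup_id // [c n z in RHS](_ : _ = 0) ?add0r //.
rewrite zs (lin_sum _ _ (lc n)) big_seq big1 // => m ms; rewrite cc.
by case: eqP ms ns => // -> ->.
Qed.

Lemma tens_hom_ext (C D : cplx) (W : lmodType F2) (f g : tens C D -> W) :
  linear f -> linear g ->
  (forall i x y, hom i x -> f (tpure x y) = g (tpure x y)) ->
  forall t, f t = g t.
Proof.
move=> lf lg h; apply: tens_ext => // x y; move: x.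
have [l1 _] := @tpure_bilin C D.
apply: (hom_ind (P := fun x => f (tpure x y) = g (tpure x y))).
- by rewrite !(lin0 (l1 y)) !lin0.
- by move=> a x x' e e'; rewrite !(l1 y) lf lg e e'.
- by move=> i x hx; apply: h hx.
Qed.

(* The tensor product of complexes over F2; hsum makes sense of the sum over i
   of (cmp i x) (x) (cmp (k - i) y). *)
Section TensorComplex.
Variables C D : cplx.
Local Notation T := (tens C D).

Definition tdif : T -> T :=
  tlift (fun (x : C) (y : D) => tpure (dif x) y + tpure x (dif y)).

Definition tcmp (k : int) : T -> T :=
  tlift (fun (x : C) (y : D) => hsum (fun i x' => tpure x' (cmp (k - i) y)) x).

Let l1 := (@tpure_bilin C D).1.
Let l2 := (@tpure_bilin C D).2.

Lemma tdif_bilin :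
  bilinear (fun (x : C) (y : D) => tpure (dif x) y + tpure x (dif y)).
Proof.
split=> [y a x x'|x a y y']; rewrite dif_lin ?l1 ?l2 scalerDr.
  by rewrite addrACA.
by rewrite addrACA.
Qed.

Lemma tcmp_bilin k : bilinear
  (fun (x : C) (y : D) => hsum (fun i x' => tpure x' (cmp (k - i) y)) x).
Proof.
split=> [y|x a y y']; first by apply: hsum_lin => n; apply: l1.
rewrite /hsum scaler_sumr -big_split; apply: eq_bigr => i _ /=.
by rewrite cmp_lin l2.
Qed.

Lemma tdifE x y : tdif (tpure x y) = tpure (dif x) y + tpure x (dif y).
Proof. exact: tliftE tdif_bilin _ _. Qed.

Lemma tcmpE k i x y : hom i x -> tcmp k (tpure x y) = tpure x (cmp (k - i) y).
Proof.
move=> h; rewrite /tcmp (tliftE (tcmp_bilin k)) (hsum_hom _ h) //.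
Qed.

Lemma tdif_lin : linear tdif.
Proof. exact: tlift_lin tdif_bilin. Qed.

Lemma tcmp_lin k : linear (tcmp k).
Proof. exact: tlift_lin (tcmp_bilin k). Qed.

Lemma tdif_tdif t : tdif (tdif t) = 0.
Proof.
have lz : linear (fun _ : T => 0 : T) by move=> a x y; rewrite scaler0 addr0.
have ld : linear (fun t => tdif (tdif t)) by move=> a x y; rewrite !tdif_lin.
apply: (tens_ext ld lz) => x y.
rewrite tdifE (linD tdif_lin) !tdifE !dif_dif (lin0 (l1 y)) (lin0 (l2 x)).
by rewrite add0r addr0 addxx.
Qed.

Lemma tcmp_tcmp m n t : tcmp m (tcmp n t) = if m == n then tcmp n t else 0.
Proof.
move: t; apply: tens_hom_ext.
- by move=> a x y; rewrite !tcmp_lin.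
- move=> a x y; case: ifP => _; last by rewrite scaler0 addr0.
  by rewrite tcmp_lin.
move=> i x y h; rewrite !(tcmpE _ _ h) cmp_cmp.
rewrite (inj_eq (addIr (- i))); case: ifP => // _.
by rewrite (lin0 (l2 x)).
Qed.

Lemma tcmp_sum t : exists2 s : seq int, uniq s & t = \sum_(n <- s) tcmp n t.
Proof.
apply: (span_cmp_sum tcmp_lin tcmp_tcmp).
set P := (fun _ => _); suff H x y : span P (tpure x y).
  elim: (tens_span t) => [|a g z [x [y ->]] _ IH]; first exact: span0.
  exact: span_lin (H x y) IH.
move: x; apply: hom_ind => [|a x x' hx hx'|i x hx].
- by rewrite (lin0 (l1 y)); apply: span0.
- by rewrite l1; apply: span_lin hx hx'.
move: y; apply: hom_ind => [|a y y' hy hy'|j y hy].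
- by rewrite (lin0 (l2 x)); apply: span0.
- by rewrite l2; apply: span_lin hy hy'.
by apply: span_gen; exists (j + i); rewrite (tcmpE _ _ hx) addrK hy.
Qed.

Lemma tdif_tcmp n t : tdif (tcmp n t) = tcmp (n - 1) (tdif t).
Proof.
move: t; apply: tens_hom_ext.
- by move=> a x y; rewrite tcmp_lin tdif_lin.
- by move=> a x y; rewrite tdif_lin tcmp_lin.
move=> i x y h; rewrite (tcmpE _ _ h) !tdifE (linD (tcmp_lin _)).
rewrite (tcmpE _ _ h) (tcmpE _ _ (hom_dif h)) dif_cmp.
have -> : n - 1 - (i - 1) = n - i by rewrite opprB addrA subrK.
by rewrite (addrAC n).
Qed.

Definition tens_cplx : cplx :=
  Cplx tdif_lin tdif_tdif tcmp_lin tcmp_tcmp tcmp_sum tdif_tcmp.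

Lemma dif_tpure x y :
  dif (tpure x y : tens_cplx) = tpure (dif x) y + tpure x (dif y).
Proof. exact: tdifE. Qed.

Lemma cmp_tpure k i x y : hom i x ->
  cmp k (tpure x y : tens_cplx) = tpure x (cmp (k - i) y).
Proof. exact: tcmpE. Qed.

End TensorComplex.

Section QuotientComplex.
Variables (C : cplx) (G : C -> Prop).
Hypotheses (Gd : forall g, G g -> span G (dif g))
           (Gc : forall n g, G g -> span G (cmp n g)).

Definition qdif : quot G -> quot G := @qmap _ _ G G dif.
Definition qcmp (n : int) : quot G -> quot G := @qmap _ _ G G (cmp n).

Lemma qdif_lin : linear qdif.
Proof. exact: qmap_lin (@dif_lin C) Gd. Qed.

Lemma qcmp_lin n : linear (qcmp n).
Proof. exact: qmap_lin (@cmp_lin C n) (Gc n). Qed.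

Lemma qdifE x : qdif (qpi G x) = qpi G (dif x).
Proof. exact: (qmapE (@dif_lin C) Gd). Qed.

Lemma qcmpE n x : qcmp n (qpi G x) = qpi G (cmp n x).
Proof. exact: (qmapE (@cmp_lin C n) (Gc n)). Qed.

Lemma qdif_qdif q : qdif (qdif q) = 0.
Proof. by elim/quotP: q => x; rewrite !qdifE dif_dif (lin0 (@qpi_lin _ _)). Qed.

Lemma qcmp_qcmp m n q : qcmp m (qcmp n q) = if m == n then qcmp n q else 0.
Proof.
by elim/quotP: q => x; rewrite !qcmpE cmp_cmp; case: ifP.
Qed.

Lemma qcmp_sum q : exists2 s : seq int, uniq s & q = \sum_(n <- s) qcmp n q.
Proof.
elim/quotP: q => x; have [s us xs] := cmp_sum x; exists s => //.
rewrite {1}xs (lin_sum _ _ (@qpi_lin _ _)).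
by apply: eq_bigr => n _; rewrite qcmpE.
Qed.

Lemma qdif_qcmp n q : qdif (qcmp n q) = qcmp (n - 1) (qdif q).
Proof. by elim/quotP: q => x; rewrite qcmpE !qdifE qcmpE dif_cmp. Qed.

Definition quot_cplx : cplx :=
  Cplx qdif_lin qdif_qdif qcmp_lin qcmp_qcmp qcmp_sum qdif_qcmp.

Lemma dif_qpi x : dif (qpi G x : quot_cplx) = qpi G (dif x).
Proof. exact: qdifE. Qed.

Lemma cmp_qpi n x : cmp n (qpi G x : quot_cplx) = qpi G (cmp n x).
Proof. exact: qcmpE. Qed.

End QuotientComplex.

(* dg algebras over F2 (differential of degree -1); the zero algebra is allowed,
   which the algType structure would exclude. *)
Record dgAlg := DgAlg {
  dga :> cplx;
  dgmul : dga -> dga -> dga;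
  dgone : dga;
  dgmul_bilin : bilinear dgmul;
  dgmulA : associative dgmul;
  dgmul1l : left_id dgone dgmul;
  dgmul1r : right_id dgone dgmul;
  dgmul_dif : forall a b, dif (dgmul a b) = dgmul (dif a) b + dgmul a (dif b);
  dgmul_hom : forall i j a b, hom i a -> hom j b -> hom (i + j) (dgmul a b);
  dgone_hom : hom 0 dgone }.

Arguments dgmul {d}.
Arguments dgone {d}.

Record dgBimod (A : dgAlg) := DgBimod {
  bimod :> cplx;
  lact : A -> bimod -> bimod;
  ract : bimod -> A -> bimod;
  lact_bilin : bilinear lact;
  ract_bilin : bilinear ract;
  lactA : forall a b x, lact a (lact b x) = lact (dgmul a b) x;
  lact1 : forall x, lact dgone x = x;
  ractA : forall x a b, ract (ract x a) b = ract x (dgmul a b);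
  ract1 : forall x, ract x dgone = x;
  lractC : forall a x b, ract (lact a x) b = lact a (ract x b);
  lact_dif : forall a x, dif (lact a x) = lact (dif a) x + lact a (dif x);
  ract_dif : forall x a, dif (ract x a) = ract (dif x) a + ract x (dif a);
  lact_hom : forall i j a x, hom i a -> hom j x -> hom (i + j) (lact a x);
  ract_hom : forall i j x a, hom i x -> hom j a -> hom (i + j) (ract x a) }.

Arguments lact {A d}.
Arguments ract {A d}.

Definition reg_bimod (A : dgAlg) : dgBimod A :=
  @DgBimod A A dgmul dgmul (@dgmul_bilin A) (@dgmul_bilin A)
    (fun a b x => dgmulA a b x) (@dgmul1l A) (fun x a b => esym (dgmulA x a b))
    (@dgmul1r A) (fun a x b => esym (dgmulA a x b)) (@dgmul_dif A)
    (@dgmul_dif A) (@dgmul_hom A) (@dgmul_hom A).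

Section Bimodules.
Variable A : dgAlg.

Lemma lact_cmp (M : dgBimod A) k i (a : A) (x : M) : hom i a ->
  cmp k (lact a x) = lact a (cmp (k - i) x).
Proof.
move=> ha; have [_ l2] := lact_bilin M; move: x; apply: hom_ind.
- by rewrite !(lin0 (l2 a), lin0 (@cmp_lin _ _)).
- by move=> b x y ex ey; rewrite !(l2 a, @cmp_lin _ _) ex ey.
move=> j x hx; rewrite (cmp_hom _ hx) (cmp_hom _ (lact_hom ha hx)).
rewrite subr_eq addrC; case: ifP => // _; by rewrite (lin0 (l2 a)).
Qed.

Lemma ract_cmp (M : dgBimod A) k i (x : M) (a : A) : hom i a ->
  cmp k (ract x a) = ract (cmp (k - i) x) a.
Proof.
move=> ha; have [l1 _] := ract_bilin M; move: x; apply: hom_ind.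
- by rewrite !(lin0 (l1 a), lin0 (@cmp_lin _ _)).
- by move=> b x y ex ey; rewrite !(l1 a, @cmp_lin _ _) ex ey.
move=> j x hx; rewrite (cmp_hom _ hx) (cmp_hom _ (ract_hom hx ha)).
by rewrite subr_eq; case: ifP => // _; rewrite (lin0 (l1 a)).
Qed.

(* M (x) N over F2, with A acting through the left action on M and the right
   action on N. *)
Section Outer.
Variables M N : dgBimod A.
Local Notation T := (tens_cplx M N).

Definition olact (a : A) : T -> T := tmap (lact a) id.
Definition oract (t : T) (a : A) : T := tmap id (fun y : N => ract y a) t.

Let l1 := (@tpure_bilin M N).1.
Let l2 := (@tpure_bilin M N).2.
Let idl (V : lmodType F2) : linear (@id V). Proof. by []. Qed.
Let ll a := (lact_bilin M).2 a.
Let rr a := (ract_bilin N).1 a.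

Lemma olactE a (x : M) (y : N) : olact a (tpure x y) = tpure (lact a x) y.
Proof. exact: tmapE (ll a) (@idl N) _ _. Qed.
Lemma oractE a (x : M) (y : N) : oract (tpure x y) a = tpure x (ract y a).
Proof. exact: tmapE (@idl M) (rr a) _ _. Qed.
Lemma olact_lin a : linear (olact a).
Proof. exact: tmap_lin (ll a) (@idl N). Qed.
Lemma oract_lin a : linear (oract^~ a).
Proof. exact: tmap_lin (@idl M) (rr a). Qed.

Lemma olact_bilin : bilinear olact.
Proof.
split=> [t b a a'|]; last exact: olact_lin.
apply: (tens_ext (f := fun t => olact (b *: a + a') t)
  (g := fun t => b *: olact a t + olact a' t)); first exact: olact_lin.
  move=> c x y; rewrite !olact_lin !scalerDr !scalerA (mulrC b c).
  by rewrite addrACA.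
by move=> x y; rewrite !olactE (lact_bilin M).1 l1.
Qed.

Lemma oract_bilin : bilinear oract.
Proof.
split=> [|t b a a']; first exact: oract_lin.
apply: (tens_ext (f := fun t => oract t (b *: a + a'))
  (g := fun t => b *: oract t a + oract t a')); first exact: oract_lin.
  move=> c x y; rewrite !oract_lin !scalerDr !scalerA (mulrC b c).
  by rewrite addrACA.
by move=> x y; rewrite !oractE (ract_bilin N).2 l2.
Qed.

Lemma olactA a b t : olact a (olact b t) = olact (dgmul a b) t.
Proof.
move: t; apply: tens_ext; last by move=> x y; rewrite !olactE lactA.
  by move=> c x y; rewrite !olact_lin.
exact: olact_lin.
Qed.

Lemma olact1 t : olact dgone t = t.
Proof.
move: t; apply: tens_ext => [|//|x y]; first exact: olact_lin.
by rewrite olactE lact1.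
Qed.

Lemma oractA t a b : oract (oract t a) b = oract t (dgmul a b).
Proof.
move: t; apply: tens_ext; last by move=> x y; rewrite !oractE ractA.
  by move=> c x y; rewrite !oract_lin.
exact: oract_lin.
Qed.

Lemma oract1 t : oract t dgone = t.
Proof.
move: t; apply: tens_ext => [|//|x y]; first exact: oract_lin.
by rewrite oractE ract1.
Qed.

Lemma olractC a t b : oract (olact a t) b = olact a (oract t b).
Proof.
move: t; apply: tens_ext; last by move=> x y; rewrite !(oractE, olactE).
  by move=> c x y; rewrite olact_lin oract_lin.
by move=> c x y; rewrite oract_lin olact_lin.
Qed.

Lemma olact_dif a t : dif (olact a t) = olact (dif a) t + olact a (dif t).
Proof.
move: t; apply: tens_ext.
- by move=> c x y; rewrite olact_lin dif_lin.
- by move=> c x y; rewrite dif_lin !olact_lin scalerDr addrACA.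
move=> x y; rewrite olactE !dif_tpure (linD (olact_lin _)) !olactE lact_dif.
by rewrite (linD (l1 y)) addrA.
Qed.

Lemma oract_dif t a : dif (oract t a) = oract (dif t) a + oract t (dif a).
Proof.
move: t; apply: tens_ext.
- by move=> c x y; rewrite oract_lin dif_lin.
- by move=> c x y; rewrite dif_lin !oract_lin scalerDr addrACA.
move=> x y; rewrite oractE !dif_tpure (linD (oract_lin _)) !oractE ract_dif.
by rewrite (linD (l2 x)) addrA.
Qed.

Lemma olact_cmp k i a t : hom i a -> cmp k (olact a t) = olact a (cmp (k - i) t).
Proof.
move=> ha; move: t; apply: tens_hom_ext.
- by move=> c x y; rewrite olact_lin cmp_lin.
- by move=> c x y; rewrite cmp_lin olact_lin.
move=> j x y hx; rewrite olactE (cmp_tpure _ _ (lact_hom ha hx)) (cmp_tpure _ _ hx).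
by rewrite olactE opprD addrA.
Qed.

Lemma oract_cmp k i t a : hom i a -> cmp k (oract t a) = oract (cmp (k - i) t) a.
Proof.
move=> ha; move: t; apply: tens_hom_ext.
- by move=> c x y; rewrite oract_lin cmp_lin.
- by move=> c x y; rewrite cmp_lin oract_lin.
move=> j x y hx; rewrite oractE !(cmp_tpure _ _ hx) oractE (ract_cmp _ _ ha).
by rewrite addrAC.
Qed.

Lemma olact_hom i j a (t : T) : hom i a -> hom j t -> hom (i + j) (olact a t : T).
Proof. by move=> ha ht; rewrite /hom (olact_cmp _ _ ha) addrAC subrr add0r ht. Qed.

Lemma oract_hom i j (t : T) a : hom i t -> hom j a -> hom (i + j) (oract t a : T).
Proof. by move=> ht ha; rewrite /hom (oract_cmp _ _ ha) addrK ht. Qed.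

Definition outer_bimod : dgBimod A :=
  DgBimod olact_bilin oract_bilin olactA olact1 oractA oract1 olractC
    olact_dif oract_dif olact_hom oract_hom.

End Outer.

Section QuotientBimod.
Variables (M : dgBimod A) (G : M -> Prop).
Hypotheses (Gd : forall g, G g -> span G (dif g))
           (Gc : forall n g, G g -> span G (cmp n g))
           (Gl : forall a g, G g -> span G (lact a g))
           (Gr : forall a g, G g -> span G (ract g a)).
Local Notation Q := (quot_cplx Gd Gc).

Definition qlact (a : A) : Q -> Q := @qmap _ _ G G (lact a).
Definition qract (q : Q) (a : A) : Q := @qmap _ _ G G (fun x => ract x a) q.

Let ll a := (lact_bilin M).2 a.
Let rr a := (ract_bilin M).1 a.

Lemma qlactE a x : qlact a (qpi G x) = qpi G (lact a x).
Proof. exact: (qmapE (ll a) (Gl a)). Qed.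
Lemma qractE a x : qract (qpi G x) a = qpi G (ract x a).
Proof. exact: (qmapE (rr a) (Gr a)). Qed.

Lemma qlact_bilin : bilinear qlact.
Proof.
split=> [q b a a'|a]; last exact: qmap_lin (ll a) (Gl a).
by elim/quotP: q => x; rewrite !qlactE (lact_bilin M).1 qpi_lin.
Qed.
Lemma qract_bilin : bilinear qract.
Proof.
split=> [a|q b a a']; first exact: qmap_lin (rr a) (Gr a).
by elim/quotP: q => x; rewrite !qractE (ract_bilin M).2 qpi_lin.
Qed.
Lemma qlactA a b q : qlact a (qlact b q) = qlact (dgmul a b) q.
Proof. by elim/quotP: q => x; rewrite !qlactE lactA. Qed.
Lemma qlact1 q : qlact dgone q = q.
Proof. by elim/quotP: q => x; rewrite qlactE lact1. Qed.
Lemma qractA q a b : qract (qract q a) b = qract q (dgmul a b).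
Proof. by elim/quotP: q => x; rewrite !qractE ractA. Qed.
Lemma qract1 q : qract q dgone = q.
Proof. by elim/quotP: q => x; rewrite qractE ract1. Qed.
Lemma qlractC a q b : qract (qlact a q) b = qlact a (qract q b).
Proof. by elim/quotP: q => x; rewrite !(qlactE, qractE) lractC. Qed.
Lemma qlact_dif a (q : Q) : dif (qlact a q) = qlact (dif a) q + qlact a (dif q).
Proof.
by elim/quotP: q => x; rewrite qlactE !dif_qpi !qlactE lact_dif (linD (@qpi_lin _ _)).
Qed.
Lemma qract_dif (q : Q) a : dif (qract q a) = qract (dif q) a + qract q (dif a).
Proof.
by elim/quotP: q => x; rewrite qractE !dif_qpi !qractE ract_dif (linD (@qpi_lin _ _)).
Qed.
Lemma qlact_hom i j a (q : Q) : hom i a -> hom j q -> hom (i + j) (qlact a q : Q).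
Proof.
move=> ha; rewrite /hom; elim/quotP: q => x hx; rewrite -hx [cmp j _]cmp_qpi.
rewrite qlactE [LHS]cmp_qpi; congr qpi.
exact: (lact_hom ha (hom_cmp _ _)).
Qed.
Lemma qract_hom i j (q : Q) a : hom i q -> hom j a -> hom (i + j) (qract q a : Q).
Proof.
move=> hq ha; move: hq; rewrite /hom; elim/quotP: q => x hx.
rewrite -hx [cmp i _]cmp_qpi qractE [LHS]cmp_qpi; congr qpi.
exact: (ract_hom (hom_cmp _ _) ha).
Qed.

Definition quot_bimod : dgBimod A :=
  DgBimod qlact_bilin qract_bilin qlactA qlact1 qractA qract1 qlractC
    qlact_dif qract_dif qlact_hom qract_hom.

Lemma lact_qpi a x : lact a (qpi G x : quot_bimod) = qpi G (lact a x).
Proof. exact: qlactE. Qed.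

Lemma ract_qpi a x : ract (qpi G x : quot_bimod) a = qpi G (ract x a).
Proof. exact: qractE. Qed.

End QuotientBimod.

(* bal_rel cuts M (x) N down to M (x)_A N; hc_rel cuts R (x) M down to HC(M),
   which is hc_cplx R M for a resolution R of A. *)
Section Relations.
Variables M N : dgBimod A.
Local Notation T := (tens_cplx M N).

Inductive bal_rel : T -> Prop :=
| BalRel (x : M) (a : A) (y : N) :
    bal_rel (tpure (ract x a) y - tpure x (lact a y)).

Inductive hc_rel : T -> Prop :=
| HcBal (x : M) (a : A) (y : N) :
    hc_rel (tpure (ract x a) y - tpure x (lact a y))
| HcCyc (x : M) (a : A) (y : N) :
    hc_rel (tpure (lact a x) y - tpure x (ract y a)).

Let l1 := (@tpure_bilin M N).1.
Let l2 := (@tpure_bilin M N).2.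

Lemma bal_rel_dif g : bal_rel g -> span bal_rel (dif g).
Proof.
case=> x a y; rewrite (linB (@dif_lin T)) !dif_tpure ract_dif lact_dif.
rewrite (linD (l1 y)) (linD (l2 x)).
set p := tpure (ract (dif x) a) y; set q := tpure (ract x (dif a)) y.
set r := tpure (ract x a) (dif y); set p' := tpure (dif x) (lact a y).
set q' := tpure x (lact (dif a) y); set r' := tpure x (lact a (dif y)).
have -> : p + q + r - (p' + (q' + r')) = (p - p') + (q - q') + (r - r').
  by rewrite (addrA p') !opprD addrACA (addrACA p q).
by apply: spanD; first apply: spanD; apply/span_gen/BalRel.
Qed.

Lemma hc_rel_dif g : hc_rel g -> span hc_rel (dif g).
Proof.
case=> x a y; rewrite (linB (@dif_lin T)) !dif_tpure ract_dif lact_dif.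
  rewrite (linD (l1 y)) (linD (l2 x)).
  set p := tpure (ract (dif x) a) y; set q := tpure (ract x (dif a)) y.
  set r := tpure (ract x a) (dif y); set p' := tpure (dif x) (lact a y).
  set q' := tpure x (lact (dif a) y); set r' := tpure x (lact a (dif y)).
  have -> : p + q + r - (p' + (q' + r')) = (p - p') + (q - q') + (r - r').
    by rewrite (addrA p') !opprD addrACA (addrACA p q).
  by apply: spanD; first apply: spanD; apply/span_gen/HcBal.
rewrite (linD (l1 y)) (linD (l2 x)).
set p := tpure (lact (dif a) x) y; set q := tpure (lact a (dif x)) y.
set r := tpure (lact a x) (dif y); set q' := tpure (dif x) (ract y a).
set r' := tpure x (ract (dif y) a); set p' := tpure x (ract y (dif a)).
have -> : p + q + r - (q' + (r' + p')) = (p - p') + (q - q') + (r - r').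
  rewrite (addrC r') (addrA q') (addrC q').
  by rewrite !opprD addrACA (addrACA p q).
by apply: spanD; first apply: spanD; apply/span_gen/HcCyc.
Qed.

Lemma span_lin_hom (C : cplx) (G : T -> Prop) (f : C -> T) : linear f ->
  (forall i x, hom i x -> span G (f x)) -> forall x, span G (f x).
Proof.
move=> lf h; apply: hom_ind => [|a x y hx hy|//].
  by rewrite (lin0 lf); apply: span0.
by rewrite lf; apply: span_lin.
Qed.

Lemma bal_lin_x (a : A) (y : N) :
  linear (fun x : M => tpure (ract x a) y - tpure x (lact a y)).
Proof.
move=> b x x'; rewrite (ract_bilin M).1 !l1 scalerBr opprD.
by rewrite addrACA.
Qed.
Lemma bal_lin_a (x : M) (y : N) :
  linear (fun a : A => tpure (ract x a) y - tpure x (lact a y)).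
Proof.
move=> b a a'; rewrite (ract_bilin M).2 (lact_bilin N).1 l1 l2 scalerBr opprD.
by rewrite addrACA.
Qed.
Lemma cyc_lin_x (a : A) (y : N) :
  linear (fun x : M => tpure (lact a x) y - tpure x (ract y a)).
Proof.
move=> b x x'; rewrite (lact_bilin M).2 !l1 scalerBr opprD.
by rewrite addrACA.
Qed.
Lemma cyc_lin_a (x : M) (y : N) :
  linear (fun a : A => tpure (lact a x) y - tpure x (ract y a)).
Proof.
move=> b a a'; rewrite (lact_bilin M).1 (ract_bilin N).2 l1 l2 scalerBr opprD.
by rewrite addrACA.
Qed.

Lemma bal_cmp n i j x a y : hom i x -> hom j a ->
  cmp n (tpure (ract x a) y - tpure x (lact a y) : T) =
  tpure (ract x a) (cmp (n - (i + j)) y) -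
  tpure x (lact a (cmp (n - (i + j)) y)).
Proof.
move=> hx ha; rewrite (linB (@cmp_lin T n)) (cmp_tpure _ _ (ract_hom hx ha)).
by rewrite (cmp_tpure _ _ hx) (lact_cmp _ _ ha) opprD addrA.
Qed.

Lemma cyc_cmp n i j x a y : hom i x -> hom j a ->
  cmp n (tpure (lact a x) y - tpure x (ract y a) : T) =
  tpure (lact a x) (cmp (n - (i + j)) y) -
  tpure x (ract (cmp (n - (i + j)) y) a).
Proof.
move=> hx ha; rewrite (linB (@cmp_lin T n)) (cmp_tpure _ _ (lact_hom ha hx)).
by rewrite (cmp_tpure _ _ hx) (ract_cmp _ _ ha) (addrC j) opprD addrA.
Qed.

Lemma bal_rel_cmp n g : bal_rel g -> span bal_rel (cmp n g).
Proof.
case=> x a y; move: x; apply: span_lin_hom => [b x x'|i x hx].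
  by rewrite bal_lin_x cmp_lin.
move: a; apply: span_lin_hom => [b a a'|j a ha].
  by rewrite bal_lin_a cmp_lin.
by rewrite (bal_cmp _ _ hx ha); apply/span_gen/BalRel.
Qed.

Lemma hc_rel_cmp n g : hc_rel g -> span hc_rel (cmp n g).
Proof.
case=> x a y; move: x; apply: span_lin_hom => [b x x'|i x hx].
- by rewrite bal_lin_x cmp_lin.
- move: a; apply: span_lin_hom => [b a a'|j a ha].
    by rewrite bal_lin_a cmp_lin.
  by rewrite (bal_cmp _ _ hx ha); apply/span_gen/HcBal.
- by rewrite cyc_lin_x cmp_lin.
move: a; apply: span_lin_hom => [b a a'|j a ha].
  by rewrite cyc_lin_a cmp_lin.
by rewrite (cyc_cmp _ _ hx ha); apply/span_gen/HcCyc.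
Qed.

Lemma bal_rel_lact a (g : outer_bimod M N) : bal_rel g -> span bal_rel (lact a g).
Proof.
case=> x b y; rewrite [lact a _](linB (olact_lin a)) !olactE -lractC.
exact/span_gen/BalRel.
Qed.

Lemma bal_rel_ract a (g : outer_bimod M N) : bal_rel g -> span bal_rel (ract g a).
Proof.
case=> x b y; rewrite [ract _ a](linB (oract_lin a)) !oractE lractC.
exact/span_gen/BalRel.
Qed.

Definition tensA : dgBimod A :=
  @quot_bimod (outer_bimod M N) bal_rel bal_rel_dif bal_rel_cmp
    bal_rel_lact bal_rel_ract.

Definition hc_cplx : cplx := quot_cplx hc_rel_dif hc_rel_cmp.

Definition tA (x : M) (y : N) : tensA := qpi bal_rel (tpure x y).

Definition hcpure (x : M) (y : N) : hc_cplx := qpi hc_rel (tpure x y).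

Lemma tA_bilin : bilinear tA.
Proof. by split=> [y a x x'|x a y y']; rewrite /tA ?l1 ?l2 qpi_lin. Qed.

Lemma hcpure_bilin : bilinear hcpure.
Proof. by split=> [y a x x'|x a y y']; rewrite /hcpure ?l1 ?l2 qpi_lin. Qed.

Lemma tA_bal x a y : tA (ract x a) y = tA x (lact a y).
Proof. by apply/qpi_eq/span_gen/BalRel. Qed.

Lemma tA_lact a x y : lact a (tA x y) = tA (lact a x) y.
Proof. by rewrite [LHS]lact_qpi [lact a _]olactE. Qed.

Lemma tA_ract a x y : ract (tA x y) a = tA x (ract y a).
Proof. by rewrite [LHS]ract_qpi [ract _ a]oractE. Qed.

Lemma hcpure_bal x a y : hcpure (ract x a) y = hcpure x (lact a y).
Proof. by apply/qpi_eq/span_gen/HcBal. Qed.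

Lemma hcpure_cyc x a y : hcpure (lact a x) y = hcpure x (ract y a).
Proof. by apply/qpi_eq/span_gen/HcCyc. Qed.

Variable W : lmodType F2.

Definition tA_lift (f : M -> N -> W) : tensA -> W := qlift (tlift f).
Definition hc_lift (f : M -> N -> W) : hc_cplx -> W := qlift (tlift f).

Section Lift.
Variable f : M -> N -> W.
Hypotheses (bf : bilinear f)
  (fb : forall x a y, f (ract x a) y = f x (lact a y)).

Let tf0 g : bal_rel g -> tlift f g = 0.
Proof. by case=> x a y; rewrite (linB (tlift_lin bf)) !tliftE // fb subrr. Qed.

Lemma tA_lift_lin : linear (tA_lift f).
Proof. exact: qlift_lin (tlift_lin bf) tf0. Qed.

Lemma tA_liftE x y : tA_lift f (tA x y) = f x y.
Proof. by rewrite /tA_lift (qliftE (tlift_lin bf) tf0) tliftE. Qed.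

Hypothesis fc : forall x a y, f (lact a x) y = f x (ract y a).

Let hf0 g : hc_rel g -> tlift f g = 0.
Proof.
by case=> x a y; rewrite (linB (tlift_lin bf)) !tliftE // ?fb ?fc subrr.
Qed.

Lemma hc_lift_lin : linear (hc_lift f).
Proof. exact: qlift_lin (tlift_lin bf) hf0. Qed.

Lemma hc_liftE x y : hc_lift f (hcpure x y) = f x y.
Proof. by rewrite /hc_lift (qliftE (tlift_lin bf) hf0) tliftE. Qed.

End Lift.

Lemma tA_ext (f g : tensA -> W) : linear f -> linear g ->
  (forall x y, f (tA x y) = g (tA x y)) -> forall t, f t = g t.
Proof.
move=> lf lg h; apply: quot_ext; apply: tens_ext => [a x y|a x y|//].
  by rewrite qpi_lin lf.
by rewrite qpi_lin lg.
Qed.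

End Relations.

End Bimodules.

Section Tate.
Variables (A : dgAlg) (R M : dgBimod A).

(* M (x)^L M = M (x)_A R (x)_A M, for a resolution R of A *)
Definition derived_square : dgBimod A := tensA (tensA M R) M.
Local Notation MM := derived_square.
Local Notation HC := (hc_cplx R MM).

(* The involution r (x) (m (x) r' (x) m') |-> r' (x) (m' (x) r (x) m),
   assembled one tensor factor at a time; see tauE. *)
Definition tau3 (r : R) (m' : M) : tensA M R -> HC :=
  tA_lift (fun (m : M) (r' : R) => hcpure (N := MM) r' (tA (tA m' r) m)).
Definition tau2 (r : R) : MM -> HC := tA_lift (fun u m' => tau3 r m' u).
Definition tau : HC -> HC := hc_lift (M := R) (N := MM) tau2.

Let tt1 := (@tA_bilin A (tensA M R) M).1.
Let tt2 := (@tA_bilin A (tensA M R) M).2.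
Let t1 := (@tA_bilin A M R).1.
Let t2 := (@tA_bilin A M R).2.
Let h1 := (@hcpure_bilin A R MM).1.
Let h2 := (@hcpure_bilin A R MM).2.

Lemma tau3_bilin r m' :
  bilinear (fun (m : M) (r' : R) => hcpure (N := MM) r' (tA (tA m' r) m)).
Proof. by split=> [y a x x'|x a y y']; rewrite ?tt2 ?h1 ?h2. Qed.

Lemma tau3_bal (r : R) (m' m : M) a (r' : R) :
  hcpure (N := MM) r' (tA (tA m' r) (ract m a)) =
  hcpure (N := MM) (lact a r') (tA (tA m' r) m).
Proof. by rewrite hcpure_cyc tA_ract. Qed.

Lemma tau3_lin r m' : linear (tau3 r m').
Proof. exact: tA_lift_lin (tau3_bilin r m') (tau3_bal r m'). Qed.

Lemma tau3E r m' m r' :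
  tau3 r m' (tA m r') = hcpure (N := MM) r' (tA (tA m' r) m).
Proof. exact: tA_liftE (tau3_bilin r m') (tau3_bal r m') _ _. Qed.

Lemma comb_lin (U W : lmodType F2) (f g : U -> W) b :
  linear f -> linear g -> linear (fun u => b *: f u + g u).
Proof.
move=> lf lg c x y; rewrite lf lg !scalerDr !scalerA (mulrC b c).
by rewrite addrACA.
Qed.

Lemma tau2_bilin r : bilinear (fun (u : tensA M R) (m' : M) => tau3 r m' u).
Proof.
split=> [m'|u a x x']; first exact: tau3_lin.
move: u; apply: (tA_ext (f := tau3 r (a *: x + x'))); first exact: tau3_lin.
  by apply: comb_lin; apply: tau3_lin.
by move=> m r'; rewrite !tau3E t1 tt1 h2.
Qed.

Lemma tau2_bal r u a m' : tau3 r m' (ract u a) = tau3 r (lact a m') u.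
Proof.
move: u; apply: tA_ext => [b x y||m r']; last first.
- by rewrite tA_ract !tau3E hcpure_bal !tA_lact.
- exact: tau3_lin.
by rewrite (ract_bilin _).1 tau3_lin.
Qed.

Lemma tau2_lin r : linear (tau2 r).
Proof. exact: tA_lift_lin (tau2_bilin r) (tau2_bal r). Qed.

Lemma tau2E r m r' m' :
  tau2 r (tA (tA m r') m') = hcpure (N := MM) r' (tA (tA m' r) m).
Proof. by rewrite /tau2 (tA_liftE (tau2_bilin r) (tau2_bal r)) tau3E. Qed.

Lemma derived_square_ext (W : lmodType F2) (f g : MM -> W) :
  linear f -> linear g ->
  (forall m r m', f (tA (tA m r) m') = g (tA (tA m r) m')) ->
  forall t, f t = g t.
Proof.
move=> lf lg h; apply: tA_ext => // u m'.
move: u; apply: tA_ext => // a x y.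
  by rewrite tt1 lf.
by rewrite tt1 lg.
Qed.

Lemma tau_bilin : bilinear tau2.
Proof.
split=> [v a r s|r]; last exact: tau2_lin.
move: v; apply: derived_square_ext; first exact: tau2_lin.
  by apply: comb_lin; apply: tau2_lin.
by move=> m r' m'; rewrite !tau2E t2 tt1 h2.
Qed.

Lemma tau_bal r a v : tau2 (ract r a) v = tau2 r (lact a v).
Proof.
move: v; apply: derived_square_ext; first exact: tau2_lin.
  by move=> b x y; rewrite (lact_bilin _).2 tau2_lin.
by move=> m r' m'; rewrite !tA_lact !tau2E -tA_ract tA_bal.
Qed.

Lemma tau_cyc r a v : tau2 (lact a r) v = tau2 r (ract v a).
Proof.
move: v; apply: derived_square_ext; first exact: tau2_lin.
  by move=> b x y; rewrite (ract_bilin _).1 tau2_lin.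
by move=> m r' m'; rewrite tA_ract !tau2E tA_bal.
Qed.

Lemma tau_lin : linear tau.
Proof. exact: hc_lift_lin tau_bilin tau_bal tau_cyc. Qed.

Lemma tauE r m r' m' :
  tau (hcpure (N := MM) r (tA (tA m r') m')) =
  hcpure (N := MM) r' (tA (tA m' r) m).
Proof. by rewrite /tau (hc_liftE tau_bilin tau_bal tau_cyc) tau2E. Qed.

Lemma hc_ext (W : lmodType F2) (f g : HC -> W) : linear f -> linear g ->
  (forall r m r' m', f (hcpure (N:=MM) r (tA (tA m r') m')) = g (hcpure (N:=MM) r (tA (tA m r') m'))) ->
  forall x, f x = g x.
Proof.
move=> lf lg h; apply: quot_ext; apply: tens_ext => [a x y|a x y|r v].
- by rewrite qpi_lin lf.
- by rewrite qpi_lin lg.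
have l2 := (@hcpure_bilin A R MM).2 r.
move: v; apply: derived_square_ext => [a x y|a x y|]; last by move=> *; apply: h.
- by rewrite -[qpi _ _]/(hcpure r (a *: x + y)) l2 lf.
- by rewrite -[qpi _ _]/(hcpure r (a *: x + y)) l2 lg.
Qed.
Lemma tau_tau (x : HC) : tau (tau x) = x.
Proof.
move: x; apply: hc_ext => [a x y|//|r m r' m']; last by rewrite !tauE.
by rewrite !tau_lin.
Qed.
Lemma dif_hc (r : R) (v : MM) : dif (hcpure r v) = hcpure (dif r) v + hcpure r (dif v).
Proof. by rewrite /hcpure dif_qpi dif_tpure (linD (@qpi_lin _ _)). Qed.
Lemma dif_tA (N1 N2 : dgBimod A) (x : N1) (y : N2) : dif (tA x y) = tA (dif x) y + tA x (dif y).
Proof. by rewrite /tA [LHS]dif_qpi [dif _]dif_tpure (linD (@qpi_lin _ _)). Qed.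
Lemma tau_dif (x : HC) : tau (dif x) = dif (tau x).
Proof.
move: x; apply: hc_ext => [a x y|a x y|r m r' m'].
- by rewrite (@dif_lin HC) tau_lin.
- by rewrite tau_lin dif_lin.
have L := (linD tau_lin).
have B1 := fun a b => linD ((@hcpure_bilin A R MM).2 a) b.
have C1 := fun a b => linD ((@tA_bilin A (tensA M R) M).1 a) b.
have C2 := fun a b => linD ((@tA_bilin A (tensA M R) M).2 a) b.
rewrite tauE !dif_hc !dif_tA !(C1, B1) !L !tauE.
set a1 := hcpure _ _; set a2 := hcpure _ _; set a3 := hcpure _ _; set a4 := hcpure _ _.
by rewrite (addrAC a2) addrA addrC -(addrA a4) (addrC a4) (addrA a1).

Qed.

End Tate.

Section DirectSum.
Variables (I : choiceType) (V : I -> lmodType F2).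

Record dsum := DSum {
  dsum_val :> forall i, V i;
  dsum_supp : exists s : seq I, forall i, i \notin s -> dsum_val i = 0 }.

Lemma dsumP (f g : dsum) : (forall i, f i = g i) -> f = g.
Proof.
case: f g => f hf [g hg] /= h.
have {}h : f = g by apply: functional_extensionality_dep.
by case: _ / h in hg *; congr DSum; apply: Prop_irrelevance.
Qed.

HB.instance Definition _ := gen_eqMixin dsum.
HB.instance Definition _ := gen_choiceMixin dsum.

Lemma dsum0_supp : exists s : seq I, forall i, i \notin s -> 0 = 0 :> V i.
Proof. by exists [::]. Qed.
Definition dsum0 := DSum dsum0_supp.

Lemma dsum_add_supp (f g : dsum) :
  exists s : seq I, forall i, i \notin s -> f i + g i = 0.
Proof.
have [s hs] := dsum_supp f; have [t ht] := dsum_supp g; exists (s ++ t) => i.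
by rewrite mem_cat negb_or => /andP [is_ it]; rewrite hs // ht // addr0.
Qed.
Definition dsum_add f g := DSum (dsum_add_supp f g).

Lemma dsum_map_supp (h : forall i, V i -> V i) (f : dsum) :
  (forall i, h i 0 = 0) ->
  exists s : seq I, forall i, i \notin s -> h i (f i) = 0.
Proof.
by move=> h0; have [s hs] := dsum_supp f; exists s => i /hs ->; apply: h0.
Qed.
Definition dsum_map h h0 f := DSum (@dsum_map_supp h f h0).

Definition dsum_opp := @dsum_map (fun i => -%R) (fun i => oppr0 _).
Definition dsum_scale a := @dsum_map (fun i => *:%R a) (fun i => scaler0 _ a).

Lemma dsum_addA : associative dsum_add.
Proof. by move=> f g h; apply: dsumP => i /=; rewrite addrA. Qed.
Lemma dsum_addC : commutative dsum_add.
Proof. by move=> f g; apply: dsumP => i /=; rewrite addrC. Qed.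
Lemma dsum_add0 : left_id dsum0 dsum_add.
Proof. by move=> f; apply: dsumP => i /=; rewrite add0r. Qed.
Lemma dsum_addN : left_inverse dsum0 dsum_opp dsum_add.
Proof. by move=> f; apply: dsumP => i /=; rewrite addNr. Qed.

HB.instance Definition _ :=
  GRing.isZmodule.Build dsum dsum_addA dsum_addC dsum_add0 dsum_addN.

Lemma dsum_scaleA a b f : dsum_scale a (dsum_scale b f) = dsum_scale (a * b) f.
Proof. by apply: dsumP => i /=; rewrite scalerA. Qed.
Lemma dsum_scale1 : left_id 1 dsum_scale.
Proof. by move=> f; apply: dsumP => i /=; rewrite scale1r. Qed.
Lemma dsum_scaleDr : right_distributive dsum_scale +%R.
Proof. by move=> a f g; apply: dsumP => i /=; rewrite scalerDr. Qed.
Lemma dsum_scaleDl f : {morph dsum_scale^~ f : a b / a + b}.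
Proof. by move=> a b; apply: dsumP => i /=; rewrite scalerDl. Qed.

HB.instance Definition _ := GRing.Zmodule_isLmodule.Build F2 dsum
  dsum_scaleA dsum_scale1 dsum_scaleDr dsum_scaleDl.

Lemma dsum_linE a (f g : dsum) i : (a *: f + g) i = a *: f i + g i.
Proof. by []. Qed.

Lemma dsum_sumE J (r : seq J) (F : J -> dsum) i :
  (\sum_(j <- r) F j) i = \sum_(j <- r) F j i.
Proof.
elim: r => [|j r IH]; first by rewrite !big_nil.
by rewrite !big_cons -IH.
Qed.

End DirectSum.

Section DirectSumBimod.
Variables (A : dgAlg) (I : choiceType) (M : I -> dgBimod A).
Local Notation D := (dsum (fun i => M i : lmodType F2)).

Definition ds_dif : D -> D :=
  @dsum_map I _ (fun i => @dif (M i)) (fun i => lin0 (@dif_lin (M i))).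
Definition ds_cmp (n : int) : D -> D :=
  @dsum_map I _ (fun i => @cmp (M i) n) (fun i => lin0 (@cmp_lin (M i) n)).
Definition ds_lact (a : A) : D -> D :=
  @dsum_map I _ (fun i => @lact A (M i) a)
    (fun i => lin0 ((lact_bilin (M i)).2 a)).
Definition ds_ract (f : D) (a : A) : D :=
  @dsum_map I _ (fun i x => @ract A (M i) x a)
    (fun i => lin0 ((ract_bilin (M i)).1 a)) f.

Lemma ds_dif_lin : linear ds_dif.
Proof. by move=> a f g; apply: dsumP => i; rewrite /= dif_lin. Qed.
Lemma ds_dif_dif f : ds_dif (ds_dif f) = 0.
Proof. by apply: dsumP => i; rewrite /= dif_dif. Qed.
Lemma ds_cmp_lin n : linear (ds_cmp n).
Proof. by move=> a f g; apply: dsumP => i; rewrite /= cmp_lin. Qed.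
Lemma ds_cmp_cmp m n f : ds_cmp m (ds_cmp n f) = if m == n then ds_cmp n f else 0.
Proof. by apply: dsumP => i; rewrite /= cmp_cmp; case: ifP. Qed.
Lemma ds_cmp_sum f : exists2 s : seq int, uniq s & f = \sum_(n <- s) ds_cmp n f.
Proof.
have [s hs] := dsum_supp f.
have [t ht] : exists t : seq int, forall i n, n \notin t -> cmp n (f i) = 0.
  suff [t ht] : exists t : seq int,
      forall i, i \in s -> forall n, n \notin t -> cmp n (f i) = 0.
    exists t => i n nt; case: (boolP (i \in s)) => [/ht|/hs ->]; first exact.
    exact/lin0/cmp_lin.
  elim: (s) => [|i s' [t ht]]; first by exists [::].
  have [u _ hu] := cmp_sum (f i); exists (u ++ t) => j.
  rewrite inE => /predU1P [->|js] n; rewrite mem_cat negb_or => /andP [nu nt].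
    exact: cmp_out hu nu.
  exact: ht.
exists (undup t); first exact: undup_uniq.
apply: dsumP => i; rewrite dsum_sumE /=.
have := @hsumE _ _ (fun _ x => x) (fun n a x y => erefl) (undup t) (f i)
  (undup_uniq t).
have [u uu xu] := cmp_sum (f i).
have := @hsumE _ _ (fun _ x => x) (fun n a x y => erefl) u (f i) uu.
move=> -> /=; last by move=> n; apply: cmp_out xu.
by rewrite -xu; apply=> n; rewrite mem_undup; apply: ht.
Qed.
Lemma ds_dif_cmp n f : ds_dif (ds_cmp n f) = ds_cmp (n - 1) (ds_dif f).
Proof. by apply: dsumP => i; rewrite /= dif_cmp. Qed.

Definition dsum_cplx : cplx :=
  Cplx ds_dif_lin ds_dif_dif ds_cmp_lin ds_cmp_cmp ds_cmp_sum ds_dif_cmp.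

Lemma ds_homP n (f : dsum_cplx) : hom n f <-> forall i, hom n (dsum_val f i).
Proof.
split=> [h i|h]; last by apply: dsumP => i; apply: h.
exact: (congr1 (fun g : D => g i) h).
Qed.

Lemma ds_lact_bilin : bilinear ds_lact.
Proof.
split=> [f b a a'|a b f g]; apply: dsumP => i.
  by rewrite /= (lact_bilin _).1.
by rewrite /= (lact_bilin _).2.
Qed.
Lemma ds_ract_bilin : bilinear ds_ract.
Proof.
split=> [a b f g|f b a a']; apply: dsumP => i.
  by rewrite /= (ract_bilin _).1.
by rewrite /= (ract_bilin _).2.
Qed.
Lemma ds_lactA a b f : ds_lact a (ds_lact b f) = ds_lact (dgmul a b) f.
Proof. by apply: dsumP => i; rewrite /= lactA. Qed.
Lemma ds_lact1 f : ds_lact dgone f = f.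
Proof. by apply: dsumP => i; rewrite /= lact1. Qed.
Lemma ds_ractA f a b : ds_ract (ds_ract f a) b = ds_ract f (dgmul a b).
Proof. by apply: dsumP => i; rewrite /= ractA. Qed.
Lemma ds_ract1 f : ds_ract f dgone = f.
Proof. by apply: dsumP => i; rewrite /= ract1. Qed.
Lemma ds_lractC a f b : ds_ract (ds_lact a f) b = ds_lact a (ds_ract f b).
Proof. by apply: dsumP => i; rewrite /= lractC. Qed.
Lemma ds_lact_dif a f : ds_dif (ds_lact a f) = ds_lact (dif a) f + ds_lact a (ds_dif f).
Proof. by apply: dsumP => i; rewrite /= lact_dif. Qed.
Lemma ds_ract_dif f a : ds_dif (ds_ract f a) = ds_ract (ds_dif f) a + ds_ract f (dif a).
Proof. by apply: dsumP => i; rewrite /= ract_dif. Qed.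
Lemma ds_lact_hom n m a (f : dsum_cplx) :
  hom n a -> hom m f -> hom (n + m) (ds_lact a f : dsum_cplx).
Proof. by move=> ha /ds_homP hf; apply/ds_homP => i; apply: lact_hom. Qed.
Lemma ds_ract_hom n m (f : dsum_cplx) a :
  hom n f -> hom m a -> hom (n + m) (ds_ract f a : dsum_cplx).
Proof. by move=> /ds_homP hf ha; apply/ds_homP => i; apply: ract_hom. Qed.

Definition dsum_bimod : dgBimod A :=
  @DgBimod A dsum_cplx ds_lact ds_ract ds_lact_bilin ds_ract_bilin ds_lactA
    ds_lact1 ds_ractA ds_ract1 ds_lractC ds_lact_dif ds_ract_dif
    ds_lact_hom ds_ract_hom.

End DirectSumBimod.

(* The shift M[n], with M[n]_i = M_(i - n). *)
Section Shift.
Variables (A : dgAlg) (n : int) (M : dgBimod A).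

Definition sh_cmp (i : int) : M -> M := cmp (i - n).

Lemma sh_cmp_cmp i j x : sh_cmp i (sh_cmp j x) = if i == j then sh_cmp j x else 0.
Proof. by rewrite /sh_cmp cmp_cmp (inj_eq (addIr _)). Qed.
Lemma sh_cmp_sum x : exists2 s : seq int, uniq s & x = \sum_(i <- s) sh_cmp i x.
Proof.
have [s us xs] := cmp_sum x; exists [seq i + n | i <- s].
  by rewrite map_inj_uniq //; apply: addIr.
by rewrite big_map {1}xs; apply: eq_bigr => i _; rewrite /sh_cmp addrK.
Qed.
Lemma sh_dif_cmp i x : dif (sh_cmp i x) = sh_cmp (i - 1) (dif x).
Proof. by rewrite /sh_cmp dif_cmp addrAC. Qed.

Definition shift_cplx : cplx :=
  Cplx (@dif_lin M) (@dif_dif M) (fun i => @cmp_lin M (i - n)) sh_cmp_cmp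
    sh_cmp_sum sh_dif_cmp.

Lemma sh_lact_hom i j (a : A) (x : shift_cplx) :
  hom i a -> hom j x -> hom (i + j) (lact a (x : M) : shift_cplx).
Proof. by move=> ha hx; rewrite /hom /= /sh_cmp -addrA; apply: lact_hom. Qed.
Lemma sh_ract_hom i j (x : shift_cplx) (a : A) :
  hom i x -> hom j a -> hom (i + j) (ract (x : M) a : shift_cplx).
Proof. by move=> hx ha; rewrite /hom /= /sh_cmp addrAC; apply: ract_hom. Qed.

Definition shift_bimod : dgBimod A :=
  @DgBimod A shift_cplx (@lact A M) (@ract A M) (lact_bilin M) (ract_bilin M)
    (@lactA A M) (@lact1 A M) (@ractA A M) (@ract1 A M) (@lractC A M)
    (@lact_dif A M) (@ract_dif A M) sh_lact_hom sh_ract_hom.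

End Shift.

Section Notions.
Variable A : dgAlg.
Implicit Types M N C F R : dgBimod A.

Definition dgmap M N (f : M -> N) : Prop :=
  [/\ linear f,
      forall x, f (dif x) = dif (f x),
      forall n x, f (cmp n x) = cmp n (f x),
      forall a x, f (lact a x) = lact a (f x) &
      forall x a, f (ract x a) = ract (f x) a].

Definition dgiso M N : Prop := exists (f : M -> N) (g : N -> M),
  [/\ dgmap f, dgmap g, cancel f g & cancel g f].

Definition quasi_iso M N (f : M -> N) : Prop :=
  [/\ dgmap f,
      forall x, dif x = 0 -> (exists y, f x = dif y) -> exists z, x = dif z &
      forall y, dif y = 0 -> exists x z, dif x = 0 /\ y = f x + dif z].

(* A^e = A (x) A, with a (b (x) c) d = (a b) (x) (c d) *)
Definition enveloping : dgBimod A := outer_bimod (reg_bimod A) (reg_bimod A).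

Definition dg_free F : Prop := exists (I : choiceType) (n : I -> int),
  dgiso F (dsum_bimod (fun i => shift_bimod (n i) enveloping)).

Definition dg_free_fin F : Prop := exists (m : nat) (n : 'I_m -> int),
  dgiso F (dsum_bimod (fun i => shift_bimod (n i) enveloping)).

Definition sub_bimod M (S : M -> Prop) : Prop :=
  [/\ S 0 /\ (forall a x y, S x -> S y -> S (a *: x + y)),
      forall x, S x -> S (dif x),
      forall n x, S x -> S (cmp n x),
      forall a x, S x -> S (lact a x) &
      forall x a, S x -> S (ract x a)].

(* T / S is isomorphic to F: q restricts to a surjective morphism of dg
   bimodules from T to F with kernel S; its values outside T are irrelevant. *)
Definition subquot_iso M (S T : M -> Prop) F : Prop := exists q : M -> F,
  [/\ (forall a x y, T x -> T y -> q (a *: x + y) = a *: q x + q y) /\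
      (forall x, T x -> q (dif x) = dif (q x)) /\
      (forall n x, T x -> q (cmp n x) = cmp n (q x)),
      (forall a x, T x -> q (lact a x) = lact a (q x)) /\
      (forall x a, T x -> q (ract x a) = ract (q x) a),
      forall y, exists2 x, T x & q x = y &
      forall x, T x -> (q x = 0 <-> S x)].

(* A filtration 0 = S 0, S 1, S 2, ... whose subquotients all satisfy P. *)
Definition cell_filtration (P : dgBimod A -> Prop) C (S : nat -> C -> Prop) :=
  [/\ forall i, sub_bimod (S i),
      forall x, S 0%N x <-> x = 0,
      forall i x, S i x -> S i.+1 x &
      forall i, exists2 F, P F & subquot_iso (S i) (S i.+1) F].

Definition cell C : Prop := exists2 S : nat -> C -> Prop,
  cell_filtration dg_free S & forall x, exists i, S i x.

Definition finite_cell C : Prop := exists2 S : nat -> C -> Prop,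
  cell_filtration dg_free_fin S & exists i, forall x, S i x.

Definition dg_retract R C : Prop := exists (i : R -> C) (p : C -> R),
  [/\ dgmap i, dgmap p & cancel i p].

Definition cell_retract R : Prop := exists2 C, cell C & dg_retract R C.

Definition resolution R M (f : R -> M) : Prop := cell_retract R /\ quasi_iso f.

Definition homologically_proper : Prop := exists (m : nat) (e : 'I_m -> A),
  (forall i, dif (e i) = 0) /\
  forall x : A, dif x = 0 -> exists (c : 'I_m -> F2) (y : A),
    x = \sum_i c i *: e i + dif y.

Definition homologically_smooth : Prop :=
  exists R (f : R -> reg_bimod A),
    (exists2 C, finite_cell C & dg_retract R C) /\ quasi_iso f.

End Notions.

(* The spectral sequence of a bicomplex whose (p, q) entry is the subspace
   C p q of V, with vertical differential dv : C p q -> C p (q - 1) and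
   horizontal differential dh : C p q -> C (p - 1) q, for the filtration by q
   (d^0 = dh). An element of total degree n is a family x with x p in
   C p (n - p); families of infinite support are allowed, but the pages E^r are
   the same for the total complex made of finitely supported families. *)
Section BicomplexHV.
Variables (V : lmodType F2) (C : int -> int -> V -> Prop) (dv dh : V -> V).

Definition hv_dif (x : int -> V) (p : int) : V := dv (x p) + dh (x (p + 1)).

Definition hv_fil (s n : int) (x : int -> V) : Prop :=
  (forall p, C p (n - p) (x p)) /\ (forall p, s < n - p -> x p = 0).

Definition hv_Z (r s n : int) (x : int -> V) : Prop :=
  hv_fil s n x /\ hv_fil (s - r) (n - 1) (hv_dif x).

Definition hv_B (r s n : int) (x : int -> V) : Prop :=
  exists y z : int -> V,
    [/\ hv_Z (r - 1) (s - 1) n y, hv_Z (r - 1) (s + r - 1) (n + 1) z &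
        forall p, x p = y p + hv_dif z p].

(* E^r in filtration degree s and total degree n is hv_Z r s n / hv_B r s n
   (r >= 1), and d^r is induced by hv_dif. *)
Definition hv_d_zero (r s n : int) : Prop := forall x,
  hv_Z r s n x -> hv_B r (s - r) (n - 1) (hv_dif x).

Definition hv_collapses_at (r0 : nat) : Prop :=
  forall r : nat, (r0 <= r)%N -> forall s n, hv_d_zero r s n.

End BicomplexHV.

Definition pi_formal_bimod (A : dgAlg) (R M : dgBimod A) : Prop :=
  hv_collapses_at (fun _ q => @hom (hc_cplx R (derived_square R M)) q)
    dif (fun x => x + tau x) 3.

(* Smoothness and properness are part of the notion, and no particular
   resolution of A is singled out: all are required to work. *)
Definition pi_formal (A : dgAlg) : Prop :=
  [/\ homologically_smooth A, homologically_proper A &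
      forall (R : dgBimod A) (f : R -> reg_bimod A), resolution f ->
      forall M : dgBimod A, pi_formal_bimod R M].

(* Algebras over F2, the zero algebra included. *)
Record algF2 := AlgF2 {
  alg :> lmodType F2;
  amul : alg -> alg -> alg;
  aone : alg;
  amul_bilin : bilinear amul;
  amulA : associative amul;
  amul1l : left_id aone amul;
  amul1r : right_id aone amul }.

Arguments amul {a}.
Arguments aone {a}.

Section DegreeZero.
Variable B : algF2.

Definition z_dif (x : B) : B := 0.
Definition z_cmp (n : int) (x : B) : B := if n == 0 then x else 0.

Lemma z_dif_lin : linear z_dif.
Proof. by move=> a x y; rewrite /z_dif scaler0 addr0. Qed.
Lemma z_dif_dif x : z_dif (z_dif x) = 0. Proof. by []. Qed.
Lemma z_cmp_lin n : linear (z_cmp n).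
Proof. by move=> a x y; rewrite /z_cmp; case: ifP => // _; rewrite scaler0 addr0. Qed.
Lemma z_cmp_cmp m n x : z_cmp m (z_cmp n x) = if m == n then z_cmp n x else 0.
Proof.
rewrite /z_cmp; have [->|mn] := eqVneq m n; first by case: (n == 0).
case: (m =P 0) => // m0; case: (n =P 0) => // n0.
by rewrite m0 n0 eqxx in mn.
Qed.
Lemma z_cmp_sum x : exists2 s : seq int, uniq s & x = \sum_(n <- s) z_cmp n x.
Proof. by exists [:: 0] => //; rewrite big_seq1. Qed.
Lemma z_dif_cmp n x : z_dif (z_cmp n x) = z_cmp (n - 1) (z_dif x).
Proof. by rewrite /z_dif /z_cmp if_same. Qed.

Definition z_cplx : cplx :=
  Cplx z_dif_lin z_dif_dif z_cmp_lin z_cmp_cmp z_cmp_sum z_dif_cmp.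

Lemma z_mul_dif (a b : z_cplx) :
  dif (amul a b : z_cplx) = amul (dif a) b + amul a (dif b).
Proof.
have [l1 l2] := amul_bilin B.
by rewrite /= /z_dif (lin0 (l1 b)) (lin0 (l2 a)) addr0.
Qed.
Lemma z_mul_hom i j (a b : z_cplx) :
  hom i a -> hom j b -> hom (i + j) (amul a b : z_cplx).
Proof.
have [l1 l2] := amul_bilin B; rewrite /hom /= /z_cmp.
have [->|_] := eqVneq i 0; first rewrite add0r.
  by case: ifP => // _ _ <-; rewrite (lin0 (l2 a)).
by move=> <- _; rewrite (lin0 (l1 b)) if_same.
Qed.
Lemma z_one_hom : hom 0 (aone : z_cplx).
Proof. by []. Qed.

Definition dg_of_alg : dgAlg :=
  @DgAlg z_cplx amul aone (amul_bilin B) (@amulA B) (@amul1l B) (@amul1r B)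
    z_mul_dif z_mul_hom z_one_hom.

End DegreeZero.

Section QuotientAlgebra.
Variables (B : algF2) (rel : B -> Prop).

Inductive ideal_gen : B -> Prop :=
| IdealGen p g q : rel g -> ideal_gen (amul (amul p g) q).

Let l1 := (amul_bilin B).1.
Let l2 := (amul_bilin B).2.

Lemma ideal_mull x y : span ideal_gen y -> span ideal_gen (amul x y).
Proof.
apply: (span_map (l2 x)) => _ [p g q rg]; rewrite !amulA.
exact/span_gen/IdealGen.
Qed.
Lemma ideal_mulr x y : span ideal_gen x -> span ideal_gen (amul x y).
Proof.
apply: (span_map (l1 y)) => _ [p g q rg]; rewrite -amulA.
exact/span_gen/IdealGen.
Qed.

Definition quot_mul (x y : quot ideal_gen) : quot ideal_gen :=
  qpi ideal_gen (amul (repr x) (repr y)).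

Lemma quot_mulE x y :
  quot_mul (qpi ideal_gen x) (qpi ideal_gen y) = qpi ideal_gen (amul x y).
Proof.
apply/qpi_eq; set x' := repr _; set y' := repr _.
have -> : amul x' y' - amul x y = amul (x' - x) y' + amul x (y' - y).
  by rewrite (linB (l1 y')) (linB (l2 x)) subrKA.
by apply: spanD; [apply: ideal_mulr|apply: ideal_mull]; apply: repr_qpi.
Qed.

Lemma quot_mul_bilin : bilinear quot_mul.
Proof.
split=> [y a x x'|x a y y'].
  elim/quotP: y => y; elim/quotP: x => x; elim/quotP: x' => x'.
  by rewrite -qpi_lin !quot_mulE l1 qpi_lin.
elim/quotP: y => y; elim/quotP: x => x; elim/quotP: y' => y'.
by rewrite -qpi_lin !quot_mulE l2 qpi_lin.
Qed.
Lemma quot_mulA : associative quot_mul.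
Proof.
elim/quotP=> x; elim/quotP=> y; elim/quotP=> z.
by rewrite (quot_mulE y) (quot_mulE x y) !quot_mulE amulA.
Qed.
Lemma quot_mul1l : left_id (qpi ideal_gen aone) quot_mul.
Proof. by elim/quotP=> x; rewrite quot_mulE amul1l. Qed.
Lemma quot_mul1r : right_id (qpi ideal_gen aone) quot_mul.
Proof. by elim/quotP=> x; rewrite quot_mulE amul1r. Qed.

Definition quot_alg : algF2 :=
  AlgF2 quot_mul_bilin quot_mulA quot_mul1l quot_mul1r.

End QuotientAlgebra.

(* The path algebra of a quiver with finitely many vertices; a path is its
   starting vertex with its sequence of arrows, and p q is p followed by q. *)
Section PathAlgebra.
Variables (vert : finType) (arrow : choiceType) (src tgt : arrow -> vert).

Fixpoint walk (v : vert) (es : seq arrow) : bool :=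
  if es is e :: es' then (src e == v) && walk (tgt e) es' else true.

Definition wend (v : vert) (es : seq arrow) : vert := last v [seq tgt e | e <- es].

Definition qpath := {p : vert * seq arrow | walk p.1 p.2}.

Definition pstart (p : qpath) : vert := (val p).1.
Definition parrows (p : qpath) : seq arrow := (val p).2.
Definition pend (p : qpath) : vert := wend (pstart p) (parrows p).

Lemma walk_cat v es fs : walk v (es ++ fs) = walk v es && walk (wend v es) fs.
Proof.
elim: es v => [|e es IH] v //=.
by rewrite IH andbA.
Qed.

Lemma wend_cat v es fs : wend v (es ++ fs) = wend (wend v es) fs.
Proof. by rewrite /wend map_cat last_cat. Qed.

Definition pcat (p q : qpath) : option qpath :=
  if pend p == pstart q then (insub (pstart p, parrows p ++ parrows q) : option qpath)
  else None.

Definition ptriv (v : vert) : qpath := exist _ (v, [::]) isT.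
Definition parrow (e : arrow) : qpath :=
  exist _ (src e, [:: e]) (introT andP (conj (eqxx (src e)) isT)).

Definition path_sp := {freeg qpath / F2}.
HB.instance Definition _ := GRing.Lmodule.on path_sp.

Definition pbasis (p : qpath) : path_sp := <<p>>.

Definition pbasis_opt (o : option qpath) : path_sp :=
  if o is Some p then pbasis p else 0.

Definition path_mul (x y : path_sp) : path_sp :=
  fglift (fun p => fglift (fun q => pbasis_opt (pcat p q)) y) x.

Definition path_one : path_sp := \sum_(v : vert) pbasis (ptriv v).

Lemma path_mul_bilin : bilinear path_mul.
Proof.
split=> [y|x]; first exact: fglift_lin.
move=> a y y'; rewrite /path_mul.
pose F y := fun p => fglift (fun q => pbasis_opt (pcat p q)) y.
apply: (span_ext (f := fglift (F (a *: y + y')))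
   (g := fun x => a *: fglift (F y) x + fglift (F y') x) _ _ _ (freeg_span x)).
- exact: fglift_lin.
- by apply: comb_lin; apply: fglift_lin.
by move=> _ [p ->]; rewrite !fgliftE /F fglift_lin.
Qed.

Lemma path_mulE p q : path_mul (pbasis p) (pbasis q) = pbasis_opt (pcat p q).
Proof. by rewrite /path_mul !fgliftE. Qed.

Lemma path_ext (W : lmodType F2) (f g : path_sp -> W) : linear f -> linear g ->
  (forall p, f (pbasis p) = g (pbasis p)) -> forall x, f x = g x.
Proof.
move=> lf lg h x; apply: (span_ext lf lg _ (freeg_span x)).
by move=> _ [p ->]; apply: h.
Qed.

Lemma pcat_Some p q : pend p = pstart q ->
  exists2 r, pcat p q = Some r &
    [/\ pstart r = pstart p, parrows r = parrows p ++ parrows q &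
        pend r = pend q].
Proof.
move=> e; rewrite /pcat e eqxx.
have w : walk (pstart p) (parrows p ++ parrows q).
  by rewrite walk_cat (valP p) -/(pend p) e (valP q).
exists (exist _ (pstart p, parrows p ++ parrows q) w : qpath).
  by apply: (insubT (fun x : vert * seq arrow => walk x.1 x.2)).
by rewrite /pend /parrows /pstart !SubK /=; split=> //; rewrite wend_cat -/(pend p) e.
Qed.

Lemma pcat_None p q : pend p <> pstart q -> pcat p q = None.
Proof. by rewrite /pcat; case: eqP. Qed.

Lemma qpathP p q : pstart p = pstart q -> parrows p = parrows q -> p = q.
Proof.
rewrite /pstart /parrows => h1 h2; apply: val_inj.
by case: (val p) (val q) h1 h2 => ? ? [? ?] /= -> ->.
Qed.

Lemma path_mulA : associative path_mul.
Proof.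
have [l1 l2] := path_mul_bilin.
move=> x y z; move: x; apply: path_ext => [|a x x'|p]; first exact: l1.
  by rewrite !(l1 _ a).
move: y; apply: path_ext => [a y y'|a y y'|q]; first by rewrite l1 l2.
  by rewrite l2 l1.
move: z; apply: path_ext => [a z z'||r]; first by rewrite !l2.
  exact: l2.
rewrite !path_mulE.
have [e1|n1] := pselect (pend p = pstart q); last first.
  rewrite (pcat_None n1) /= (lin0 (l1 _)).
  have [e2|n2] := pselect (pend q = pstart r); last first.
    by rewrite (pcat_None n2) /= (lin0 (l2 _)).
  have [s -> [s1 _ _]] := pcat_Some e2.
  by rewrite path_mulE pcat_None // s1.
have [s -> [s1 s2 s3]] := pcat_Some e1.
have [e2|n2] := pselect (pend q = pstart r); last first.
  rewrite (pcat_None n2) /= (lin0 (l2 _)) path_mulE pcat_None //.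
  by rewrite s3.
have [t -> [t1 t2 t3]] := pcat_Some e2.
rewrite !path_mulE.
have [u -> [u1 u2 u3]] : exists2 u, pcat p t = Some u &
    [/\ pstart u = pstart p, parrows u = parrows p ++ parrows t & pend u = pend t].
  by apply: pcat_Some; rewrite e1 t1.
have [v -> [v1 v2 v3]] : exists2 v, pcat s r = Some v &
    [/\ pstart v = pstart s, parrows v = parrows s ++ parrows r & pend v = pend r].
  by apply: pcat_Some; rewrite s3 e2.
by congr pbasis; apply: qpathP; rewrite ?u1 ?u2 ?v1 ?v2 ?s1 ?s2 ?t2 ?catA.
Qed.

Lemma path_mul1l : left_id path_one path_mul.
Proof.
have [l1 l2] := path_mul_bilin.
apply: path_ext => [|//|p]; first exact: l2.
rewrite /path_one (lin_sum _ _ (l1 _)) (bigD1 (pstart p)) //= big1 ?addr0.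
  rewrite path_mulE; have [//|u -> [u1 u2 _]] := @pcat_Some (ptriv (pstart p)) p.
  by congr pbasis; apply: qpathP; rewrite ?u1 ?u2.
by move=> v /eqP vp; rewrite path_mulE pcat_None.
Qed.

Lemma path_mul1r : right_id path_one path_mul.
Proof.
have [l1 l2] := path_mul_bilin.
apply: path_ext => [|//|p]; first exact: l1.
rewrite /path_one (lin_sum _ _ (l2 _)) (bigD1 (pend p)) //= big1 ?addr0.
  rewrite path_mulE; have [//|u -> [u1 u2 _]] := @pcat_Some p (ptriv (pend p)).
  by congr pbasis; apply: qpathP; rewrite ?u1 ?u2 ?cats0.
move=> v /eqP vp; rewrite path_mulE pcat_None // => e.
by apply: vp; rewrite e.
Qed.

Definition path_alg : algF2 :=
  AlgF2 path_mul_bilin path_mulA path_mul1l path_mul1r.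

Definition arr (e : arrow) : path_alg := pbasis (parrow e).

End PathAlgebra.

(* The quiver with relations of A(Z, -k+1), for k >= 1, indexed from 0: with
   n = 2k - 1, the vertex iota_(i+1) is i : 'I_n.+1, the arrows a_(i+1) and
   b_(i+1) are Some (true, i) and Some (false, i) for i : 'I_n, and c is None. *)
Section Antipodal.
Variable k : nat.
Local Notation n := (k.*2.-1).

Definition ap_arrow : choiceType := option (bool * 'I_n)%type.

Definition ap_src (e : ap_arrow) : 'I_n.+1 :=
  if e is Some (_, i) then widen_ord (leqnSn n) i else ord_max.
Definition ap_tgt (e : ap_arrow) : 'I_n.+1 :=
  if e is Some (_, i) then fintype.lift ord0 i else ord0.

Definition ap_path : algF2 := path_alg ap_src ap_tgt.

Definition ap_a (i : 'I_n) : ap_path := arr ap_src ap_tgt (Some (true, i)).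
Definition ap_b (i : 'I_n) : ap_path := arr ap_src ap_tgt (Some (false, i)).
Definition ap_c : ap_path := arr ap_src ap_tgt None.

Inductive ap_rel : ap_path -> Prop :=
| ApAB (i j : 'I_n) : j = i.+1 :> nat -> ap_rel (amul (ap_a i) (ap_b j))
| ApBA (i j : 'I_n) : j = i.+1 :> nat -> ap_rel (amul (ap_b i) (ap_a j))
| ApBC (i : 'I_n) : i.+1 = n -> ap_rel (amul (ap_b i) ap_c)
| ApCA (i : 'I_n) : i = 0%N :> nat -> ap_rel (amul ap_c (ap_a i)).

Definition antipodal_alg : dgAlg := dg_of_alg (quot_alg ap_rel).

End Antipodal.

(* Main.v *)
(* The arrows of the quiver form a single chain x_1, ..., x_N with N = 4k - 1, and
   the relations are x_r x_(r+1) = 0, so A is Koszul. Its Koszul resolution shows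
   smoothness.

   Let M be a bimodule, C a cell bimodule and T = M (x)_A C. Then HC(M (x)^L M) is
   the cyclic tensor square of T: it is spanned by symbols B(t, u), with
   B(t a, u) = B(t, a u), B(a t, u) = B(t, u a) and tau B(t, u) = B(u, t). It is
   also the square of the F2-vector space T / [A, T]; hence every invariant is
   B(t, t) + (1 + tau) u, and B(t, t) is in the image of 1 + tau only for t in
   [A, T]. Surviving to E^3 forces d t in [A, T]. The Koszul resolution then
   replaces t, modulo [A, T], by G such that
     d G = sum_r [x_r, g_r],  d g_r = x_(r+1) q_r + q_(r-1) x_(r-1), ...
   and the elements cyc1, cyc2, cyc3 of HC(M (x)^L M), explicit in the g_r and
   q_r, complete B(G, G) to a cycle of the total complex. So all differentials
   d^r with r >= 3 vanish. Retracts of cell bimodules follow by functoriality. *)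
From mathcomp Require Import all_boot all_algebra.
From mathcomp Require Import boolp classical_sets.
From mathcomp.multinomials Require Import freeg.
From mathcomp Require Import zify.
Require Import Defs.

Set Implicit Arguments.
Unset Strict Implicit.
Unset Printing Implicit Defensive.

Import GRing.Theory Num.Theory.
Local Open Scope ring_scope.

(** * The explicit cycle *)

(** The term B(t, t) is quadratic, so no linear correction is available: d B(G, G) = (1 + tau) B(d
    G, G), and the next corrections must be written down. With d G a sum of commutators they become
    double sums over pairs of arrows. Such a sum is (1 + tau) of its half over r < s once its
    diagonal cancels, which characteristic 2 and x_r x_(r+1) = 0 provide; the same relation kills
    all terms in p_r, so nothing is left after [cyc3].

    The obstacle to finding G is that T has its own differential. Without it, removing the last
    arrow of a path and cutting a path at an arrow contract the Koszul complex of M (x) A. A cell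
    bimodule makes T a sum of copies of M (x) A whose differential is that of M up to generators of
    smaller rank; the homotopy commutes with d up to smaller rank, and an induction on the rank
    concludes. Applied to A^e with its inner actions and zero differential, the same theorem gives
    the resolution of A.

    As M is arbitrary, T / [A, T] may have infinite dimension, so the squares B(t, t) are detected
    by linear functionals. *)

Section Char2.
Variable V : lmodType F2.
Implicit Types x y z : V.

Lemma addxK x y : x + (x + y) = y.
Proof. by rewrite addrA addxx add0r. Qed.

Lemma addr_eq2 x y : x + y = 0 -> x = y.
Proof. by move=> h; rewrite -[y](addxK x) h addr0. Qed.

(** With the truncated predecessor, the shifted sum counts [F 0] twice and misses [F L]. Both vanish
    in the applications because the arrows x_0 and x_(N+1) are set to 0. *)
Lemma sum_shift L (F : nat -> V) : F 0%N = 0 -> F L = 0 ->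
  \sum_(r < L.+1) F r.-1 = \sum_(r < L.+1) F r.
Proof. by move=> F0 FL; rewrite big_ord_recl big_ord_recr /= F0 FL add0r addr0. Qed.

Lemma sum_split_lt L (K : nat -> nat -> V) : (forall r, K r r = 0) ->
  \sum_(r < L) \sum_(s < L) K r s =
  \sum_(r < L) \sum_(s < L | (r < s)%N) K r s +
  \sum_(r < L) \sum_(s < L | (s < r)%N) K r s.
Proof.
move=> Krr; rewrite -big_split; apply: eq_bigr => r _.
rewrite (bigID (fun s : 'I_L => (r < s)%N)) /=; congr (_ + _).
rewrite (bigID (fun s : 'I_L => s == r)) /= big1 ?add0r.
  by apply: eq_bigl => s; rewrite -leqNgt [RHS]ltn_neqAle andbC.
by move=> s /andP [_ /eqP ->].
Qed.

Lemma exchange_lt L (K : nat -> nat -> V) :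
  \sum_(r < L) \sum_(s < L | (s < r)%N) K r s =
  \sum_(r < L) \sum_(s < L | (r < s)%N) K s r.
Proof. by rewrite (exchange_big_dep predT). Qed.

End Char2.

Section Additive.
Variables (U V : lmodType F2) (f : U -> V).
Hypothesis lf : linear f.

Lemma lin_sum_ord L (F : 'I_L -> U) (P : pred 'I_L) :
  f (\sum_(r | P r) F r) = \sum_(r | P r) f (F r).
Proof. by elim/big_rec2: _ => [|r x y _ <-]; [exact: lin0|rewrite linD]. Qed.

End Additive.

(* For M a bimodule, R a resolution and T = M (x)_A R, the form B identifies
   the cyclic tensor square of T with HC(M (x)_A R (x)_A M). *)
Section CyclicForm.
Variables (A : dgAlg) (T Y : lmodType F2).
Variables (la : A -> T -> T) (ra : T -> A -> T) (dT : T -> T).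
Variables (dY tY : Y -> Y) (B : T -> T -> Y).
Hypotheses (la_bilin : bilinear la) (ra_bilin : bilinear ra).
Hypotheses (laA : forall a b t, la a (la b t) = la (dgmul a b) t)
  (raA : forall t a b, ra (ra t a) b = ra t (dgmul a b))
  (laraC : forall a t b, ra (la a t) b = la a (ra t b)).
Hypotheses (dT_lin : linear dT) (dT_la : forall a t, dT (la a t) = la a (dT t))
  (dT_ra : forall t a, dT (ra t a) = ra (dT t) a).
Hypotheses (dY_lin : linear dY) (tY_lin : linear tY) (B_bilin : bilinear B).
Hypotheses (B_ra : forall t a u, B (ra t a) u = B t (la a u))
  (B_la : forall t a u, B (la a t) u = B t (ra u a))
  (tB : forall t u, tY (B t u) = B u t)
  (dB : forall t u, dY (B t u) = B (dT t) u + B t (dT u)).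

Lemma dY_square t : dY (B t t) = B (dT t) t + tY (B (dT t) t).
Proof. by rewrite dB tB. Qed.

Lemma square_add t u :
  B (t + u) (t + u) = B t t + B u u + (B t u + tY (B t u)).
Proof.
rewrite (linD (B_bilin.1 _)) !(linD (B_bilin.2 _)) tB (addrC (B u t)).
by rewrite !addrA; congr (_ + _); rewrite -!addrA; congr (_ + _); rewrite addrC.
Qed.

Section Cycle.
Variables (N : nat) (x : nat -> A) (G : T) (g q p : nat -> T).
Hypotheses (x0 : x 0%N = 0) (xN : forall r, (N < r)%N -> x r = 0).
Hypothesis xx : forall r, dgmul (x r) (x r.+1) = 0.
Local Notation L := N.+2.
(** [g r], [q r] and [p r] are the components of a Koszul chain on x_r, on x_r x_(r+1) and on x_r
    x_(r+1) x_(r+2). The sums include the indices 0 and N + 1, where x vanishes, so that they can be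
    shifted. *)
Hypotheses (dG : dT G = \sum_(r < L) (la (x r) (g r) + ra (g r) (x r)))
  (dg : forall r, dT (g r) = la (x r.+1) (q r) + ra (q r.-1) (x r.-1))
  (dq : forall r, dT (q r) = la (x r.+2) (p r) + ra (p r.-1) (x r.-1)).

Let la0 t : la 0 t = 0. Proof. exact: lin0 (la_bilin.1 t). Qed.
Let ra_0 t : ra t 0 = 0. Proof. exact: lin0 (ra_bilin.2 t). Qed.
Let ra0 a : ra 0 a = 0. Proof. exact: lin0 (ra_bilin.1 a). Qed.
Let B0 u : B 0 u = 0. Proof. exact: lin0 (B_bilin.1 u). Qed.
Let B_0 t : B t 0 = 0. Proof. exact: lin0 (B_bilin.2 t). Qed.
Let BD t t' u : B (t + t') u = B t u + B t' u.
Proof. exact: linD (B_bilin.1 u) _ _. Qed.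
Let B_D t u u' : B t (u + u') = B t u + B t u'.
Proof. exact: linD (B_bilin.2 t) _ _. Qed.
Let la_D a u u' : la a (u + u') = la a u + la a u'.
Proof. exact: linD (la_bilin.2 a) _ _. Qed.
Let raD t t' a : ra (t + t') a = ra t a + ra t' a.
Proof. exact: linD (ra_bilin.1 a) _ _. Qed.
Let tD y z : tY (y + z) = tY y + tY z.
Proof. exact: linD tY_lin _ _. Qed.
Let dD y z : dY (y + z) = dY y + dY z.
Proof. exact: linD dY_lin _ _. Qed.

Let xL1 : x L.-1 = 0. Proof. exact: xN. Qed.
Let raxx t r : ra (ra t (x r)) (x r.+1) = 0. Proof. by rewrite raA xx ra_0. Qed.
Let laxx t r : la (x r) (la (x r.+1) t) = 0. Proof. by rewrite laA xx la0. Qed.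
Let raxxp t r : ra (ra t (x r.-1)) (x r) = 0.
Proof. by case: r => [|r] /=; rewrite ?raxx // x0 ra_0. Qed.

Let laxxp t r : la (x r.-1) (la (x r) t) = 0.
Proof. by case: r => [|r] /=; rewrite ?laxx // x0 la0. Qed.

Definition cyc0 := B G G.

Definition cyc1 := \sum_(r < L) B (g r) (la (x r) G + ra G (x r)).

(** Expanding B(g_r, [x_r, [x_s, g_s]]) gives [m r s], [m' r s], [h r s] and [tY (h s r)].
    Exchanging r and s applies [tY] to [m] and to [m'], and [m r r = m' r r]; so [m + m'] only
    enters [cyc2] through r < s, while [h] enters in full. *)
Let m r s := B (ra (g r) (x s)) (ra (g s) (x r)).
Let m' r s := B (ra (g r) (x r)) (ra (g s) (x s)).
Let h r s := B (g r) (ra (ra (g s) (x s)) (x r)).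

Definition cyc2 :=
  \sum_(r < L) \sum_(s < L | (r < s)%N) (m r s + m' r s) +
  \sum_(r < L) \sum_(s < L) h r s.

(** These are the terms, linear in q, to which the differentials of [m], [m'] and [h] reduce. Since
    x_r x_(r+1) = 0, [al r r] and [be r r.+1] vanish, whence the strict inequalities in [cyc3]. *)
Let al r s := B (ra (q r) (x r)) (ra (ra (g s) (x s)) (x r.+1)).
Let be r s := B (ra (g s) (x r.+1)) (ra (ra (q r) (x r)) (x s)).

Definition cyc3 :=
  \sum_(r < L) \sum_(s < L | (s < r)%N) al r s +
  \sum_(r < L) \sum_(s < L | (r.+1 < s)%N) be r s.

Lemma dcyc0 : dY cyc0 = cyc1 + tY cyc1.
Proof.
rewrite /cyc0 dY_square; suff -> : cyc1 = B (dT G) G by [].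
rewrite dG (lin_sum _ _ (B_bilin.1 G)); apply: eq_bigr => r _.
by rewrite BD B_la B_ra B_D addrC.
Qed.

Lemma dcyc1 : dY cyc1 = cyc2 + tY cyc2.
Proof.
(* The terms in q: of the four products for each r, two contain x_r x_(r+1) or x_(r-1) x_r and
   vanish; the others are [F r] and [F r.-1], which cancel after a shift of the index. *)
pose F r := B (q r) (la (x r) (ra G (x r.+1))).
have e1 : dY cyc1 = \sum_(r < L) (F r + F r.-1) +
    \sum_(r < L) \sum_(s < L) (m r s + m' r s + (h r s + tY (h s r))).
  rewrite /cyc1 (lin_sum _ _ dY_lin) -big_split; apply: eq_bigr => r _ /=.
  rewrite dB; congr (_ + _).
    rewrite dg BD B_la B_ra la_D raD !B_D raxx B_0 addr0 laraC /F.
    rewrite laxxp B_0 add0r; congr (_ + _).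
    by case: (nat_of_ord r) => [|r'] //=; rewrite x0 !la0.
  rewrite (linD dT_lin) dT_la dT_ra dG.
  rewrite (lin_sum _ _ (la_bilin.2 _)) (lin_sum _ _ (ra_bilin.1 _)).
  rewrite -big_split (lin_sum _ _ (B_bilin.2 _)); apply: eq_bigr => s _ /=.
  rewrite la_D raD !B_D /m /m' /h tB.
  rewrite -(B_ra _ (x r) (la _ _)) -(B_ra _ (x r) (ra _ _)) laraC.
  rewrite -!(B_ra _ _ (ra (g s) (x r))) -(B_ra _ _ (g s)).
  set a := B _ (g s); set b := B _ (ra (g s) (x s)); set c := B _ (ra (g s) (x r)).
  by rewrite addrCA -!addrA; congr (_ + _); rewrite addrCA; congr (_ + _); rewrite addrC.
rewrite e1 big_split /= (sum_shift (F := F)) /F ?xL1 ?x0 ?la0 ?B_0 //.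
rewrite addxx add0r.
under eq_bigr do rewrite big_split.
rewrite big_split /= /cyc2 tD addrACA; congr (_ + _).
  rewrite (sum_split_lt _ (K := fun r s => m r s + m' r s)); last first.
    by move=> r; rewrite /m /m' addxx.
  congr (_ + _); rewrite (exchange_lt _ (fun r s => m r s + m' r s)).
  rewrite (lin_sum_ord tY_lin); apply: eq_bigr => r _.
  rewrite (lin_sum_ord tY_lin); apply: eq_bigr => s _.
  by rewrite tD !tB.
under eq_bigr do rewrite big_split; rewrite big_split; congr (_ + _) => /=.
rewrite exchange_big (lin_sum_ord tY_lin); apply: eq_bigr => r _.
by rewrite (lin_sum_ord tY_lin).
Qed.

Let dga r a : dT (ra (g r) a) =
  la (x r.+1) (ra (q r) a) + ra (ra (q r.-1) (x r.-1)) a.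
Proof. by rewrite dT_ra dg raD laraC. Qed.

Let dqx r : dT (ra (q r) (x r)) = la (x r.+2) (ra (p r) (x r)).
Proof. by rewrite dT_ra dq raD laraC raxxp addr0. Qed.

Let dm r s : dY (m r s) = tY (be r.-1 s) + be s.-1 r.
Proof.
rewrite /m /be dB !dga BD B_D B_la raxx B_0 add0r tB; congr (_ + _).
  by case: r => //=; rewrite x0 !ra_0 !ra0 !B0.
rewrite -B_ra raxx B0 add0r.
by case: s => //=; rewrite x0 !ra_0 !ra0 !B_0.
Qed.

Let dm' r s : dY (m' r s) = al r s + tY (al s r).
Proof.
rewrite /m' /al dB !dga !raxxp !addr0 B_la tB.
by rewrite -B_ra.
Qed.

Let dh r s : dY (h r s) = al r.-1 s + be s r.
Proof.
rewrite /h /al /be dB dT_ra dga raxxp addr0 dg BD B_la raxx B_0 add0r.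
rewrite laraC -B_ra; congr (_ + _).
by case: r => //=; rewrite x0 ra_0 !B0.
Qed.

Lemma dcyc2 : dY cyc2 = cyc3 + tY cyc3.
Proof.
have al0 s : al 0 s = 0 by rewrite /al x0 ra_0 B0.
have be0 s : be 0 s = 0 by rewrite /be x0 ra_0 ra0 B_0.
have alL s : al L.-1 s = 0 by rewrite /al xL1 ra_0 B0.
have beL s : be L.-1 s = 0 by rewrite /be xL1 ra_0 ra0 B_0.
have -> : dY cyc2 =
    \sum_(r < L) \sum_(s < L | (r < s)%N)
      (tY (be r.-1 s) + be s.-1 r + (al r s + tY (al s r))) +
    \sum_(r < L) \sum_(s < L) (al r.-1 s + be s r).
  rewrite /cyc2 dD; congr (_ + _); rewrite (lin_sum_ord dY_lin);
    apply: eq_bigr => r _; rewrite (lin_sum_ord dY_lin); apply: eq_bigr => s _.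
    by rewrite dD dm dm'.
  by rewrite dh.
under eq_bigr do rewrite !big_split /=.
under [X in _ + X]eq_bigr do rewrite !big_split /=.
rewrite !big_split /=.
set b1 := \sum_(r < L) \sum_(s < L | _) tY (be r.-1 s).
set b2 := \sum_(r < L) \sum_(s < L | _) be s.-1 r.
set a1 := \sum_(r < L) \sum_(s < L | _) al r s.
set a2 := \sum_(r < L) \sum_(s < L | _) tY (al s r).
set a3 := \sum_(r < L) \sum_(s < L) al r.-1 s.
set b3 := \sum_(r < L) \sum_(s < L) be s r.
(* The half sum coming from [m'] cancels one half of the full sum coming from [h], and the other
   half is the one kept in [cyc3]. The same happens below for [be], with [m] in place of [m']. *)
have ea : a1 + a3 = \sum_(r < L) \sum_(s < L | (s < r)%N) al r s.
  rewrite /a3 (sum_shift (F := fun r => \sum_(s < L) al r s)).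
  - rewrite (sum_split_lt _ (K := al)); first by rewrite addxK.
    by move=> r; rewrite /al raxx B_0.
  - by rewrite big1.
  - by rewrite big1.
have ea2 : a2 = tY (\sum_(r < L) \sum_(s < L | (s < r)%N) al r s).
  rewrite (exchange_lt _ al) (lin_sum_ord tY_lin); apply: eq_bigr => r _.
  by rewrite (lin_sum_ord tY_lin).
have eb1 : b1 = tY (\sum_(r < L) \sum_(s < L | (r.+1 < s)%N) be r s).
  (* Replacing r by [r.-1.+1] changes the range of s only for r = 0, where both inner sums vanish
     because [be 0 s = 0]. *)
  rewrite /b1 (eq_bigr (fun r : 'I_L => \sum_(s < L | (r.-1.+1 < s)%N) tY (be r.-1 s))).
    rewrite (sum_shift (F := fun r => \sum_(s < L | (r.+1 < s)%N) tY (be r s))).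
    - rewrite (lin_sum_ord tY_lin); apply: eq_bigr => r _.
      by rewrite (lin_sum_ord tY_lin).
    - by rewrite big1 // => s _; rewrite be0 lin0.
    - by rewrite big1 // => s _; rewrite beL lin0.
  case=> -[|r] //= _ _; rewrite !big1 // => s _; by rewrite be0 lin0.
have eb : b2 + b3 = \sum_(r < L) \sum_(s < L | (r.+1 < s)%N) be r s.
  rewrite /b2 -(exchange_lt _ (fun r s => be r.-1 s)) /b3 exchange_big /=.
  rewrite (eq_bigr (fun r : 'I_L => \sum_(s < L | (s < r.-1.+1)%N) be r.-1 s)).
    rewrite (sum_shift (F := fun r => \sum_(s < L | (s < r.+1)%N) be r s)).
    - rewrite -big_split; apply: eq_bigr => r _ /=.
      rewrite [X in _ + X](bigID (fun s : 'I_L => (s < r.+1)%N)) /= addxK.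
      rewrite (bigID (fun s : 'I_L => s == r.+1 :> nat)) /= big1 ?add0r.
        apply: eq_bigl => s; by rewrite -leqNgt eq_sym [RHS]ltn_neqAle andbC.
      by move=> s /andP [_ /eqP ->]; rewrite /be raxx B_0.
    - by rewrite big1.
    - by rewrite big1.
  case=> -[|r] //= _ _; rewrite !big1 // => s _; by rewrite be0.
rewrite /cyc3 -ea -eb tD; rewrite -ea in ea2; rewrite -eb in eb1.
by rewrite -ea2 -eb1 [LHS](AC ((2*2)*2) ((3*5)*(2*6)*(4*1)))%AC.
Qed.

Let et r s := B (ra (ra (q r) (x r)) (x s.+1)) (ra (ra (q s) (x s)) (x r.+1)).

(** The differential of q_r x_r is x_(r+2) p_r x_r, and B moves x_(r+2) next to x_(r+1), where it
    dies. Hence no term in p survives; what remains of [al s r] and of [be r s.+1] is the same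
    [et s r], so the two sums of [cyc3] cancel. *)
Let dal r s : dY (al r s) = et r s.
Proof.
rewrite /al /et dB dqx B_la raxx B_0 add0r dT_ra dga raxxp addr0.
by rewrite laraC -B_ra.
Qed.

Let dbe r s : dY (be r s.+1) = et s r.
Proof.
rewrite /be /et dB dga dT_ra dqx BD B_la raxx B_0 add0r laraC -B_ra raxx B0.
by rewrite addr0.
Qed.

Lemma dcyc3 : dY cyc3 = 0.
Proof.
rewrite /cyc3 dD (exchange_lt _ al) !(lin_sum_ord dY_lin).
have etL r : et L.-1 r = 0 by rewrite /et xL1 ra_0 ra0 B0.
suff -> : \sum_(r < L) dY (\sum_(s < L | (r.+1 < s)%N) be r s) =
    \sum_(r < L) dY (\sum_(s < L | (r < s)%N) al s r) by rewrite addxx.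
apply: eq_bigr => r _; rewrite !(lin_sum_ord dY_lin) !(big_mkcond (fun s : 'I_L => (_ < s)%N)) /=.
pose F s := if (r < s)%N then et s r else 0.
rewrite [RHS](eq_bigr (fun s : 'I_L => F s)); last by move=> s _; rewrite dal.
rewrite -(sum_shift (F := F)); first last.
- by rewrite /F etL; case: ifP.
- by [].
by apply: eq_bigr => -[[|s] ?] _ //=; rewrite /F dbe.
Qed.

End Cycle.
End CyclicForm.

(** * The Koszul complex of a chain of relations *)

(* The Koszul complex of T for the relations x_r x_(r+1) = 0: G is the component
   on the vertices, W i j the one on the chain x_(i+1) ... x_j. *)
Section Koszul.
Variables (A : dgAlg) (T : lmodType F2).
Variables (la : A -> T -> T) (ra : T -> A -> T) (dT : T -> T).
Hypotheses (la_bilin : bilinear la) (ra_bilin : bilinear ra).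
Hypotheses (laA : forall a b t, la a (la b t) = la (dgmul a b) t)
  (raA : forall t a b, ra (ra t a) b = ra t (dgmul a b))
  (laraC : forall a t b, ra (la a t) b = la a (ra t b))
  (ra1 : forall t, ra t dgone = t).
Hypotheses (dT_lin : linear dT) (dT_dT : forall t, dT (dT t) = 0)
  (dT_la : forall a t, dT (la a t) = la a (dT t))
  (dT_ra : forall t a, dT (ra t a) = ra (dT t) a).
Variables (vert : finType) (ev : vert -> A).
Hypotheses (ev_ev : forall v w, dgmul (ev v) (ev w) = if v == w then ev v else 0)
  (ev_sum : \sum_v ev v = dgone).
Variables (N : nat) (x es et : nat -> A).
Hypotheses (x0 : x 0%N = 0) (xN : forall r, (N < r)%N -> x r = 0).
Hypothesis xx : forall r, dgmul (x r) (x r.+1) = 0.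
Hypotheses (et_x : forall r, (0 < r)%N -> dgmul (et r) (x r.+1) = x r.+1)
  (x_es : forall r, (r < N)%N -> dgmul (x r) (es r.+1) = x r).
Local Notation L := N.+2.

Let la0 t : la 0 t = 0. Proof. exact: lin0 (la_bilin.1 t). Qed.
Let la_0 a : la a 0 = 0. Proof. exact: lin0 (la_bilin.2 a). Qed.
Let ra_0 t : ra t 0 = 0. Proof. exact: lin0 (ra_bilin.2 t). Qed.
Let ra0 a : ra 0 a = 0. Proof. exact: lin0 (ra_bilin.1 a). Qed.
Let la_D a t u : la a (t + u) = la a t + la a u.
Proof. exact: linD (la_bilin.2 a) _ _. Qed.
Let raD t u a : ra (t + u) a = ra t a + ra u a.
Proof. exact: linD (ra_bilin.1 a) _ _. Qed.
Let dTD t u : dT (t + u) = dT t + dT u.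
Proof. exact: linD dT_lin _ _. Qed.

Definition diag t := \sum_v la (ev v) (ra t (ev v)).

Lemma diag_lin : linear diag.
Proof.
move=> a t u; rewrite /diag scaler_sumr -big_split; apply: eq_bigr => v _.
by rewrite ra_bilin.1 la_bilin.2.
Qed.

Let diagD t u : diag (t + u) = diag t + diag u.
Proof. exact: linD diag_lin _ _. Qed.

Lemma diagK t : diag (diag t) = diag t.
Proof.
rewrite /diag; apply: eq_bigr => v _.
rewrite (lin_sum _ _ (ra_bilin.1 _)) (lin_sum _ _ (la_bilin.2 _)).
rewrite (bigD1 v) //= big1 ?addr0.
  by rewrite laraC laA raA !ev_ev eqxx.
move=> w /negbTE wv; rewrite laraC laA raA !ev_ev wv.
by rewrite ra_0 la_0.
Qed.

Lemma dT_diag t : dT (diag t) = diag (dT t).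
Proof.
by rewrite /diag (lin_sum _ _ dT_lin); apply: eq_bigr => v _; rewrite dT_la dT_ra.
Qed.

Definition comm_gen (z : T) : Prop := exists a t, z = la a t + ra t a.
Definition comm : T -> Prop := span comm_gen.

Lemma comm_dT t : comm t -> comm (dT t).
Proof.
apply: span_map => // _ [a [u ->]]; apply: span_gen; exists a, (dT u).
by rewrite dTD dT_la dT_ra.
Qed.

(** Each t e_v differs from e_v t e_v by the commutator of e_v with t e_v, and t is the sum of the t
    e_v. *)
Lemma comm_diag t : comm (t + diag t).
Proof.
have {1}-> : t = \sum_v ra t (ev v).
  by rewrite -(lin_sum _ _ (ra_bilin.2 t)) ev_sum ra1.
rewrite /diag -big_split; elim/big_rec: _ => [|v z _]; first exact: span0.
apply: spanD; apply: span_gen; exists (ev v), (ra t (ev v)).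
by rewrite raA ev_ev eqxx addrC.
Qed.

Definition koszul0 (W : nat -> nat -> T) : T :=
  \sum_(r < L) (la (x r) (W r.-1 r) + ra (W r.-1 r) (x r)).
(** Both ways of extending the chain by one arrow. For i = 0 the predecessor is truncated and the
    term is killed by x_0 = 0; for j = N the other one is killed by x_(N+1) = 0. *)
Definition koszul (W : nat -> nat -> T) (i j : nat) : T :=
  ra (W i.-1 j) (x i) + la (x j.+1) (W i j.+1).

Definition chain i j := (i < j <= N)%N.

(** The component on x_(i+1) ... x_j lives in the corner of T cut out by the idempotents at the end
    of x_j (on the left) and at the start of x_(i+1) (on the right). *)
Definition family (G : T) (W : nat -> nat -> T) : Prop :=
  [/\ diag G = G, forall i j, ~~ chain i j -> W i j = 0,
      forall i j, la (et j) (W i j) = W i j &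
      forall i j, ra (W i j) (es i.+1) = W i j].

Lemma koszul0D W W' :
  koszul0 (fun i j => W i j + W' i j) = koszul0 W + koszul0 W'.
Proof.
rewrite /koszul0 -big_split; apply: eq_bigr => r _ /=.
by rewrite la_D raD addrACA.
Qed.

Lemma koszulD W W' i j :
  koszul (fun i j => W i j + W' i j) i j = koszul W i j + koszul W' i j.
Proof. by rewrite /koszul la_D raD addrACA. Qed.

Lemma dT_koszul0 W : dT (koszul0 W) = koszul0 (fun i j => dT (W i j)).
Proof.
rewrite /koszul0 (lin_sum _ _ dT_lin); apply: eq_bigr => r _.
by rewrite dTD dT_la dT_ra.
Qed.

Lemma dT_koszul W i j : dT (koszul W i j) = koszul (fun i j => dT (W i j)) i j.
Proof. by rewrite /koszul dTD dT_la dT_ra. Qed.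

Lemma comm_koszul0 W : comm (koszul0 W).
Proof.
rewrite /koszul0; elim/big_rec: _ => [|r z _]; first exact: span0.
by apply: spanD; apply: span_gen; exists (x r), (W r.-1 r).
Qed.

Lemma eq_koszul0 W W' : (forall i j, chain i j -> W i j = W' i j) ->
  koszul0 W = koszul0 W'.
Proof.
move=> e; apply: eq_bigr => -[[|r] rL] _ /=; first by rewrite x0 !la0 !ra_0.
have [rN|rN] := leqP r.+1 N; last by rewrite xN // !la0 !ra_0.
by rewrite e // /chain ltnSn.
Qed.

Lemma eq_koszul W W' i j : (forall i j, chain i j -> W i j = W' i j) ->
  chain i j -> koszul W i j = koszul W' i j.
Proof.
move=> e /andP [ij jN]; rewrite /koszul; congr (_ + _).
  case: i ij => [|i] ij; first by rewrite x0 !ra_0.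
  by rewrite e // /chain (ltnW ij).
have [jN'|jN'] := leqP j.+1 N; last by rewrite xN // !la0.
by rewrite e // /chain jN' leqW.
Qed.

(** Two arrows on the same side multiply to 0; a term with one arrow on each side, x_(r+1) W x_r,
    arises from the indices r and r + 1 and cancels. *)
Lemma koszul0_koszul W : koszul0 (koszul W) = 0.
Proof.
pose F r := la (x r.+1) (ra (W r.-1 r.+1) (x r)).
rewrite /koszul0 (eq_bigr (fun r : 'I_L => F r.-1 + F r)).
  rewrite big_split /= (sum_shift (F := F)) ?addxx // /F ?x0 ?ra_0 ?la_0 //.
  by rewrite xN // la0.
move=> -[r rL] _; rewrite /koszul /F /= la_D raD.
case: r rL => [|r] rL /=; first by rewrite x0 !(la0, ra_0, la_0) !add0r.
rewrite raA xx ra_0 add0r laraC; congr (_ + _).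
by rewrite laA xx la0 addr0.
Qed.

Lemma koszul_koszul W i j : koszul (koszul W) i j = 0.
Proof.
rewrite /koszul la_D raD laA xx la0 addr0 laraC.
case: i => [|i] /=; first by rewrite x0 !(ra_0, la_0) !add0r.
by rewrite raA xx ra_0 add0r addxx.
Qed.

(** * A contracting homotopy up to lower filtration *)

Section Contraction.
(** In the application these are [strip], [cut] and [fold]. The identities below make them a
    contraction of the complex augmented by T / [A, T] when T has no differential; the hypotheses on
    [Fil] say that they commute with [dT] up to the next lower step. *)
Variables (S D : nat -> T -> T) (J : T -> T).
Hypotheses (S_lin : forall r, linear (S r)) (D_lin : forall r, linear (D r))
  (J_lin : linear J).
Hypotheses (S_la : forall r a t, S r (la a t) = la a (S r t))
  (S_es : forall r t, ra (S r t) (es r) = S r t)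
  (D_et : forall r t, la (et r) (D r t) = D r t)
  (D_es : forall r t, ra (D r t) (es r) = D r t).
Hypotheses
  (S_x : forall r q t, (0 < r <= N)%N -> S r (ra t (x q)) =
     if q == r then ra t (es r) + ra (S r.-1 t) (x r.-1) else 0)
  (D_x : forall r q t, (0 < r <= N)%N -> D r (la (x q) t + ra t (x q)) =
     (if q == r then la (et r) (ra t (es r) + ra (S r.-1 t) (x r.-1)) else 0) +
     (if q == r.+1 then la (x r.+1) (S r t) else 0))
  (D_sum : forall t,
     \sum_(r < L) (la (x r) (D r t) + ra (D r t) (x r)) = diag t + diag (J t)).
Hypotheses (J_comm : forall t, comm t -> J t = 0)
  (comm_J : forall t, comm (t + J t)).
Variable Fil : nat -> T -> Prop.
Hypotheses (Fil_zero : forall t, Fil 0 t -> t = 0)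
  (Fil0 : forall n, Fil n 0)
  (FilD : forall n t u, Fil n t -> Fil n u -> Fil n (t + u))
  (Fil_la : forall n a t, Fil n t -> Fil n (la a t))
  (Fil_ra : forall n t a, Fil n t -> Fil n (ra t a)).
Hypotheses
  (Fil_S : forall n r t, Fil n.+1 t -> Fil n (dT (S r t) + S r (dT t)))
  (Fil_D : forall n r t, Fil n.+1 t -> Fil n (dT (D r t) + D r (dT t)))
  (Fil_J : forall n t, Fil n.+1 t -> Fil n (dT (J t) + J (dT t))).

Lemma Fil_diag n t : Fil n t -> Fil n (diag t).
Proof.
move=> Ft; rewrite /diag; elim/big_ind: _ => // [|v _]; first exact: FilD.
exact/Fil_la/Fil_ra.
Qed.

(** The homotopy goes from the vertices to single arrows by [D], and prepends x_(i+1) to the chain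
    x_(i+2) ... x_j by [S]. *)
Definition contr (G : T) (W : nat -> nat -> T) (i j : nat) : T :=
  if chain i j then if j == i.+1 then D j G else S i.+1 (W i.+1 j) else 0.

Lemma contr_family s G W : family G W -> family (diag (J s)) (contr G W).
Proof.
move=> [_ _ tW _]; split; rewrite /contr.
- exact: diagK.
- by move=> i j /negbTE ->.
- move=> i j; case: ifP => _; last exact: la_0.
  by case: eqP => [->|_]; rewrite ?D_et // -S_la tW.
- move=> i j; case: ifP => _; last exact: ra0.
  by case: eqP => [->|_]; rewrite ?D_es ?S_es.
Qed.

Lemma contr0 G W : koszul0 (contr G W) = diag G + diag (J G).
Proof.
rewrite -D_sum; apply: eq_bigr => -[[|r] rL] _ /=; first by rewrite x0 !la0 !ra_0.
have [rN|rN] := leqP r.+1 N; last by rewrite xN // !la0 !ra_0.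
by rewrite /contr /chain ltnSn rN eqxx.
Qed.

Lemma contrS G W i j : (i.+1 < j <= N)%N -> contr G W i j = S i.+1 (W i.+1 j).
Proof.
move=> /andP [ij jN]; rewrite /contr /chain (ltnW ij) jN /=.
by case: eqP ij => // ->; rewrite ltnn.
Qed.

Lemma koszul_contr G W i j : chain i j -> koszul (contr G W) i j =
  ra (S i (W i j)) (x i) + la (x j.+1) (S i.+1 (W i.+1 j.+1)).
Proof.
move=> /andP [ij jN]; rewrite /koszul; congr (_ + _).
  by case: i ij => [|i] ij /=; rewrite ?x0 ?ra_0 // contrS ?ij.
have [jN'|jN'] := leqP j.+1 N; last by rewrite xN // !la0.
by rewrite contrS // jN' ltnS ij.
Qed.

(** The homotopy identity alone reads W + [koszul (contr G W)] = D([koszul0 W]). By hypothesis the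
    right side is D(dT G), so all that remains is the failure of [D] to commute with [dT], which has
    lower filtration. *)
Lemma contr1 G W r : family G W -> chain r r.+1 -> dT G = koszul0 W ->
  W r r.+1 + dT (contr G W r r.+1) + koszul (contr G W) r r.+1 =
  dT (D r.+1 G) + D r.+1 (dT G).
Proof.
move=> [_ W0 tW sW] ch -> ; have /andP [_ rN] := ch.
rewrite {1}/contr ch eqxx (addrC (W _ _)) -addrA; congr (_ + _).
rewrite /koszul0 (lin_sum _ _ (D_lin _)).
under eq_bigr do rewrite D_x //.
rewrite big_split /= -!big_mkcond /=.
have rL : (r.+1 < L)%N by rewrite ltnS ltnW.
have rL2 : (r.+2 < L)%N by rewrite !ltnS.
rewrite (big_pred1 (Ordinal rL)) // (big_pred1 (Ordinal rL2)) //=.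
rewrite sW la_D -laraC -S_la !tW -addrA; congr (_ + _).
by rewrite koszul_contr.
Qed.

Lemma contr2 G W i j : family G W -> chain i j -> (i.+1 < j)%N ->
  dT (W i.+1 j) = koszul W i.+1 j ->
  W i j + dT (contr G W i j) + koszul (contr G W) i j =
  dT (S i.+1 (W i.+1 j)) + S i.+1 (dT (W i.+1 j)).
Proof.
move=> [_ W0 tW sW] ch ij ->; have /andP [_ jN] := ch.
rewrite contrS ?ij // (addrC (W _ _)) -addrA; congr (_ + _).
rewrite koszul_contr // /koszul (linD (S_lin _)) S_la addrA; congr (_ + _).
by rewrite S_x ?eqxx ?sW //= (leq_trans _ jN) // ltnW.
Qed.

(** (s, G, W) is a cycle of the total complex augmented by T / [A, T], and it is shown to be a
    boundary. Subtracting the boundary of ([diag (J s)], [contr G W]) leaves a cycle one filtration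
    step lower; its first entry is then in [A, T], and the recursion restarts with s = 0. *)
Lemma koszul_acyclic n s G W : family G W ->
  Fil n s -> Fil n G -> (forall i j, Fil n (W i j)) ->
  comm (dT s + G) -> dT G = koszul0 W ->
  (forall i j, chain i j -> dT (W i j) = koszul W i j) ->
  exists G' W', [/\ family G' W', comm (s + G'), G = dT G' + koszul0 W' &
    forall i j, chain i j -> W i j = dT (W' i j) + koszul W' i j].
Proof.
have J0 : J 0 = 0 by exact: lin0 J_lin.
have d0 : diag 0 = 0 by exact: lin0 diag_lin.
elim: n s G W => [|n IH] s G W fGW Fs FG FW cs eG eW.
  exists 0, (fun _ _ => 0); rewrite (Fil_zero Fs) (Fil_zero FG) !addr0.
  split; [by split|exact: span0| |].
  - rewrite (lin0 dT_lin) add0r /koszul0 big1 // => r _.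
    by rewrite la_0 ra0 addr0.
  - by move=> i j _; rewrite (Fil_zero (FW i j)) (lin0 dT_lin) /koszul la_0 ra0 !addr0.
pose G1 := diag (J s); pose W1 := contr G W.
have fH : family G1 W1 by exact: contr_family.
pose G2 := G + dT G1 + koszul0 W1.
pose W2 i j := if chain i j then W i j + dT (W1 i j) + koszul W1 i j else 0.
have e2 i j : chain i j -> W2 i j = W i j + dT (W1 i j) + koszul W1 i j.
  by move=> ch; rewrite /W2 ch.
have csJ : comm (s + G1).
  rewrite -[s](addrK (J s)) oppxx -addrA; apply: spanD; first exact: comm_J.
  exact: comm_diag.
have eJ : J G = J (dT s).
  by apply: addr_eq2; rewrite -(linD J_lin) addrC J_comm.
have [dG0 W0 tW sW] := fGW; have [dG1 W10 tW1 sW1] := fH.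
have fG2 : family G2 W2.
  split; rewrite /W2.
  - rewrite /G2 contr0 !diagD !diagK dG0; congr (_ + _ + _).
    by rewrite -dT_diag dG1.
  - by move=> i j /negbTE ->.
  - move=> i j; case: ifP => [/andP [ij jN]|_]; last exact: la_0.
    rewrite !la_D -dT_la tW tW1; congr (_ + _).
    by rewrite /koszul -laraC tW1 laA et_x // (leq_ltn_trans _ ij).
  - move=> i j; case: ifP => [/andP [ij jN]|_]; last exact: ra0.
    rewrite !raD -dT_ra sW sW1; congr (_ + _).
    by rewrite /koszul laraC sW1 raA x_es // (leq_trans ij).
(* By [contr0] the two copies of G cancel, and by [eJ] what remains is the diagonal part of dT(J s)
   + J(dT s), which lies one step lower. *)
have FG2 : Fil n G2.
  rewrite /G2 /G1 contr0 dG0 dT_diag (addrC G) -!addrA addxK -diagD.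
  by rewrite eJ; apply/Fil_diag/Fil_J.
have FW2 i j : Fil n (W2 i j).
  rewrite /W2; case: ifP => // ch; have /andP [ij jN] := ch.
  have [e|ne] := eqVneq j i.+1.
    by rewrite e in ch *; rewrite contr1 //; apply: Fil_D.
  have ij' : (i.+1 < j)%N by rewrite ltn_neqAle eq_sym ne ij.
  by rewrite contr2 //; [apply: Fil_S|apply: eW; rewrite /chain ij' jN].
have [|||||||G' [W' [fG' cG' eG' eW']]] := IH 0 G2 W2 => //.
- rewrite (lin0 dT_lin) add0r /G2; apply: spanD; last exact: comm_koszul0.
  have -> : G + dT G1 = dT s + G + dT (s + G1).
    by rewrite dTD addrACA addrA addxx add0r.
  by apply: spanD => //; apply: comm_dT.
- rewrite (eq_koszul0 e2) (koszul0D (fun i j => W i j + dT (W1 i j))) koszul0D.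
  by rewrite koszul0_koszul addr0 /G2 !dTD dT_dT addr0 eG dT_koszul0.
- move=> i j ch; rewrite e2 // (dTD (_ + _)) dTD dT_dT addr0 (eq_koszul e2) //.
  rewrite (koszulD (fun i j => W i j + dT (W1 i j))) koszulD.
  by rewrite koszul_koszul addr0 eW // dT_koszul.
exists (G1 + G'), (fun i j => W1 i j + W' i j).
have [dG' W'0 tW' sW'] := fG'; split.
- split.
  + by rewrite diagD dG1 dG'.
  + by move=> i j ch; rewrite W10 // W'0 // addr0.
  + by move=> i j; rewrite la_D tW1 tW'.
  + by move=> i j; rewrite raD sW1 sW'.
- by rewrite addrA; apply: spanD => //; rewrite -[G']add0r.
- rewrite dTD koszul0D addrACA -eG' /G2.
  by rewrite -(addrA G) (addrC G) addxK.
move=> i j ch; rewrite dTD koszulD addrACA -eW' // e2 //.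
by rewrite -(addrA (W i j)) (addrC (W i j)) addxK.
Qed.

End Contraction.
End Koszul.

(** * A matrix basis of the antipodal algebra *)

(* The point j of the pointed matched circle, 0 <= j <= 2n + 1, lies on the
   vertex vtx n j. *)
Definition vtx (n j : nat) : 'I_n.+1 := inord (if (j < n.+1)%N then j else j - n.+1)%N.

Fixpoint segment (A : dgAlg) (n : nat) (ev : 'I_n.+1 -> A) (y : nat -> A) (i d : nat) : A :=
  if d is d'.+1 then dgmul (segment ev y i d') (y (i + d')%N) else ev (vtx n i).

Arguments segment : simpl never.

Lemma segment0 (A : dgAlg) n (ev : 'I_n.+1 -> A) y i : segment ev y i 0 = ev (vtx n i).
Proof. by []. Qed.

Lemma segmentS (A : dgAlg) n (ev : 'I_n.+1 -> A) y i d :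
  segment ev y i d.+1 = dgmul (segment ev y i d) (y (i + d)%N).
Proof. by []. Qed.

(* A is the algebra of upper triangular matrices indexed by the points of the
   pointed matched circle whose diagonal entries agree on matched points: y l is
   the elementary matrix (l, l + 1). *)
Record matched_alg (n : nat) (A : dgAlg) (ev : 'I_n.+1 -> A) (y : nat -> A) : Prop :=
  MatchedAlg {
  ma_hom : forall a : A, hom 0 a;
  ma_ev : forall v w, dgmul (ev v) (ev w) = if v == w then ev v else 0;
  ma_sum : \sum_v ev v = dgone;
  ma_out : forall l, (n.*2.+1 <= l)%N -> y l = 0;
  ma_evy : forall v l, dgmul (ev v) (y l) = if v == vtx n l then y l else 0;
  ma_yev : forall v l, dgmul (y l) (ev v) = if v == vtx n l.+1 then y l else 0;
  ma_yy : forall l m, m != l.+1 -> dgmul (y l) (y m) = 0;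
  ma_ind : forall P : A -> Prop, P 0 -> (forall a b c, P b -> P c -> P (a *: b + c)) ->
    (forall v, P (ev v)) ->
    (forall i d, (i + d <= n.*2)%N -> P (segment ev y i d.+1)) -> forall a, P a;
  ma_lift : forall (W : lmodType F2) (Fv : 'I_n.+1 -> W) (Fs : nat -> nat -> W),
    exists L : A -> W, [/\ linear L, forall v, L (ev v) = Fv v &
      forall i d, (i + d <= n.*2)%N -> L (segment ev y i d.+1) = Fs i d] }.

Section Presentation.
Variables (k : nat) (hk : (0 < k)%N).
Local Notation n := (k.*2.-1).
Local Notation N := (n.*2.+1).
Local Notation A := (antipodal_alg k).
Local Notation arrow := (ap_arrow k).
Local Notation src := (@ap_src k).
Local Notation tgt := (@ap_tgt k).
Local Notation path := (qpath src tgt).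

Definition cls (z : ap_path k) : A := qpi (ideal_gen (@ap_rel k)) z.
Definition pcls (p : path) : A := cls (pbasis p).
Definition ap_ev (v : 'I_n.+1) : A := pcls (ptriv src tgt v).
Definition ar (e : arrow) : A := pcls (parrow src tgt e).

(** The nonzero paths with arrows are the subpaths of the single path made of all the a_i in order,
    then c, then all the b_i. An arrow is recorded by its place in that path. *)
Definition pos (e : arrow) : nat :=
  match e with
  | Some (true, i) => i
  | None => n
  | Some (false, i) => n.+1 + i
  end.

Definition arrow_at (l : nat) : option arrow :=
  if insub l is Some i then Some (Some (true, i)) else
  if l == n then Some None else
  if insub (l - n.+1)%N is Some i then Some (Some (false, i)) else None.

Lemma pos_lt e : (pos e < N)%N.
Proof. by case: e => [[[] i]|] /=; try have := ltn_ord i; lia. Qed.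

Lemma arrow_at_pos e : arrow_at (pos e) = Some e.
Proof.
rewrite /arrow_at; case: e => [[[] i]|] /=.
- by rewrite valK.
- have -> : insub (n.+1 + i)%N = None :> option 'I_n by apply: insubN; lia.
  have /negbTE -> : (n.+1 + i)%N != n by lia.
  by rewrite addKn valK.
have -> : insub n = None :> option 'I_n by apply: insubN; lia.
by rewrite eqxx.
Qed.

Lemma pos_arrow_at l : (l < N)%N -> exists2 e, arrow_at l = Some e & pos e = l.
Proof.
move=> lN; rewrite /arrow_at.
case: insubP => [i _ <-|ln]; first by exists (Some (true, i)).
case: eqP => [->|/eqP ln']; first by exists None.
case: insubP => [i _ e|]; last by lia.
by exists (Some (false, i)) => //=; rewrite e; lia.
Qed.

Definition ap_y (l : nat) : A := if arrow_at l is Some e then ar e else 0.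

Lemma ap_y_pos e : ap_y (pos e) = ar e.
Proof. by rewrite /ap_y arrow_at_pos. Qed.

Lemma val_vtx j : (j <= n.*2.+1)%N -> vtx n j = (if j < n.+1 then j else j - n.+1)%N :> nat.
Proof. by move=> jN; rewrite /vtx inordK //; case: ifP; lia. Qed.

Lemma src_vtx e : src e = vtx n (pos e).
Proof.
apply: val_inj; rewrite /= val_vtx ?(ltnW (pos_lt e)) //.
by case: e => [[[] i]|] /=; try have := ltn_ord i; case: ifP; lia.
Qed.

Lemma tgt_vtx e : tgt e = vtx n (pos e).+1.
Proof.
apply: val_inj; rewrite /= val_vtx ?pos_lt //.
by case: e => [[[] i]|] /=; rewrite ?/bump; try have := ltn_ord i; case: ifP; lia.
Qed.

Lemma cls_lin : linear cls. Proof. exact: qpi_lin. Qed.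

Lemma cls_mul (z t : ap_path k) : dgmul (cls z) (cls t) = cls (amul z t).
Proof. exact: quot_mulE. Qed.

Lemma pcls_mul p q : dgmul (pcls p) (pcls q) = cls (pbasis_opt (pcat p q)).
Proof. by rewrite /pcls cls_mul [amul _ _]path_mulE. Qed.

Lemma cls0 : cls 0 = 0. Proof. exact: lin0 cls_lin. Qed.

Lemma pcls_mul0 p q : pend p <> pstart q -> dgmul (pcls p) (pcls q) = 0.
Proof. by move=> h; rewrite pcls_mul pcat_None //= cls0. Qed.

Lemma pcls_cat p q r : pend p = pstart q -> pstart r = pstart p ->
  parrows r = parrows p ++ parrows q -> dgmul (pcls p) (pcls q) = pcls r.
Proof.
move=> e r1 r2; rewrite pcls_mul; have [u -> [u1 u2 _]] := pcat_Some e.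
by congr cls; congr pbasis; apply: qpathP; rewrite ?u1 ?u2 ?r1 ?r2.
Qed.

Lemma ap_evP v w : dgmul (ap_ev v) (ap_ev w) = if v == w then ap_ev v else 0.
Proof.
case: eqP => [<-|ne]; first exact: pcls_cat.
exact: pcls_mul0.
Qed.

Lemma ap_sum : \sum_v ap_ev v = dgone.
Proof. by rewrite -(lin_sum _ _ cls_lin). Qed.

Lemma ap_evar v e : dgmul (ap_ev v) (ar e) = if v == src e then ar e else 0.
Proof.
case: eqP => [->|ne]; first exact: pcls_cat.
exact: pcls_mul0.
Qed.

Lemma ap_arev v e : dgmul (ar e) (ap_ev v) = if v == tgt e then ar e else 0.
Proof.
case: eqP => [->|ne]; first exact: pcls_cat.
by apply: pcls_mul0 => h; apply: ne; exact: esym h.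
Qed.

Lemma ap_rel0 g : ap_rel g -> cls g = 0.
Proof.
move=> rg; apply: qpi0; rewrite -[g](amul1l g) -[amul _ g]amul1r.
exact/span_gen/IdealGen.
Qed.

Lemma ap_arar e f : pos f != (pos e).+1 -> dgmul (ar e) (ar f) = 0.
Proof.
move=> ne; have [h|h] := pselect (tgt e = src f); last first.
  exact: pcls_mul0.
rewrite /ar /pcls cls_mul; apply: ap_rel0.
move/(congr1 val): h ne; case: e f => [[[] i]|] [[[] j]|] /=;
  rewrite ?/bump ?leq0n ?add1n => h ne.
- by case/eqP: ne.
- exact: ApAB.
- by case/eqP: ne.
- exact: ApBA.
- by case/eqP: ne; lia.
- exact: ApBC.
- exact: ApCA.
- by case/eqP: ne; lia.
(* The product c c: it is composable only for n = 0, and k > 0 makes n odd. *)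
- by move: h hk; lia.
Qed.

Lemma ap_y_lt l : (l < N)%N -> exists2 e, ap_y l = ar e & pos e = l.
Proof. by move=> /pos_arrow_at [e h1 h2]; exists e; rewrite // /ap_y h1. Qed.

Lemma ap_y_out l : (N <= l)%N -> ap_y l = 0.
Proof.
move=> Nl; rewrite /ap_y; case h: (arrow_at l) => [e|//].
suff: (l < N)%N by rewrite ltnNge Nl.
have <- : pos e = l; last exact: pos_lt.
move: h; rewrite /arrow_at; case: insubP => [i _ <- [<-]|ln0] //.
case: eqP => [-> [<-] //|/eqP ln]; case: insubP => [i _ i_l|//] [<-] /=.
have : i = (l - n.+1)%N :> nat by exact: i_l.
by move: ln0 ln; rewrite -leqNgt; lia.
Qed.

Local Notation seg := (segment ap_ev ap_y).

Definition step (e f : arrow) : bool := pos f == (pos e).+1.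

Lemma seg_path i d : (i + d <= N)%N -> exists p : path,
  [/\ pstart p = vtx n i, pend p = vtx n (i + d),
      map pos (parrows p) = iota i d & seg i d = pcls p].
Proof.
elim: d => [|d IH] id; first by exists (ptriv src tgt (vtx n i)); rewrite addn0.
have [|p [p1 p2 p3 p4]] := IH; first by rewrite (leq_trans _ id) // leq_add2l.
have [|e e1 e2] := @ap_y_lt (i + d); first by rewrite -addnS.
have pe : pend p = pstart (parrow src tgt e) by rewrite p2 -e2 -src_vtx.
have [r _ [r1 r2 r3]] := pcat_Some pe; exists r; split.
- by rewrite r1.
- by rewrite r3 addnS -e2 -tgt_vtx.
- by rewrite r2 map_cat p3 -(addn1 d) iotaD /= e2.
by rewrite segmentS p4 e1; apply: pcls_cat.
Qed.

Lemma seg1 l : (l < N)%N -> seg l 1 = ap_y l.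
Proof.
by move=> /ap_y_lt [e e1 e2]; rewrite segmentS addn0 e1 ap_evar -e2 src_vtx eqxx.
Qed.

Lemma path_class v s (w : walk src tgt v s) (p : path) :
  pstart p = v -> parrows p = s ->
  [\/ pcls p = 0, exists u, pcls p = ap_ev u |
      exists i d, (i + d <= n.*2)%N /\ pcls p = seg i d.+1].
Proof.
elim/last_ind: s => [|s e IH] in p w *.
  by move=> pv ps; apply: Or32; exists v; congr pcls; apply: qpathP.
move=> pv ps; move: w; rewrite -cats1 walk_cat => /andP [w1 w2].
pose q : path := exist _ (v, s) w1.
have qe : pend q = src e by move: w2 => /= /andP [/eqP ->].
have -> : pcls p = dgmul (pcls q) (ar e).
  by apply/esym/pcls_cat; rewrite ?pv // ps -cats1.
have [->|[u ->]|[i [d [id ->]]]] := IH q w1 erefl erefl.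
- by apply: Or31; apply: lin0 ((dgmul_bilin A).1 _).
- rewrite ap_evar; case: eqP => _; last exact: Or31.
  apply: Or33; exists (pos e), 0%N; rewrite seg1 ?pos_lt ?ap_y_pos // addn0.
  by split=> //; rewrite -ltnS pos_lt.
have [pe|ne] := eqVneq (pos e) (i + d).+1.
  apply: Or33; exists i, d.+1; rewrite (segmentS _ _ i d.+1).
  by rewrite addnS -pe ap_y_pos -ltnS pos_lt.
apply: Or31; rewrite segmentS -dgmulA; have [|f -> f2] := @ap_y_lt (i + d) => //.
by rewrite ap_arar ?f2 // (lin0 ((dgmul_bilin A).2 _)).
Qed.

Lemma ap_ind (P : A -> Prop) : P 0 ->
  (forall a b c, P b -> P c -> P (a *: b + c)) -> (forall v, P (ap_ev v)) ->
  (forall i d, (i + d <= n.*2)%N -> P (seg i d.+1)) -> forall a, P a.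
Proof.
move=> P0 Pl Pv Ps; apply: quotP => z.
elim: (freeg_span z) => [|a g y [p ->] _ IH]; first by rewrite -/(cls 0) cls0.
rewrite qpi_lin; apply: Pl => //; rewrite -[qpi _ _]/(pcls p).
by case: (@path_class _ _ (valP p) p) => // [-> //|[u -> //]|[i [d [id ->]]]]; apply: Ps.
Qed.

(** * Linear maps out of the antipodal algebra *)

Section Lift.
Variables (W : lmodType F2) (Fv : 'I_n.+1 -> W) (Fs : nat -> nat -> W).

(** Paths containing two arrows that are not consecutive must go to 0 for the map to factor through
    the relations. [Fs i d] prescribes the value on d + 1 arrows, hence the size of the tail
    only. *)
Definition path_val (p : path) : W :=
  if ~~ sorted step (parrows p) then 0 else
  if parrows p is e :: s then Fs (pos e) (size s) else Fv (pstart p).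

Definition path_val_lin : path_sp src tgt -> W := fglift path_val.

Lemma path_val0 (p : path) s1 e f s2 :
  parrows p = s1 ++ e :: f :: s2 -> ~~ step e f -> path_val p = 0.
Proof.
rewrite /path_val => -> /negbTE ne; case: s1 => [|e0 s1] /=; rewrite ?ne //.
by rewrite cat_path /= ne !andbF.
Qed.

Lemma ap_rel_step g : ap_rel g -> exists e f : arrow,
  g = amul (arr src tgt e) (arr src tgt f) /\ ~~ step e f.
Proof.
case=> [i j h|i j h|i h|i h]; eexists; eexists; split; try reflexivity;
  by rewrite /step /=; try have := ltn_ord i; try have := ltn_ord j; lia.
Qed.

Lemma path_val_ideal g : ideal_gen (@ap_rel k) g -> path_val_lin g = 0.
Proof.
case=> {}g1 {}g g2 /ap_rel_step [e [f [-> ne]]].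
have lp : linear path_val_lin by exact: fglift_lin.
have [m1 m2] := path_mul_bilin src tgt.
pose x : path_sp src tgt := path_mul (pbasis (parrow src tgt e)) (pbasis (parrow src tgt f)).
rewrite -[amul _ _]/(path_mul (path_mul (g1 : path_sp src tgt) x) (g2 : path_sp src tgt)).
move: g1; apply: path_ext => [a u v|a u v|p]; first by rewrite !m1 lp.
  by rewrite scaler0 addr0.
move: g2; apply: path_ext => [a u v|a u v|q]; first by rewrite !m2 lp.
  by rewrite scaler0 addr0.
rewrite {}/x path_mulE.
case E: (pcat _ _) => [r|] /=; last by rewrite (lin0 (m2 _)) (lin0 (m1 _)) lin0.
have {}E : parrows r = [:: e; f].
  have [h|h] := pselect (pend (parrow src tgt e) = pstart (parrow src tgt f)).
    by move: E; have [u -> [_ u2 _]] := pcat_Some h; case=> <-.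
  by rewrite pcat_None in E.
rewrite path_mulE; have [h|h] := pselect (pend p = pstart r); last first.
  by rewrite pcat_None //= (lin0 (m1 _)) lin0.
have [u -> [_ u2 u3]] := pcat_Some h; rewrite path_mulE.
have [h'|h'] := pselect (pend u = pstart q); last first.
  by rewrite pcat_None //= lin0.
have [t -> [_ t2 _]] := pcat_Some h'.
rewrite [path_val_lin _]fgliftE (@path_val0 _ (parrows p) e f (parrows q)) //.
by rewrite t2 u2 E -catA.
Qed.

Definition ap_lift : A -> W := qlift path_val_lin.

Lemma ap_lift_lin : linear ap_lift.
Proof. exact: qlift_lin (fglift_lin _) path_val_ideal. Qed.

Lemma ap_liftE p : ap_lift (pcls p) = path_val p.
Proof. by rewrite /ap_lift (qliftE (fglift_lin _) path_val_ideal) fgliftE. Qed.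

Lemma ap_lift_ev v : ap_lift (ap_ev v) = Fv v.
Proof. by rewrite ap_liftE. Qed.

Lemma ap_lift_seg i d : (i + d <= n.*2)%N -> ap_lift (seg i d.+1) = Fs i d.
Proof.
move=> id; have [|p [p1 _ p3 ->]] := @seg_path i d.+1; first by rewrite addnS.
rewrite ap_liftE /path_val.
have -> : sorted step (parrows p).
  rewrite -(@sorted_map _ _ pos (fun a b => b == a.+1)) p3.
  by elim: d i {id p p1 p3} => [|d IH] i //=; rewrite eqxx /=; apply: IH.
move: p3; case: (parrows p) => [//|e s] /= [-> es]; congr Fs.
by rewrite -(size_map pos) es size_iota.
Qed.

End Lift.

Lemma antipodal_matched : matched_alg ap_ev ap_y.
Proof.
split.
- by [].
- exact: ap_evP.
- exact: ap_sum.
- exact: ap_y_out.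
- move=> v l; have [lN|lN] := ltnP l N; last first.
    by rewrite ap_y_out // (lin0 ((dgmul_bilin A).2 _)) if_same.
  by have [e -> <-] := ap_y_lt lN; rewrite ap_evar src_vtx.
- move=> v l; have [lN|lN] := ltnP l N; last first.
    by rewrite ap_y_out // (lin0 ((dgmul_bilin A).1 _)) if_same.
  by have [e -> <-] := ap_y_lt lN; rewrite ap_arev tgt_vtx.
- move=> l m ml; have [lN|lN] := ltnP l N; last first.
    by rewrite (ap_y_out lN) (lin0 ((dgmul_bilin A).1 _)).
  have [mN|mN] := ltnP m N; last first.
    by rewrite (ap_y_out mN) (lin0 ((dgmul_bilin A).2 _)).
  have [e -> el] := ap_y_lt lN; have [f -> fm] := ap_y_lt mN.
  by rewrite ap_arar // el fm.
- exact: ap_ind.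
move=> W Fv Fs; exists (ap_lift Fv Fs); split.
- exact: ap_lift_lin.
- exact: ap_lift_ev.
exact: ap_lift_seg.
Qed.

End Presentation.

(** * The longest chain of relations *)

Section ChainOrder.
Variables (n : nat) (n_odd : odd n).
Local Notation N := (n.*2.+1).

(* The r-th arrow of the longest chain x_1 ... x_N goes from the point
   chain_pos r to the next one. *)
Definition chain_pos (r : nat) : nat :=
  if odd r.-1 then r.-1 else if (r.-1 < n.+1)%N then (r.-1 + n.+1)%N else (r.-1 - n.+1)%N.

Lemma vtx_eq i j : (i <= N)%N -> (j <= N)%N ->
  (vtx n i == vtx n j) =
  ((if (i < n.+1) then i else i - n.+1) == (if (j < n.+1) then j else j - n.+1))%N.
Proof. by move=> iN jN; rewrite -val_eqE /= !inordK //; case: ifP; lia. Qed.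

Lemma chain_pos_lt r : (0 < r <= N)%N -> (chain_pos r < N)%N.
Proof. rewrite /chain_pos; repeat case: ifPn => ?; lia. Qed.

Lemma chain_pos_inj r q : (0 < r <= N)%N -> (0 < q <= N)%N ->
  chain_pos r = chain_pos q -> r = q.
Proof. rewrite /chain_pos; repeat case: ifPn => ?; lia. Qed.

Lemma chain_posP r :
  [\/ odd r.-1 /\ chain_pos r = r.-1,
      [/\ ~~ odd r.-1, (r.-1 < n.+1)%N & chain_pos r = (r.-1 + n.+1)%N] |
      [/\ ~~ odd r.-1, (n.+1 <= r.-1)%N & chain_pos r = (r.-1 - n.+1)%N]].
Proof.
rewrite /chain_pos; repeat case: ifPn => ?; [exact: Or31|exact: Or32|].
by apply: Or33; split=> //; rewrite leqNgt.
Qed.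

(** The chain visits the vertices in the order of the points: it keeps the arrow leaving an odd
    point and exchanges a_i with b_i at an even one. As n + 1 is even, the exchange preserves
    parity, and c, which leaves the odd point n, stays. *)
Lemma vtx_chain_pos r : (0 < r <= N)%N -> vtx n (chain_pos r) = vtx n r.-1.
Proof.
move=> rN; apply/eqP; rewrite vtx_eq ?(ltnW (chain_pos_lt rN)) //; last by lia.
by case: (chain_posP r) => -[]; repeat case: ifPn => ?; lia.
Qed.

Lemma vtx_chain_posS r : (0 < r <= N)%N -> vtx n (chain_pos r).+1 = vtx n r.
Proof.
move=> rN; apply/eqP; rewrite vtx_eq ?chain_pos_lt //; last by lia.
by case: (chain_posP r) => -[]; repeat case: ifPn => ?; lia.
Qed.

Lemma chain_posS r : (0 < r < N)%N -> chain_pos r.+1 != (chain_pos r).+1.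
Proof. by move=> rN; case: (chain_posP r) => -[]; case: (chain_posP r.+1) => -[]; lia. Qed.

Lemma chain_pos_succ r q : (0 < r <= N)%N -> (0 < q <= N)%N ->
  vtx n (chain_pos r).+1 = vtx n (chain_pos q) ->
  chain_pos q != (chain_pos r).+1 -> q = r.+1.
Proof.
move=> rN qN; rewrite vtx_chain_posS // vtx_chain_pos //.
move/eqP; rewrite vtx_eq; try lia.
by case: (chain_posP r) => -[]; case: (chain_posP q) => -[];
  repeat case: ifPn => ?; lia.
Qed.

(** Of the two points on a vertex, x_r starts at one and x_(r-1) ends at the other, because x_(r-1)
    x_r = 0. For r = 1 the other point is 0, which the bound on j excludes. *)
Lemma vtx_pred r j : (0 < r <= N)%N -> (0 < j <= N)%N ->
  (vtx n j == vtx n r.-1) =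
  (chain_pos r == j) (+) ((1 < r)%N && ((chain_pos r.-1).+1 == j)).
Proof.
move=> rN jN; rewrite vtx_eq; try lia.
by case: (chain_posP r) => -[]; case: (chain_posP r.-1) => -[];
  repeat case: ifPn => ?; lia.
Qed.

End ChainOrder.

(** * Koszul acyclicity *)

Section MatchedAlgebra.
Variables (n : nat) (A : dgAlg) (ev : 'I_n.+1 -> A) (y : nat -> A).
Hypotheses (n_odd : odd n) (mA : matched_alg ev y).
Local Notation N := (n.*2.+1).
Local Notation seg := (segment ev y).

Let mul0 (a : A) : dgmul 0 a = 0. Proof. exact: lin0 ((dgmul_bilin A).1 a). Qed.
Let mul_0 (a : A) : dgmul a 0 = 0. Proof. exact: lin0 ((dgmul_bilin A).2 a). Qed.

Definition chain_arrow (r : nat) : A :=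
  if (0 < r <= N)%N then y (chain_pos n r) else 0.
Definition chain_src (r : nat) : A := ev (vtx n r.-1).
Definition chain_tgt (r : nat) : A := ev (vtx n r).
Local Notation x := chain_arrow.
Local Notation es := chain_src.
Local Notation et := chain_tgt.
Local Notation cp := (chain_pos n).

Lemma chain_arrow0 : x 0%N = 0. Proof. by []. Qed.

Lemma chain_arrow_out r : (N < r)%N -> x r = 0.
Proof. by rewrite /x ltnNge => /negbTE ->; rewrite andbF. Qed.

Lemma chain_arrowE r : (0 < r <= N)%N -> x r = y (cp r).
Proof. by rewrite /x => ->. Qed.

Lemma chain_arrow_mul r : dgmul (x r) (x r.+1) = 0.
Proof.
rewrite /x; case: ifP => // r1; case: ifP => // r2; rewrite ?mul_0 //.
apply: (ma_yy mA); apply: chain_posS => //.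
by move: r1 r2 => /andP [-> _] /andP [].
Qed.

Lemma chain_tgt_arrow r : (0 < r)%N -> dgmul (et r) (x r.+1) = x r.+1.
Proof.
move=> r0; rewrite /x; case: ifP => r1; last exact: mul_0.
by rewrite (ma_evy mA) vtx_chain_pos // eqxx.
Qed.

Lemma chain_arrow_src r : (r < N)%N -> dgmul (x r) (es r.+1) = x r.
Proof.
move=> rN; rewrite /x; case: ifP => r1; last exact: mul0.
by rewrite (ma_yev mA) vtx_chain_posS // eqxx.
Qed.

Lemma ev_segment v i d : (i + d <= N)%N ->
  dgmul (ev v) (seg i d) = if v == vtx n i then seg i d else 0.
Proof.
elim: d => [|d IH] id; first by rewrite /segment (ma_ev mA); case: eqP => // ->.
rewrite segmentS dgmulA IH; first by case: ifP.
by rewrite (leq_trans _ id) // leq_add2l.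
Qed.

Lemma segment_ev v i d : (i + d <= N)%N ->
  dgmul (seg i d) (ev v) = if v == vtx n (i + d) then seg i d else 0.
Proof.
case: d => [|d] id; first by rewrite /segment (ma_ev mA) addn0 eq_sym.
by rewrite segmentS -dgmulA (ma_yev mA) addnS; case: ifP.
Qed.

Lemma segment_y i d m : dgmul (seg i d.+1) (y m) = if m == (i + d.+1)%N then seg i d.+2 else 0.
Proof.
have [->|ne] := eqVneq; first by rewrite -segmentS.
by rewrite segmentS -dgmulA (ma_yy mA) ?mul_0 // -addnS.
Qed.

Lemma segment0_y i m : dgmul (seg i 0%N) (y m) = if vtx n i == vtx n m then seg m 1 else 0.
Proof.
by rewrite segmentS /segment !(ma_evy mA) addn0 eqxx.
Qed.

Lemma y_segment l d : dgmul (y l) (seg l.+1 d) = seg l d.+1.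
Proof.
elim: d => [|d IH]; last by rewrite segmentS dgmulA IH addSnnS.
rewrite segmentS addn0 /segment (ma_yev mA) eqxx.
by rewrite (ma_evy mA) eqxx.
Qed.

Lemma segment_ind (P : A -> Prop) : P 0 ->
  (forall a b c, P b -> P c -> P (a *: b + c)) ->
  (forall i d, (i + d <= N)%N -> P (seg i d)) -> forall a, P a.
Proof.
move=> P0 Pl Ps; apply: (ma_ind mA) => // [v|i d id]; last by apply: Ps; lia.
have -> : ev v = seg v 0%N.
  rewrite /segment; congr ev; apply/eqP; rewrite -val_eqE /= inordK;
  by rewrite ltn_ord.
by apply: Ps; have := ltn_ord v; lia.
Qed.

Lemma segment_ext (W : lmodType F2) (f g : A -> W) : linear f -> linear g ->
  (forall i d, (i + d <= N)%N -> f (seg i d) = g (seg i d)) -> forall a, f a = g a.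
Proof.
move=> lf lg h; apply: segment_ind => //; first by rewrite !lin0.
by move=> a b c eb ec; rewrite lf lg eb ec.
Qed.

(* T is a direct sum of copies of M (x) A, the elements of the l-th copy being
   pr l m w. *)
Section Based.
Variables (T M : lmodType F2) (la : A -> T -> T) (ra : T -> A -> T)
  (lM : A -> M -> M) (Lam : Type) (pr : Lam -> M -> A -> T).
Hypotheses (la_bilin : bilinear la) (ra_bilin : bilinear ra).
Hypotheses (lM_bilin : bilinear lM)
  (lMA : forall a b m, lM a (lM b m) = lM (dgmul a b) m)
  (lM1 : forall m, lM dgone m = m).
Hypotheses (pr_bilin : forall l, bilinear (pr l))
  (la_pr : forall a l m w, la a (pr l m w) = pr l (lM a m) w)
  (ra_pr : forall l m w a, ra (pr l m w) a = pr l m (dgmul w a))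
  (pr_span : forall t, span (fun z => exists l m w, z = pr l m w) t)
  (pr_univ : forall (W : lmodType F2) (F : Lam -> M -> A -> W),
     (forall l, bilinear (F l)) ->
     exists2 L : T -> W, linear L & forall l m w, L (pr l m w) = F l m w).

Let pr0 l w : pr l 0 w = 0. Proof. exact: lin0 ((pr_bilin l).1 w). Qed.
Let pr_0 l m : pr l m 0 = 0. Proof. exact: lin0 ((pr_bilin l).2 m). Qed.
Let lM0 m : lM 0 m = 0. Proof. exact: lin0 (lM_bilin.1 m). Qed.

Lemma pr_ext (W : lmodType F2) (f g : T -> W) : linear f -> linear g ->
  (forall l m i d, (i + d <= N)%N -> f (pr l m (seg i d)) = g (pr l m (seg i d))) ->
  forall t, f t = g t.
Proof.
move=> lf lg h t; apply: (span_ext lf lg _ (pr_span t)) => _ [l [m [w ->]]].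
move: w; apply: segment_ext => [a b c|a b c|]; last by move=> i d id; apply: h.
  by rewrite (pr_bilin l).2 lf.
by rewrite (pr_bilin l).2 lg.
Qed.

(** Right division by x_r in the factor A. Idempotents are sent to 0, having no last arrow. *)
Lemma strip_exists r : exists2 S : T -> T, linear S & forall l m i d, (i + d <= N)%N ->
  S (pr l m (seg i d)) =
  if [&& (0 < r <= N)%N, (0 < d)%N & cp r == (i + d).-1] then pr l m (seg i d.-1) else 0.
Proof.
have [Sw [lS Sv Ss]] := ma_lift mA (fun _ => 0 : A)
  (fun i d => if (0 < r <= N)%N && (cp r == i + d)%N then seg i d else 0).
have [|S lS' SE] := @pr_univ T (fun l m w => pr l m (Sw w)).
  move=> l; split=> [w a m m'|m a w w']; first exact: (pr_bilin l).1.
  by rewrite lS (pr_bilin l).2.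
exists S => // l m i [|d] id; rewrite SE.
  by rewrite segment0 Sv pr_0 andbF.
by rewrite Ss; [rewrite addnS /=; case: ifP|rewrite -ltnS -addnS].
Qed.

(** A cyclic derivative: if w = w' x_r w'', then m (x) w goes to (w'' m) (x) w'. An arrow occurs at
    most once in a segment, so there is a single term. *)
Lemma cut_exists r : exists2 D : T -> T, linear D & forall l m i d, (i + d <= N)%N ->
  D (pr l m (seg i d)) =
  if (0 < r <= N)%N && (i <= cp r < i + d)%N
  then pr l (lM (seg (cp r).+1 (i + d - (cp r).+1)) m) (seg i (cp r - i)) else 0.
Proof.
pose L l m := sval (cid (ma_lift mA (fun _ => 0 : T) (fun i d =>
  if (0 < r <= N)%N && (i <= cp r < i + d.+1)%N
  then pr l (lM (seg (cp r).+1 (i + d.+1 - (cp r).+1)) m) (seg i (cp r - i)) else 0))).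
have lL l m : linear (L l m) by rewrite /L; case: cid => f /= [].
have Lv l m i : L l m (seg i 0%N) = 0 by rewrite /L; case: cid => f /= [_ h _]; apply: h.
have Ls l m i d : (i + d <= n.*2)%N -> L l m (seg i d.+1) =
  if (0 < r <= N)%N && (i <= cp r < i + d.+1)%N
  then pr l (lM (seg (cp r).+1 (i + d.+1 - (cp r).+1)) m) (seg i (cp r - i)) else 0.
  by move=> id; rewrite /L; case: cid => f /= [_ _ h]; apply: h.
have [|D lD DE] := @pr_univ T L.
  move=> l; split=> [w a m m'|m]; last exact: lL.
  move: w; apply: segment_ext => //.
    by move=> c u v; rewrite !lL !scalerDr !scalerA (mulrC a c) addrACA.
  move=> i [|d] id; first by rewrite !Lv scaler0 addr0.
  have id' : (i + d <= n.*2)%N by rewrite -ltnS -addnS.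
  rewrite !Ls //; case: ifP => _; last by rewrite scaler0 addr0.
  by rewrite lM_bilin.2 (pr_bilin l).1.
exists D => // l m i [|d] id; rewrite DE.
  by rewrite Lv; case: ifP => //; lia.
by rewrite Ls // -ltnS -addnS.
Qed.

Definition strip r : T -> T := s2val (cid2 (strip_exists r)).
Definition cut r : T -> T := s2val (cid2 (cut_exists r)).

Lemma strip_lin r : linear (strip r). Proof. by rewrite /strip; case: cid2. Qed.
Lemma cut_lin r : linear (cut r). Proof. by rewrite /cut; case: cid2. Qed.

Lemma stripE r l m i d : (i + d <= N)%N -> strip r (pr l m (seg i d)) =
  if [&& (0 < r <= N)%N, (0 < d)%N & cp r == (i + d).-1] then pr l m (seg i d.-1) else 0.
Proof. by rewrite /strip; case: cid2 => /= S _ h; apply: h. Qed.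

Lemma cutE r l m i d : (i + d <= N)%N -> cut r (pr l m (seg i d)) =
  if (0 < r <= N)%N && (i <= cp r < i + d)%N
  then pr l (lM (seg (cp r).+1 (i + d - (cp r).+1)) m) (seg i (cp r - i)) else 0.
Proof. by rewrite /cut; case: cid2 => /= S _ h; apply: h. Qed.

(** Modulo commutators, m (x) w = (m (x) 1) w equals w (m (x) 1) = (w m) (x) 1; [fold] picks this
    representative of the class in T / [A, T]. *)
Lemma fold_exists : exists2 J : T -> T, linear J & forall l m w,
  J (pr l m w) = pr l (lM w m) dgone.
Proof.
apply: (pr_univ (F := fun l m w => pr l (lM w m) dgone)) => l.
split=> [w a m m'|m a w w']; first by rewrite lM_bilin.2 (pr_bilin l).1.
by rewrite lM_bilin.1 (pr_bilin l).1.
Qed.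

Definition fold : T -> T := s2val (cid2 fold_exists).
Lemma fold_lin : linear fold. Proof. by rewrite /fold; case: cid2. Qed.
Lemma foldE l m w : fold (pr l m w) = pr l (lM w m) dgone.
Proof. by rewrite /fold; case: cid2. Qed.

Let la_0 a : la a 0 = 0. Proof. exact: lin0 (la_bilin.2 a). Qed.
Let la0 t : la 0 t = 0. Proof. exact: lin0 (la_bilin.1 t). Qed.
Let ra_0 t : ra t 0 = 0. Proof. exact: lin0 (ra_bilin.2 t). Qed.
Let ra0 a : ra 0 a = 0. Proof. exact: lin0 (ra_bilin.1 a). Qed.

Lemma strip_la r a t : strip r (la a t) = la a (strip r t).
Proof.
move: t; apply: pr_ext => [b u v|b u v|l m i d id].
- by rewrite la_bilin.2 strip_lin.
- by rewrite strip_lin la_bilin.2.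
by rewrite la_pr !stripE //; case: ifP => _; rewrite ?la_pr ?la_0.
Qed.

Lemma strip_src r t : ra (strip r t) (es r) = strip r t.
Proof.
move: t; apply: pr_ext => [b u v||l m i d id].
- by rewrite strip_lin ra_bilin.1.
- exact: strip_lin.
rewrite stripE //; case: ifP => [/and3P [rN d0 /eqP cr]|_]; last exact: ra0.
rewrite ra_pr segment_ev; last by lia.
suff -> : vtx n r.-1 = vtx n (i + d.-1) by rewrite eqxx.
by rewrite -vtx_chain_pos // cr; congr (vtx n _); lia.
Qed.

Lemma cut_tgt r t : la (et r) (cut r t) = cut r t.
Proof.
move: t; apply: pr_ext => [b u v||l m i d id].
- by rewrite cut_lin la_bilin.2.
- exact: cut_lin.
rewrite cutE //; case: ifP => [/andP [rN h]|_]; last exact: la_0.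
rewrite la_pr lMA ev_segment; last by lia.
by rewrite vtx_chain_posS // eqxx.
Qed.

Lemma cut_src r t : ra (cut r t) (es r) = cut r t.
Proof.
move: t; apply: pr_ext => [b u v||l m i d id].
- by rewrite cut_lin ra_bilin.1.
- exact: cut_lin.
rewrite cutE //; case: ifP => [/andP [rN h]|_]; last exact: ra0.
rewrite ra_pr segment_ev; last by lia.
by rewrite subnKC ?vtx_chain_pos ?eqxx //; case/andP: h.
Qed.

(** For q = r let w end on the source vertex of x_r. If it ends at the point where x_r starts, or is
    an idempotent, dividing w x_r by x_r gives w back. Otherwise w ends in x_(r-1): then w x_r = 0,
    and dividing w by x_(r-1) and multiplying again gives w, which cancels w e. *)
Lemma strip_arrow r q t : (0 < r <= N)%N -> strip r (ra t (x q)) =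
  if q == r then ra t (es r) + ra (strip r.-1 t) (x r.-1) else 0.
Proof.
move=> rN; have [qN|qN] := boolP (0 < q <= N)%N; last first.
  rewrite /x (negbTE qN) ra_0 (lin0 (strip_lin r)).
  by case: eqP => // qr; rewrite qr rN in qN.
move: t; apply: pr_ext => [b u v|b u v|l m i d id].
- by rewrite ra_bilin.1 strip_lin.
- case: ifP => _; last by rewrite scaler0 addr0.
  by rewrite strip_lin !ra_bilin.1 scalerDr addrACA.
rewrite ra_pr chain_arrowE //.
have cpq : (cp q == cp r) = (q == r).
  by apply/eqP/eqP => [|-> //]; apply: chain_pos_inj.
have cN := chain_pos_lt n_odd qN.
case: d => [|d] in id *.
  have -> : strip r.-1 (pr l m (seg i 0%N)) = 0 by rewrite stripE // !andbF.
  rewrite ra0 addr0 ra_pr segment_ev // addn0 segment0_y.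
  case: (eqVneq q r) => [->|qr].
    rewrite vtx_chain_pos // eq_sym; case: eqP => [e|_]; last first.
      by rewrite pr_0 (lin0 (strip_lin r)).
    rewrite stripE ?rN /= ?addn1 ?eqxx; last by rewrite (chain_pos_lt n_odd).
    by rewrite !segment0 -e vtx_chain_pos.
  case: ifP => _; last by rewrite pr_0 (lin0 (strip_lin r)).
  by rewrite stripE ?addn1 //= eq_sym cpq (negbTE qr) andbF.
rewrite segment_y; case: (eqVneq q r) => [e|qr]; last first.
  case: eqP => [cj|_]; last by rewrite pr_0 (lin0 (strip_lin r)).
  rewrite stripE; last by rewrite addnS -cj.
  by rewrite addnS /= -cj eq_sym cpq (negbTE qr) andbF.
rewrite e ra_pr segment_ev // (eq_sym (vtx n r.-1)) vtx_pred //; last by lia.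
rewrite stripE //=.
have -> : (0 < r.-1 <= N)%N = (1 < r)%N by lia.
rewrite addnS /= eqSS; case: (boolP ((1 < r)%N && (cp r.-1 == i + d)%N)) => [|h].
  move=> /andP [r1 /eqP cr].
  have -> : (cp r == (i + d).+1) = false.
    have := @chain_posS n n_odd r.-1; rewrite cr prednK //; last by lia.
    by move=> h; apply/negbTE/h; lia.
  rewrite /= pr_0 (lin0 (strip_lin r)) ra_pr.
  rewrite chain_arrowE; last by lia.
  by rewrite cr -segmentS addxx.
rewrite ra0 addr0 addbF; case: eqP => [cr|_].
  by rewrite stripE ?rN ?addnS /= ?cr ?eqxx // -cr chain_pos_lt.
by rewrite pr_0 (lin0 (strip_lin r)).
Qed.

(** If w x_q is nonzero, cutting x_q m (x) w and m (x) w x_q inside w gives the same element, and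
    only the cut at x_q itself survives, for q = r. If w x_q = 0, the first term needs w'' x_q
    nonzero with w = w' x_r w''; then w'' is an idempotent, w ends in x_r, and q = r + 1. *)
Lemma cut_arrow r q t : (0 < r <= N)%N -> cut r (la (x q) t + ra t (x q)) =
  (if q == r then la (et r) (strip r (ra t (x q))) else 0) +
  (if q == r.+1 then la (x q) (strip r t) else 0).
Proof.
move=> rN; have [qN|qN] := boolP (0 < q <= N)%N; last first.
  rewrite /x (negbTE qN) ra_0 !la0 addr0 (lin0 (cut_lin r)) (lin0 (strip_lin r)).
  by rewrite la_0 !if_same addr0.
have cpq : (cp q == cp r) = (q == r).
  by apply/eqP/eqP => [|-> //]; apply: chain_pos_inj.
have cN := chain_pos_lt n_odd qN.
move: t; apply: pr_ext => [b u v|b u v|l m i d id].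
- rewrite la_bilin.2 ra_bilin.1 addrACA -scalerDr.
  exact: cut_lin.
- rewrite ra_bilin.1 !strip_lin !la_bilin.2.
  case: ifP => _; case: ifP => _; rewrite ?addr0 ?add0r ?scaler0 ?addr0 //.
  by rewrite scalerDr addrACA.
rewrite la_pr ra_pr chain_arrowE // (linD (cut_lin r)).
case: d => [|d] in id *.
  rewrite cutE // stripE // !andbF la_0 if_same addr0.
  have -> : (i <= cp r < i + 0)%N = false by lia.
  rewrite andbF add0r segment0_y; case: ifP => _; last first.
    by rewrite pr_0 (lin0 (cut_lin r)) (lin0 (strip_lin r)) la_0 if_same.
  rewrite cutE ?addn1 // stripE ?addn1 //= rN /= -eqn_leq eq_sym.
  rewrite (eq_sym (cp r)) cpq; case: eqP => // <-.
  by rewrite subnn la_pr subnn segment0 vtx_chain_posS.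
rewrite segment_y; have [cj|cj] := eqVneq (cp q) (i + d.+1)%N.
  rewrite addnS in cj; have id2 : (i + d.+2 <= N)%N by rewrite !addnS -cj.
  rewrite !cutE // !stripE // rN !addnS -cj /=.
  rewrite (eq_sym (cp r) (cp q)) cpq.
  (* Here x_q extends the segment; if moreover q = r + 1 and the segment ended in x_r, then x_r and
     x_(r+1) would be consecutive in the longest path. *)
  have -> : (if q == r.+1 then la (y (cp q)) (if cp r == (cp q).-1
      then pr l m (seg i d) else 0) else 0) = 0.
    case: eqP => // qr; case: eqP => [cr|_]; last exact: la_0.
    have : cp r.+1 != (cp r).+1 by apply: chain_posS => //; lia.
    by rewrite -qr cr cj eqxx.
  have -> : (i <= cp r < (cp q).+1)%N = (i <= cp r < cp q)%N || (q == r).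
    by rewrite -cpq; lia.
  have [qr|qr] := eqVneq q r.
    rewrite qr ltnn andbF orbT add0r addr0 la_pr subnn segment0 vtx_chain_posS //.
    by congr pr; congr segment; rewrite -qr cj; lia.
  rewrite orbF !addr0; case: ifP => [h|_]; last by rewrite addr0.
  rewrite lMA subSn; last by lia.
  rewrite segmentS; have -> : ((cp r).+1 + (cp q - (cp r).+1))%N = cp q by lia.
  by rewrite addxx.
rewrite pr_0 (lin0 (cut_lin r)) (lin0 (strip_lin r)) la_0 if_same addr0 add0r.
rewrite cutE // stripE // rN /= addnS /=.
have [cr|cr] := eqVneq (cp r) (i + d)%N; last first.
  rewrite la_0 if_same; case: ifP => // h.
  rewrite lMA; have -> : ((i + d).+1 - (cp r).+1 = (i + d - (cp r).+1).+1)%N by lia.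
  rewrite segment_y; case: eqP => [e|_]; last by rewrite lM0 pr0.
  by case/eqP: cj; rewrite e; lia.
rewrite cr leq_addr leqnn /= subnn lMA segment0_y -cr.
have -> : (vtx n (cp r).+1 == vtx n (cp q)) = (q == r.+1).
  apply/eqP/eqP => [e|qr]; last by rewrite qr in qN *; rewrite vtx_chain_posS ?vtx_chain_pos.
  by apply: (chain_pos_succ n_odd) => //; rewrite cr -addnS.
case: eqP => _; last by rewrite lM0 pr0.
rewrite la_pr cr addKn segmentS addn0 segment0 (ma_evy mA) eqxx.
by [].
Qed.

Lemma sum_range (F : nat -> T) i d : (i + d <= N)%N ->
  \sum_(p < N) (if (i <= p < i + d)%N then F p + F p.+1 else 0) = F i + F (i + d)%N.
Proof.
elim: d => [|d IH] id.
  rewrite addn0 addxx big1 // => p _; case: ifP => //; lia.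
rewrite (eq_bigr (fun p : 'I_N => (if (i <= p < i + d)%N then F p + F p.+1 else 0) +
   (if p == (i + d)%N :> nat then F p + F p.+1 else 0))).
  rewrite big_split /= IH; last by lia.
  rewrite -big_mkcond /=; have idN : (i + d < N)%N by lia.
  rewrite (big_pred1 (Ordinal idN)) //= addrA -(addrA (F i)) addxx addr0.
  by rewrite addnS.
move=> p _; case: ifPn => h1; case: ifPn => h2; case: ifPn => h3;
  by rewrite ?addr0 ?add0r //; exfalso; lia.
Qed.

Lemma sum_chain (F : nat -> T) :
  \sum_(r < N.+2) (if (0 < r <= N)%N then F (cp r) else 0) = \sum_(p < N) F p.
Proof.
rewrite big_ord_recl /= add0r big_ord_recr /= ltnn addr0.
have lt (p : 'I_N) : (cp p.+1 < N)%N by apply: chain_pos_lt; rewrite ?ltn_ord.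
have inj : injective (fun p => Ordinal (lt p)).
  move=> p q /(congr1 val) /= /chain_pos_inj h; apply/val_inj.
  by apply/eq_add_S/h; rewrite ?ltn_ord.
rewrite [RHS](reindex_inj inj) /=; apply: eq_bigr => p _.
by rewrite /bump leq0n add1n ltn_ord.
Qed.

(** Let [f p] be m (x) w cut just before its arrow at the point p, with the tail moved onto m. The
    commutator of that arrow with the cut is f(p) + f(p+1), and the sum over the arrows of w
    telescopes to the two extreme cuts, the folded and the original element. *)
Lemma cut_sum t : \sum_(r < N.+2) (la (x r) (cut r t) + ra (cut r t) (x r)) =
  diag la ra ev t + diag la ra ev (fold t).
Proof.
move: t; apply: pr_ext => [b u v|b u v|l m i d id].
- rewrite scaler_sumr -big_split; apply: eq_bigr => r _ /=.
  by rewrite cut_lin la_bilin.2 ra_bilin.1 scalerDr addrACA.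
- by rewrite fold_lin !diag_lin // scalerDr addrACA.
pose f p := pr l (lM (seg p (i + d - p)) m) (seg i (p - i)).
rewrite (eq_bigr (fun r : 'I_N.+2 => if (0 < r <= N)%N then
    (fun p => if (i <= p < i + d)%N then f p + f p.+1 else 0) (cp r) else 0)).
  rewrite (sum_chain (fun p => if (i <= p < i + d)%N then f p + f p.+1 else 0)).
  rewrite sum_range // addrC foldE; congr (_ + _).
    rewrite /f subnn addKn /diag (bigD1 (vtx n (i + d))) //= big1 ?addr0.
      by rewrite ra_pr la_pr segment_ev // eqxx segment0.
    by move=> v /negbTE nv; rewrite ra_pr segment_ev // nv pr_0 la_0.
  rewrite /f addKn subnn /diag (bigD1 (vtx n i)) //= big1 ?addr0.
    by rewrite ra_pr la_pr lMA ev_segment // eqxx dgmul1l segment0.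
  by move=> v /negbTE nv; rewrite ra_pr la_pr lMA ev_segment // nv lM0 pr0.
move=> r _; rewrite cutE //; have [rN|rN] := boolP (0 < r <= N)%N; last first.
  by rewrite /= la_0 ra0 addr0.
rewrite /= chain_arrowE //; case: ifP => [/andP [h1 h2]|_]; last by rewrite la_0 ra0 addr0.
rewrite la_pr ra_pr lMA y_segment /f subSn // -(subSn h2) segmentS subnKC //.
Qed.

Lemma fold_comm t : comm la ra t -> fold t = 0.
Proof.
have lz : linear (fun _ : T => 0 : T) by move=> a u v; rewrite scaler0 addr0.
move: t; apply: (span_ext fold_lin lz) => _ [a [t ->]].
apply: (span_ext (f := fun t => fold (la a t + ra t a)) _ lz _ (pr_span t)) => [b u v|].
  by rewrite la_bilin.2 ra_bilin.1 addrACA -scalerDr fold_lin.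
move=> _ [l [m [w ->]]]; rewrite (linD fold_lin) la_pr ra_pr !foldE lMA.
by rewrite addxx.
Qed.

Lemma comm_fold t : comm la ra (t + fold t).
Proof.
elim: (pr_span t) => [|a g u [l [m [w ->]]] _ IH].
  by rewrite (lin0 fold_lin) addr0; apply: span0.
rewrite fold_lin addrACA -scalerDr; apply: span_lin IH; apply: span_gen.
exists w, (pr l m dgone); rewrite la_pr ra_pr foldE dgmul1l.
exact: addrC.
Qed.

(** * The filtration by rank *)

Section Differential.
Variables (dT : T -> T) (dM : M -> M) (rk : Lam -> nat).
Hypotheses (laA : forall a b t, la a (la b t) = la (dgmul a b) t)
  (raA : forall t a b, ra (ra t a) b = ra t (dgmul a b))
  (laraC : forall a t b, ra (la a t) b = la a (ra t b))
  (ra1 : forall t, ra t dgone = t).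
Hypotheses (dT_lin : linear dT) (dT_dT : forall t, dT (dT t) = 0)
  (dT_la : forall a t, dT (la a t) = la a (dT t))
  (dT_ra : forall t a, dT (ra t a) = ra (dT t) a).
Hypothesis dM_lM : forall a m, dM (lM a m) = lM a (dM m).

Definition fil_gen (i : nat) (z : T) : Prop :=
  exists l m w, (rk l < i)%N /\ z = pr l m w.
Definition fil (i : nat) : T -> Prop := span (fil_gen i).

Hypothesis triangular : forall l m w, fil (rk l) (dT (pr l m w) + pr l (dM m) w).

Lemma fil_mono i j t : (i <= j)%N -> fil i t -> fil j t.
Proof.
move=> ij; apply: (span_map (f := id)) => // _ [l [m [w [li ->]]]].
by apply: span_gen; exists l, m, w; rewrite (leq_trans li).
Qed.

Lemma fil_exhaust t : exists i, fil i t.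
Proof.
elim: (pr_span t) => [|a g u [l [m [w ->]]] _ [i IH]].
  by exists 0%N; apply: span0.
exists (maxn (rk l).+1 i); apply: span_lin; last exact: fil_mono (leq_maxr _ _) IH.
by apply: span_gen; exists l, m, w; rewrite leq_maxl.
Qed.

Lemma fil_la i a t : fil i t -> fil i (la a t).
Proof.
apply: span_map; first exact: la_bilin.2.
move=> _ [l [m [w [li ->]]]]; apply: span_gen; exists l, (lM a m), w.
by rewrite la_pr.
Qed.

Lemma fil_ra i t a : fil i t -> fil i (ra t a).
Proof.
apply: (span_map (ra_bilin.1 a)).
move=> _ [l [m [w [li ->]]]]; apply: span_gen; exists l, m, (dgmul w a).
by rewrite ra_pr.
Qed.

Section Operator.
Variable O : T -> T.
Hypotheses (lO : linear O) (OE : forall l i d, (i + d <= N)%N ->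
  exists a w, forall m, O (pr l m (seg i d)) = pr l (lM a m) w).

Lemma fil_op_stable i t : fil i t -> fil i (O t).
Proof.
apply: span_map => // _ [l [m [w [li ->]]]].
move: w; apply: segment_ind => [|a b c hb hc|j d id].
- by rewrite pr_0 (lin0 lO); apply: span0.
- by rewrite (pr_bilin l).2 lO; apply: span_lin.
have [a [w E]] := OE l id; rewrite E; apply: span_gen.
by exists l, (lM a m), w.
Qed.

(** On a basis element, O multiplies m by an element of A and changes w; so it commutes with the
    part of the differential coming from M, and only the part that lowers the rank contributes. *)
Lemma fil_op i t : fil i.+1 t -> fil i (dT (O t) + O (dT t)).
Proof.
apply: (span_map (f := fun t => dT (O t) + O (dT t))).
  by move=> a u v; rewrite lO !dT_lin lO scalerDr addrACA.
move=> _ [l [m [w [li ->]]]].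
move: w; apply: segment_ind => [|a b c hb hc|j d id].
- by rewrite pr_0 (lin0 dT_lin) (lin0 lO) (lin0 dT_lin) addr0; apply: span0.
- rewrite (pr_bilin l).2 lO !dT_lin lO addrACA -scalerDr.
  exact: span_lin.
have [a [w E]] := OE l id; rewrite E.
have -> : dT (pr l (lM a m) w) + O (dT (pr l m (seg j d))) =
    (dT (pr l (lM a m) w) + pr l (dM (lM a m)) w) +
    O (dT (pr l m (seg j d)) + pr l (dM m) (seg j d)).
  by rewrite (linD lO) E dM_lM addrACA addxx addr0.
apply: fil_mono (li : (rk l <= i)%N) _; apply: spanD; first exact: triangular.
exact/fil_op_stable/triangular.
Qed.

End Operator.

Lemma strip_form r l i d : (i + d <= N)%N ->
  exists a w, forall m, strip r (pr l m (seg i d)) = pr l (lM a m) w.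
Proof.
move=> id; case h: [&& (0 < r <= N)%N, (0 < d)%N & cp r == (i + d).-1].
  by exists dgone, (seg i d.-1) => m; rewrite stripE // h lM1.
by exists dgone, 0 => m; rewrite stripE // h pr_0.
Qed.

Lemma cut_form r l i d : (i + d <= N)%N ->
  exists a w, forall m, cut r (pr l m (seg i d)) = pr l (lM a m) w.
Proof.
move=> id; case h: ((0 < r <= N)%N && (i <= cp r < i + d)%N).
  by eexists; eexists => m; rewrite cutE // h.
by exists dgone, 0 => m; rewrite cutE // h pr_0.
Qed.

Local Notation comm := (comm la ra).
Local Notation koszul := (koszul la ra x).
Local Notation koszul0 := (koszul0 la ra N x).
Local Notation family := (family la ra ev N es et).

Theorem based_acyclic s G W : family G W -> comm (dT s + G) -> dT G = koszul0 W ->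
  (forall i j, chain N i j -> dT (W i j) = koszul W i j) ->
  exists G' W', [/\ family G' W', comm (s + G'), G = dT G' + koszul0 W' &
    forall i j, chain N i j -> W i j = dT (W' i j) + koszul W' i j].
Proof.
move=> fGW cG eG eW; have [a Fs] := fil_exhaust s; have [b FG] := fil_exhaust G.
(* There are finitely many chains, so one filtration step contains all components. *)
have [c FW] : exists c, forall i j, fil c (W i j).
  have [c hc] : exists c, forall i j, chain N i j -> fil c (W i j).
    have [f hf] := choice (fun p => fil_exhaust (W p.1 p.2)).
    exists (\max_(i < N.+1) \max_(j < N.+1) f (i : nat, j : nat)) => i j /andP [ij jN].
    have iN : (i < N.+1)%N by rewrite ltnS (leq_trans (ltnW ij)).
    apply: fil_mono (hf (i, j)).
    apply: leq_trans (leq_bigmax (Ordinal iN)) => /=.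
    exact: (leq_bigmax (Ordinal (jN : j < N.+1)%N)).
  exists c => i j; case: (boolP (chain N i j)) => [/hc //|ch].
  by case: fGW => _ -> // _ _; apply: span0.
pose m := maxn a (maxn b c).
have [ma [mb mc]] : (a <= m /\ b <= m /\ c <= m)%N by rewrite /m; lia.
apply: (@koszul_acyclic A T la ra dT la_bilin ra_bilin laA raA laraC ra1 dT_lin dT_dT
  dT_la dT_ra _ ev (ma_ev mA) (ma_sum mA) N x es et chain_arrow0 chain_arrow_out
  chain_arrow_mul chain_tgt_arrow chain_arrow_src strip cut fold strip_lin cut_lin
  fold_lin strip_la strip_src cut_tgt cut_src _ _ cut_sum fold_comm comm_fold fil _
  _ _ fil_la fil_ra _ _ _ m s G W fGW).
- exact: strip_arrow.
- move=> r q t rN; rewrite cut_arrow //; congr (_ + _).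
    by case: eqP => // ->; rewrite strip_arrow // eqxx.
  by case: eqP => // ->.
- by move=> t; elim=> // a' g z [l [w' [w'' []]]].
- by move=> i; apply: span0.
- by move=> i t u; apply: spanD.
- by move=> i r; apply: fil_op; [exact: strip_lin|exact: strip_form].
- by move=> i r; apply: fil_op; [exact: cut_lin|exact: cut_form].
- move=> i; apply: fil_op; first exact: fold_lin.
  by move=> l j d jd; exists (seg j d), dgone => m'; rewrite foldE.
- exact: fil_mono Fs.
- exact: fil_mono FG.
- by move=> i j; apply: fil_mono (FW i j).
- exact: cG.
- exact: eG.
- exact: eW.
Qed.

End Differential.
End Based.
End MatchedAlgebra.

(** * Smoothness and properness *)

Lemma fin_supp (I : finType) (V : I -> lmodType F2) (F : forall i, V i) :
  exists s : seq I, forall i, i \notin s -> F i = 0.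
Proof. by exists (enum I) => i; rewrite mem_enum. Qed.

Definition fin_dsum (I : finType) (V : I -> lmodType F2) (F : forall i, V i) : dsum V :=
  DSum (fin_supp F).

Section Smooth.
Variables (n : nat) (A : dgAlg) (ev : 'I_n.+1 -> A) (y : nat -> A).
Hypotheses (n_odd : odd n) (mA : matched_alg ev y).
Local Notation N := (n.*2.+1).
Local Notation seg := (segment ev y).
Local Notation x := (chain_arrow n y).
Local Notation es := (chain_src ev).
Local Notation et := (chain_tgt ev).

Lemma matched_cmp m (a : A) : cmp m a = if m == 0 then a else 0.
Proof. exact: cmp_hom (ma_hom mA a). Qed.

Lemma matched_dif (a : A) : dif a = 0.
Proof.
have := dif_cmp (c := A) 0 a; rewrite (ma_hom mA a) => ->.
by rewrite matched_cmp.
Qed.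

Lemma matched_proper : homologically_proper A.
Proof.
pose K : finType := ('I_N.+1 * 'I_N.+1)%type.
exists #|K|, (fun q : 'I_#|K| => seg (enum_val q : K).1 (enum_val q : K).2).
split=> [q|a _]; first exact: matched_dif.
suff [c ->] : exists c : 'I_#|K| -> F2,
    a = \sum_q c q *: seg (enum_val q : K).1 (enum_val q : K).2.
  by exists c, 0; rewrite (lin0 (@dif_lin A)) addr0.
move: a; apply: (segment_ind n_odd mA (P := fun a => exists c : 'I_#|K| -> F2,
    a = \sum_q c q *: seg (enum_val q : K).1 (enum_val q : K).2)) => [|a b c [f ->] [g ->]|i d id].
- by exists (fun _ => 0); rewrite big1 // => q _; rewrite scale0r.
- exists (fun q => a * f q + g q); rewrite scaler_sumr -big_split.
  by apply: eq_bigr => q _; rewrite /= scalerA scalerDl.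
have iN : (i < N.+1)%N by lia.
have dN : (d < N.+1)%N by lia.
pose q0 : K := (Ordinal iN, Ordinal dN).
exists (fun q => (q == enum_rank q0)%:R); rewrite (bigD1 (enum_rank q0)) //= big1 ?addr0.
  by rewrite eqxx scale1r enum_rankK.
by move=> q /negbTE ->; rewrite scale0r.
Qed.

(** * The inner bimodule structure of the enveloping bimodule *)

Local Notation E := (enveloping A).

(** These actions commute with the outer ones. For them E is based with M = A and one generator, the
    left tensor factor being the path factor, and E modulo inner commutators is A (x)_A A = A. The
    Koszul complex of E is thus a bimodule resolution of A. *)
Definition inner_l (a : A) : E -> E := tmap id (dgmul a).
Definition inner_r (t : E) (a : A) : E := tmap (fun w => dgmul w a) id t.

Let idl (V : lmodType F2) : linear (@id V). Proof. by []. Qed.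
Let ml (a : A) : linear (dgmul a) := (dgmul_bilin A).2 a.
Let mr (a : A) : linear (fun w : A => dgmul w a) := (dgmul_bilin A).1 a.

Lemma inner_lE a w m : inner_l a (tpure w m) = tpure w (dgmul a m).
Proof. exact: (tmapE (@idl _) (ml a)). Qed.
Lemma inner_rE a w m : inner_r (tpure w m) a = tpure (dgmul w a) m.
Proof. exact: (tmapE (mr a) (@idl _)). Qed.
Lemma inner_l_lin a : linear (inner_l a). Proof. exact: tmap_lin. Qed.
Lemma inner_r_lin a : linear (inner_r^~ a). Proof. exact: (tmap_lin (mr a) (@idl _)). Qed.

Let l1 := (@tpure_bilin A A).1.
Let l2 := (@tpure_bilin A A).2.

Lemma inner_l_bilin : bilinear inner_l.
Proof.
split=> [t b a a'|]; last exact: inner_l_lin.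
move: t; apply: tens_ext; first exact: inner_l_lin.
  by apply: comb_lin; apply: inner_l_lin.
by move=> w m; rewrite !inner_lE (dgmul_bilin A).1 l2.
Qed.

Lemma inner_r_bilin : bilinear inner_r.
Proof.
split=> [|t b a a']; first exact: inner_r_lin.
move: t; apply: (tens_ext (f := inner_r^~ (b *: a + a'))
  (g := fun t => b *: inner_r t a + inner_r t a')); first exact: inner_r_lin.
  by apply: comb_lin; apply: inner_r_lin.
by move=> w m; rewrite !inner_rE (dgmul_bilin A).2 l1.
Qed.

Lemma inner_lA a b t : inner_l a (inner_l b t) = inner_l (dgmul a b) t.
Proof.
move: t; apply: tens_ext => [c u v||w m].
- by rewrite !inner_l_lin.
- exact: inner_l_lin.
by rewrite !inner_lE dgmulA.
Qed.

Lemma inner_rA t a b : inner_r (inner_r t a) b = inner_r t (dgmul a b).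
Proof.
move: t; apply: tens_ext => [c u v||w m].
- by rewrite !inner_r_lin.
- exact: inner_r_lin.
by rewrite !inner_rE dgmulA.
Qed.

Lemma inner_lrC a t b : inner_r (inner_l a t) b = inner_l a (inner_r t b).
Proof.
move: t; apply: tens_ext => [c u v|c u v|w m].
- by rewrite inner_l_lin inner_r_lin.
- by rewrite inner_r_lin inner_l_lin.
by rewrite !(inner_lE, inner_rE).
Qed.

Lemma inner_r1 t : inner_r t dgone = t.
Proof.
move: t; apply: tens_ext => [c u v|//|w m]; first by rewrite inner_r_lin.
by rewrite inner_rE dgmul1r.
Qed.

Lemma env_lactE a (w m : A) : lact a (tpure w m : E) = tpure (dgmul a w) m.
Proof. exact: olactE. Qed.
Lemma env_ractE a (w m : A) : ract (tpure w m : E) a = tpure w (dgmul m a).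
Proof. exact: oractE. Qed.

Lemma lact_inner_l a b (t : E) : lact a (inner_l b t) = inner_l b (lact a t).
Proof.
move: t; apply: tens_ext => [c u v|c u v|w m].
- by rewrite inner_l_lin (lact_bilin E).2.
- by rewrite (lact_bilin E).2 inner_l_lin.
by rewrite inner_lE !env_lactE inner_lE.
Qed.

Lemma lact_inner_r a b (t : E) : lact a (inner_r t b) = inner_r (lact a t) b.
Proof.
move: t; apply: tens_ext => [c u v|c u v|w m].
- by rewrite inner_r_lin (lact_bilin E).2.
- by rewrite (lact_bilin E).2 inner_r_lin.
by rewrite inner_rE !env_lactE inner_rE dgmulA.
Qed.

Lemma ract_inner_l a b (t : E) : ract (inner_l b t) a = inner_l b (ract t a).
Proof.
move: t; apply: tens_ext => [c u v|c u v|w m].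
- by rewrite inner_l_lin (ract_bilin E).1.
- by rewrite (ract_bilin E).1 inner_l_lin.
by rewrite inner_lE !env_ractE inner_lE dgmulA.
Qed.

Lemma ract_inner_r a b (t : E) : ract (inner_r t b) a = inner_r (ract t a) b.
Proof.
move: t; apply: tens_ext => [c u v|c u v|w m].
- by rewrite inner_r_lin (ract_bilin E).1.
- by rewrite (ract_bilin E).1 inner_r_lin.
by rewrite inner_rE !env_ractE inner_rE.
Qed.

Lemma env_dif (t : E) : dif t = 0.
Proof.
have lz : linear (fun _ : E => 0 : E) by move=> a u v; rewrite scaler0 addr0.
move: t; apply: (tens_ext (@dif_lin E) lz) => w m.
rewrite [dif _]dif_tpure !matched_dif.
by rewrite (lin0 (l1 m)) (lin0 (l2 w)) addr0.
Qed.

Lemma env_cmp m (t : E) : cmp m t = if m == 0 then t else 0.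
Proof.
move: t; apply: tens_ext => [|a u v|u v]; first exact: (@cmp_lin E).
  by case: ifP => // _; rewrite scaler0 addr0.
rewrite [cmp m _](cmp_tpure _ _ (ma_hom mA u)) subr0 matched_cmp.
by case: ifP => // _; rewrite (lin0 (l2 u)).
Qed.

Definition env_pr (_ : unit) (m w : A) : E := tpure w m.

Lemma env_pr_bilin l : bilinear (env_pr l).
Proof. by split; [exact: l2|exact: l1]. Qed.

Lemma env_pr_span t : span (fun z => exists l m w, z = env_pr l m w) t.
Proof.
apply: (span_map (f := id)) (tens_span t) => // _ [w [m ->]].
by apply: span_gen; exists tt, m, w.
Qed.

Lemma env_pr_univ (W : lmodType F2) (F : unit -> A -> A -> W) :
  (forall l, bilinear (F l)) ->
  exists2 L : E -> W, linear L & forall l m w, L (env_pr l m w) = F l m w.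
Proof.
move=> bF; have bF' : bilinear (fun w m => F tt m w).
  by split; [exact: (bF tt).2|exact: (bF tt).1].
exists (tlift (fun w m => F tt m w)); first exact: tlift_lin.
by move=> [] m w; apply: tliftE.
Qed.

Local Notation kos := (koszul inner_l inner_r x).
Local Notation kos0 := (koszul0 inner_l inner_r N x).
Local Notation chainN := (chain N).
Local Notation diag_in := (diag inner_l inner_r ev).
Local Notation family := (family inner_l inner_r ev N es et).
Local Notation comm := (comm inner_l inner_r).

(* The index None stands for a single generator replacing those of all
   vertices; the indices Some (i, j) which are not chains are junk. *)
Local Notation I := (option ('I_N.+1 * 'I_N.+1)).

Definition cell_deg (p : I) : nat := if p is Some (i, j) then (j - i)%N else 0%N.

Definition cell_free : dgBimod A :=
  dsum_bimod (fun p : I => shift_bimod (Posz (cell_deg p)) E).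

Local Notation D := (dsum (fun p : I => shift_bimod (Posz (cell_deg p)) E : lmodType F2)).

Definition mk (F : I -> E) : D :=
  @fin_dsum I (fun p : I => shift_bimod (Posz (cell_deg p)) E : lmodType F2) F.

Definition comps (u : D) (i j : nat) : E :=
  if chainN i j then u (Some (inord i, inord j)) else 0.

Definition build (G : E) (W : nat -> nat -> E) : D :=
  mk (fun p => if p is Some (i, j) then if chainN i j then W i j else 0 else G).

Lemma comps_build G W i j : chainN i j -> comps (build G W) i j = W i j.
Proof.
move=> ch; rewrite /comps ch /=; have /andP [ij jN] := ch.
by rewrite !inordK ?ch // ltnS // (leq_trans (ltnW ij)).
Qed.

Lemma comps_out u i j : ~~ chainN i j -> comps u i j = 0.
Proof. by rewrite /comps => /negbTE ->. Qed.

Lemma comps_ord u (i j : 'I_N.+1) : chainN i j -> comps u i j = u (Some (i, j)).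
Proof. by rewrite /comps => ->; rewrite !inord_val. Qed.

Definition cell_dif (u : D) : D := build (kos0 (comps u)) (kos (comps u)).

Lemma comps_map (f : E -> E) (u v : D) : f 0 = 0 -> (forall p, v p = f (u p)) ->
  comps v = fun i j => f (comps u i j).
Proof.
move=> f0 e; apply: funext => i; apply: funext => j; rewrite /comps.
by case: ifP => _; rewrite ?e ?f0.
Qed.

Let bl := inner_l_bilin.
Let br := inner_r_bilin.
Let x0 : x 0%N = 0 := erefl.
Let xN := @chain_arrow_out n A y.
Let xx := chain_arrow_mul n_odd mA.
Let kos0D := koszul0D bl br N x.
Let kosD := koszulD bl br x.
Let kos0_kos := koszul0_koszul bl br inner_lA inner_rA inner_lrC x0 xN xx.
Let kos_kos := koszul_koszul bl br inner_lA inner_rA inner_lrC x0 xx.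
Let eq_kos0 W W' := @eq_koszul0 A E inner_l inner_r bl br N x x0 xN W W'.
Let eq_kos W W' i j := @eq_koszul A E inner_l inner_r bl br N x x0 xN W W' i j.
Let il0 a : inner_l a 0 = 0 := lin0 (inner_l_lin a).
Let ir0 a : inner_r 0 a = 0 := lin0 (inner_r_lin a).
Let kos00 W : (forall i j, chainN i j -> W i j = 0) -> kos0 W = 0.
Proof.
move=> W0; rewrite (eq_kos0 (W' := fun _ _ => 0)) // /koszul0 big1 // => r _.
by rewrite il0 ir0 addr0.
Qed.

Lemma cell_dif_lin : linear cell_dif.
Proof.
apply: Defs.additive_linear => u v; apply: dsumP => p.
have e : comps (u + v) = fun i j => comps u i j + comps v i j.
  apply: funext => i; apply: funext => j; rewrite /comps.
  by case: ifP => _ //; rewrite addr0.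
rewrite [RHS]/= /cell_dif e /=; case: p => [[i j]|]; last exact: kos0D.
by case: ifP => _; [exact: kosD|rewrite addr0].
Qed.

Lemma cell_dif_dif u : cell_dif (cell_dif u) = 0.
Proof.
apply: dsumP => -[[i j]|] /=.
  case: ifP => // ch; rewrite (eq_kos (W' := kos (comps u))) ?kos_kos //.
  by move=> i' j' ch'; rewrite comps_build.
rewrite (eq_kos0 (W' := kos (comps u))) ?kos0_kos //.
by move=> i' j' ch'; rewrite comps_build.
Qed.

Lemma cell_cmpE m (u : cell_free) p :
  (cmp m u : D) p = if m == Posz (cell_deg p) then u p else 0.
Proof. by rewrite /= /sh_cmp [LHS]env_cmp subr_eq0. Qed.

Lemma comps_cmp m (u : cell_free) i j : chainN i j ->
  comps (cmp m u) i j = if m == Posz (j - i) then comps u i j else 0.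
Proof.
move=> ch; rewrite /comps ch cell_cmpE /=; have /andP [ij jN] := ch.
by rewrite !inordK // ltnS // (leq_trans (ltnW ij)).
Qed.

Lemma koszul_cmp m (u : cell_free) i j : chainN i j ->
  kos (comps (cmp m u)) i j = if m - 1 == Posz (j - i) then kos (comps u) i j else 0.
Proof.
move=> /andP [ij jN]; rewrite /koszul.
have e : (m - 1 == Posz (j - i)) = (m == Posz (j.+1 - i)).
  by rewrite subr_eq -PoszD addn1 subSn // ltnW.
have e1 : inner_r (comps (cmp m u) i.-1 j) (x i) =
    if m - 1 == Posz (j - i) then inner_r (comps u i.-1 j) (x i) else 0.
  case: i ij e => [|i] ij e; first by rewrite !(lin0 (inner_r_bilin.2 _)) if_same.
  rewrite comps_cmp; last by rewrite /chain (ltnW ij).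
  by rewrite e subSS /=; case: ifP.
have e2 : inner_l (x j.+1) (comps (cmp m u) i j.+1) =
    if m - 1 == Posz (j - i) then inner_l (x j.+1) (comps u i j.+1) else 0.
  have [jN'|jN'] := leqP j.+1 N; last by rewrite xN // !(lin0 (inner_l_bilin.1 _)) if_same.
  rewrite comps_cmp; last by rewrite /chain jN' ltnS ltnW.
  by rewrite e; case: ifP.
by rewrite e1 e2; case: ifP => // _; rewrite addr0.
Qed.

Lemma koszul0_cmp m (u : cell_free) :
  kos0 (comps (cmp m u)) = if m - 1 == 0 then kos0 (comps u) else 0.
Proof.
rewrite subr_eq0 /koszul0; have [->|m1] := eqVneq; last first.
  rewrite big1 // => r _; case: (boolP (chainN r.-1 r)) => ch; last first.
    by rewrite !comps_out // il0 ir0 addr0.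
  rewrite comps_cmp // ; have -> : (r - r.-1 = 1)%N by move: ch => /andP []; lia.
  by rewrite (negbTE m1) il0 ir0 addr0.
apply: eq_bigr => r _; case: (boolP (chainN r.-1 r)) => ch; last by rewrite !comps_out.
by rewrite comps_cmp //; have -> : (r - r.-1 = 1)%N by move: ch => /andP []; lia.
Qed.

Lemma cell_dif_cmp m (u : cell_free) :
  cell_dif (cmp m u) = cmp (m - 1) (cell_dif u : cell_free).
Proof.
apply: dsumP => p; rewrite cell_cmpE; case: p => [[i j]|] /=.
  by case: ifP => [ch|_]; [rewrite koszul_cmp|rewrite if_same].
exact: koszul0_cmp.
Qed.

Definition cell_cplx : cplx :=
  @Cplx D cell_dif (@cmp cell_free) cell_dif_lin cell_dif_dif (@cmp_lin cell_free)
    (@cmp_cmp cell_free) (@cmp_sum cell_free) cell_dif_cmp.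

Lemma cell_dif_act (f : E -> E) (F : D -> D) : linear f ->
  (forall a t, f (inner_l a t) = inner_l a (f t)) ->
  (forall t a, f (inner_r t a) = inner_r (f t) a) ->
  (forall u p, F u p = f (u p)) -> forall u, cell_dif (F u) = F (cell_dif u).
Proof.
move=> lf fl fr FE u; apply: dsumP => p; rewrite FE.
rewrite /cell_dif (comps_map (lin0 lf) (FE u)).
case: p => [[i j]|] /=; last by rewrite (dT_koszul0 lf fl fr).
by case: ifP => _; [rewrite (dT_koszul lf fl fr)|rewrite (lin0 lf)].
Qed.

Lemma cell_lact_dif a (u : cell_cplx) :
  dif (@lact A cell_free a u : cell_cplx) =
  @lact A cell_free (dif a) u + @lact A cell_free a (dif u).
Proof.
rewrite matched_dif (lin0 ((lact_bilin cell_free).1 _)) add0r.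
apply: (@cell_dif_act (fun t : E => lact a t)) => //.
- exact: (lact_bilin E).2.
- by move=> b t; rewrite lact_inner_l.
- by move=> t b; rewrite lact_inner_r.
Qed.

Lemma cell_ract_dif (u : cell_cplx) a :
  dif (@ract A cell_free u a : cell_cplx) =
  @ract A cell_free (dif u) a + @ract A cell_free u (dif a).
Proof.
rewrite matched_dif (lin0 ((ract_bilin cell_free).2 _)) addr0.
apply: (@cell_dif_act (fun t : E => ract t a) (fun u => @ract A cell_free u a)) => //.
- exact: (ract_bilin E).1.
- by move=> b t; rewrite ract_inner_l.
- by move=> t b; rewrite ract_inner_r.
Qed.

Definition koszul_cell : dgBimod A :=
  @DgBimod A cell_cplx (@lact A cell_free) (@ract A cell_free)
    (lact_bilin cell_free) (ract_bilin cell_free) (@lactA A cell_free)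
    (@lact1 A cell_free) (@ractA A cell_free) (@ract1 A cell_free)
    (@lractC A cell_free) cell_lact_dif cell_ract_dif
    (@lact_hom A cell_free) (@ract_hom A cell_free).

Definition deg_layer (i : nat) (u : koszul_cell) : Prop :=
  forall p, (i <= cell_deg p)%N -> (u : D) p = 0.

Lemma koszul_layer i (u : D) (j l : nat) :
  (forall p, (i < cell_deg p)%N -> u p = 0) -> chainN j l -> (i <= l - j)%N ->
  kos (comps u) j l = 0.
Proof.
move=> Su /andP [jl lN] il; rewrite /koszul.
have Sc j' l' : (i < l' - j')%N -> comps u j' l' = 0.
  move=> h; rewrite /comps; case: ifP => // /andP [jl' lN'].
  by apply: Su; rewrite /= !inordK //; lia.
rewrite (Sc j l.+1); last by lia.
case: j jl il => [|j] jl il; last by rewrite Sc ?ir0 ?il0 ?addr0 //=; lia.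
by rewrite (lin0 (inner_r_bilin.2 _)) il0 addr0.
Qed.

(** The Koszul differential shortens chains by one arrow. Hence it vanishes on the subquotients, as
    it must, since E has zero differential. *)
Lemma deg_layer_dif i u : deg_layer i.+1 u -> deg_layer i (dif u).
Proof.
move=> Su [[j l]|] /=.
  by case: ifP => // ch il; apply: koszul_layer il.
rewrite leqn0 => /eqP i0; apply: kos00 => j l ch.
rewrite /comps ch; apply: Su; move: ch => /andP [jl lN] /=.
by rewrite !inordK; lia.
Qed.

Lemma deg_layerS i u : deg_layer i u -> deg_layer i.+1 u.
Proof. by move=> Su p /ltnW; apply: Su. Qed.

Lemma deg_layer_sub i : sub_bimod (deg_layer i).
Proof.
split=> [|u Su|m u Su|a u Su|u a Su].
- split=> // a u v Su Sv p ip; rewrite dsum_linE (Su p ip) (Sv p ip).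
  by rewrite scaler0 addr0.
- exact/deg_layer_dif/deg_layerS.
- move=> p ip; rewrite [LHS]cell_cmpE (Su p ip) if_same.
  by [].
- by move=> p ip /=; rewrite (Su p ip); apply: lin0 ((lact_bilin E).2 a).
by move=> p ip /=; rewrite (Su p ip); apply: lin0 ((ract_bilin E).1 a).
Qed.

Lemma dgiso_refl (M : dgBimod A) : dgiso M M.
Proof. by exists id, id; split. Qed.

Lemma koszul_cell_finite : finite_cell koszul_cell.
Proof.
exists deg_layer; last first.
  exists N.+1 => u [[i j]|] //= h.
  by have := ltn_ord j; have := ltn_ord i; move: h; lia.
split=> [i|u|i u|i].
- exact: deg_layer_sub.
- split=> [Su|-> //]; apply: dsumP => p; exact: Su.
- exact: deg_layerS.
pose Q := [pred p : I | cell_deg p == i].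
pose m := #|Q|.
pose F := dsum_bimod (fun q : 'I_m => shift_bimod (Posz (cell_deg (enum_val q))) E).
exists F; first by exists m, (fun q => Posz (cell_deg (enum_val q))); apply: dgiso_refl.
pose q (u : koszul_cell) : F :=
  @fin_dsum 'I_m (fun q => shift_bimod (Posz (cell_deg (enum_val q))) E : lmodType F2)
    (fun r => (u : D) (enum_val r)).
have degQ (r : 'I_m) : cell_deg (enum_val r) = i by have /eqP := enum_valP r.
exists q; split.
- split=> [a u v _ _|]; first exact: dsumP.
  split=> [u Su|j u _]; apply: dsumP => r //=.
  rewrite [RHS]env_dif; apply: (deg_layer_dif Su).
  by rewrite degQ.
- by split=> [a u _|u a _]; apply: dsumP.
- move=> v; exists (mk (fun p => \sum_(r < m | enum_val r == p) (v : dsum _) r)).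
    move=> p /= ip; rewrite big1 // => r /eqP e.
    by have := degQ r; rewrite e => ei; rewrite ei ltnn in ip.
  apply: dsumP => r /=; rewrite (big_pred1 r) // => r'.
  by rewrite (inj_eq enum_val_inj).
move=> u Su; split=> [qu p|Su'].
  rewrite leq_eqVlt => /orP [/eqP ip|]; last exact: Su.
  have pQ : p \in Q by rewrite inE -ip.
  have := congr1 (fun w : dsum _ => w (enum_rank_in pQ p)) (qu : (q u : dsum _) = 0).
  by rewrite /= enum_rankK_in.
by apply: dsumP => r /=; apply: Su'; rewrite degQ.
Qed.

Lemma chain_src_mul r : dgmul (es r) (x r) = x r.
Proof.
rewrite /chain_arrow; case: ifP => rN; last exact: lin0 ((dgmul_bilin A).2 _).
by rewrite (ma_evy mA) vtx_chain_pos // eqxx.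
Qed.

Lemma chain_mul_tgt r : dgmul (x r) (et r) = x r.
Proof.
rewrite /chain_arrow; case: ifP => rN; last exact: lin0 ((dgmul_bilin A).1 _).
by rewrite (ma_yev mA) vtx_chain_posS // eqxx.
Qed.

Definition corner (i j : nat) (t : E) : E := inner_l (et j) (inner_r t (es i.+1)).

Lemma corner_lin i j : linear (corner i j).
Proof. by move=> a t u; rewrite /corner inner_r_lin inner_l_lin. Qed.

Lemma cornerK i j t : corner i j (corner i j t) = corner i j t.
Proof. by rewrite /corner inner_lrC inner_lA inner_rA !(ma_ev mA) !eqxx. Qed.

Lemma koszul_corner W i j : chainN i j ->
  kos (fun i j => corner i j (W i j)) i j = corner i j (kos W i j).
Proof.
move=> /andP [ij jN]; rewrite /koszul (linD (corner_lin i j)); congr (_ + _).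
  case: i ij => [|i] ij /=.
    by rewrite !(lin0 (inner_r_bilin.2 _)) (lin0 (corner_lin _ _)).
  rewrite /corner inner_lrC !inner_rA chain_src_mul (chain_arrow_src n_odd mA) //.
  exact: leq_trans ij jN.
rewrite /corner inner_lrC !inner_lA chain_mul_tgt (chain_tgt_arrow n_odd mA) //.
exact: leq_ltn_trans ij.
Qed.

Lemma diag_arrow_l r t : diag_in (inner_l (x r) t) = inner_l (x r) (inner_r t (es r)).
Proof.
have e v : inner_l (ev v) (inner_r (inner_l (x r) t) (ev v)) =
    if v == vtx n r.-1 then inner_l (x r) (inner_r t (ev v)) else 0.
  rewrite inner_lrC inner_lA; case: eqP => [->|ne]; first by rewrite chain_src_mul.
  rewrite -{1}(chain_src_mul r) dgmulA (ma_ev mA); case: eqP => // _.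
  by rewrite (lin0 ((dgmul_bilin A).1 _)) (lin0 (inner_l_bilin.1 _)).
by rewrite /diag (eq_bigr _ (fun v _ => e v)) -big_mkcond big_pred1_eq.
Qed.

Lemma diag_arrow_r r t : diag_in (inner_r t (x r)) = inner_r (inner_l (et r) t) (x r).
Proof.
have e v : inner_l (ev v) (inner_r (inner_r t (x r)) (ev v)) =
    if v == vtx n r then inner_r (inner_l (ev v) t) (x r) else 0.
  rewrite inner_rA inner_lrC; case: eqP => [->|ne]; first by rewrite chain_mul_tgt.
  rewrite -{1}(chain_mul_tgt r) -dgmulA (ma_ev mA); case: eqP => [e|_].
    by case: ne.
  by rewrite (lin0 ((dgmul_bilin A).2 _)) (lin0 (inner_r_bilin.2 _)) il0.
by rewrite /diag (eq_bigr _ (fun v _ => e v)) -big_mkcond big_pred1_eq.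
Qed.

Let diagl := diag_lin bl br ev.

Lemma koszul0_corner W :
  kos0 (fun i j => corner i j (W i j)) = diag_in (kos0 W).
Proof.
rewrite /koszul0 (lin_sum _ _ diagl); apply: eq_bigr => -[[|r] ?] _ /=.
  rewrite !(lin0 (inner_r_bilin.2 _)) !(lin0 (inner_l_bilin.1 _)) addr0.
  by rewrite (lin0 diagl).
rewrite (linD diagl) diag_arrow_l diag_arrow_r /corner.
by rewrite inner_lA chain_mul_tgt !inner_lrC inner_rA chain_src_mul.
Qed.

Definition corner_at (p : I) : E -> E :=
  if p is Some (i, j) then if chainN i j then corner i j else fun _ => 0 else diag_in.

Lemma corner_at_lin p : linear (corner_at p).
Proof.
case: p => [[i j]|] //=; case: ifP => _; first exact: corner_lin.
by move=> a u v; rewrite scaler0 addr0.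
Qed.

Lemma corner_atK p t : corner_at p (corner_at p t) = corner_at p t.
Proof.
case: p => [[i j]|] /=; last by apply: diagK; [exact: bl|exact: br|exact: inner_lA|
  exact: inner_rA|exact: inner_lrC|exact: (ma_ev mA)].
by case: ifP => _ //; apply: cornerK.
Qed.

Lemma corner_at_act (f : E -> E) p t : linear f ->
  (forall a t, f (inner_l a t) = inner_l a (f t)) ->
  (forall t a, f (inner_r t a) = inner_r (f t) a) ->
  corner_at p (f t) = f (corner_at p t).
Proof.
move=> lf fl fr; case: p => [[i j]|] /=; last by rewrite (dT_diag lf fl fr).
by case: ifP => _; rewrite ?(lin0 lf) // /corner fl fr.
Qed.

(** In the Koszul resolution the chain from the vertex s to the vertex t carries A e_s (x) e_t A,
    which is only a summand of A^e. The resolution is the image of this idempotent endomorphism of a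
    genuine cell bimodule; the junk indices are sent to 0. *)
Definition proj (u : koszul_cell) : koszul_cell := mk (fun p => corner_at p ((u : D) p)).

Lemma proj_lin : linear proj.
Proof. by move=> a u v; apply: dsumP => p; apply: corner_at_lin. Qed.

Lemma projK u : proj (proj u) = proj u.
Proof. by apply: dsumP => p; apply: corner_atK. Qed.

Lemma comps_proj u i j : chainN i j -> comps (proj u) i j = corner i j (comps u i j).
Proof.
move=> ch; rewrite /comps ch /= ; have /andP [ij jN] := ch.
by rewrite !inordK ?ch // ltnS // (leq_trans (ltnW ij)).
Qed.

Lemma proj_dif u : proj (dif u) = dif (proj u).
Proof.
apply: dsumP => -[[i j]|] /=.
  case: ifP => // ch; rewrite -koszul_corner //; apply/esym/eq_kos => // i' j' ch'.
  exact: comps_proj.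
by rewrite -koszul0_corner; apply/esym/eq_kos0 => i' j' ch'; apply: comps_proj.
Qed.

Lemma proj_cmp m u : proj (cmp m u) = cmp m (proj u).
Proof.
apply: dsumP => p; transitivity (corner_at p ((cmp m (u : cell_free) : D) p)) => //.
rewrite [RHS](cell_cmpE m (proj u : D)) cell_cmpE.
by case: ifP => // _; apply: lin0 (corner_at_lin p).
Qed.

Lemma proj_lact a u : proj (lact a u) = lact a (proj u).
Proof.
apply: dsumP => p; apply: (corner_at_act (f := fun t : E => lact a t)).
- exact: (lact_bilin E).2.
- by move=> b t; rewrite lact_inner_l.
- by move=> t b; rewrite lact_inner_r.
Qed.

Lemma proj_ract u a : proj (ract u a) = ract (proj u) a.
Proof.
apply: dsumP => p; apply: (corner_at_act (f := fun t : E => ract t a)).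
- exact: (ract_bilin E).1.
- by move=> b t; rewrite ract_inner_l.
- by move=> t b; rewrite ract_inner_r.
Qed.

(** The quotient by the image of 1 - [proj] is a model of the image of [proj]; the projection and
    the map induced by [proj] exhibit it as a retract. *)
Definition proj_gen (z : koszul_cell) : Prop := exists u, z = u - proj u.

Lemma span_proj_gen u : span proj_gen (u - proj u).
Proof. by apply: span_gen; exists u. Qed.

Lemma proj_gen_dif g : proj_gen g -> span proj_gen (dif g).
Proof. by case=> u ->; rewrite (linB (@dif_lin koszul_cell)) -proj_dif; apply: span_proj_gen. Qed.
Lemma proj_gen_cmp m g : proj_gen g -> span proj_gen (cmp m g).
Proof. by case=> u ->; rewrite (linB (@cmp_lin koszul_cell m)) -proj_cmp; apply: span_proj_gen. Qed.
Lemma proj_gen_lact a g : proj_gen g -> span proj_gen (lact a g).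
Proof. by case=> u ->; rewrite (linB ((lact_bilin koszul_cell).2 a)) -proj_lact; apply: span_proj_gen. Qed.
Lemma proj_gen_ract a g : proj_gen g -> span proj_gen (ract g a).
Proof. by case=> u ->; rewrite (linB ((ract_bilin koszul_cell).1 a)) -proj_ract; apply: span_proj_gen. Qed.

Definition koszul_res : dgBimod A :=
  quot_bimod proj_gen_dif proj_gen_cmp proj_gen_lact proj_gen_ract.

Lemma proj_gen0 g : proj_gen g -> proj g = 0.
Proof. by case=> u ->; rewrite (linB proj_lin) projK subrr. Qed.

Definition res_in : koszul_res -> koszul_cell := qlift proj.

Lemma res_inE u : res_in (qpi proj_gen u) = proj u.
Proof. exact: (qliftE proj_lin proj_gen0). Qed.

Lemma res_in_lin : linear res_in.
Proof. exact: (qlift_lin proj_lin proj_gen0). Qed.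

Lemma qpi_proj u : qpi proj_gen (proj u) = qpi proj_gen u.
Proof. by apply/esym/qpi_eq/span_proj_gen. Qed.

Lemma koszul_res_retract : dg_retract koszul_res koszul_cell.
Proof.
exists res_in, (qpi proj_gen); split.
- split; first exact: res_in_lin.
  + by elim/quotP => u; rewrite [dif _]dif_qpi !res_inE proj_dif.
  + by move=> m; elim/quotP => u; rewrite [cmp _ _]cmp_qpi !res_inE proj_cmp.
  + by move=> a; elim/quotP => u; rewrite [lact _ _]lact_qpi !res_inE proj_lact.
  + by elim/quotP => u a; rewrite [ract _ _]ract_qpi !res_inE proj_ract.
- split; first exact: qpi_lin.
  + by move=> u; rewrite [RHS]dif_qpi.
  + by move=> m u; rewrite [RHS]cmp_qpi.
  + by move=> a u; rewrite [RHS]lact_qpi.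
  + by move=> u a; rewrite [RHS]ract_qpi.
by elim/quotP => u; rewrite res_inE qpi_proj.
Qed.

(** * The augmentation onto A *)

Definition env_mul : E -> A := tlift dgmul.

Lemma env_mul_lin : linear env_mul. Proof. exact: tlift_lin (dgmul_bilin A). Qed.
Lemma env_mulE w m : env_mul (tpure w m) = dgmul w m.
Proof. exact: tliftE (dgmul_bilin A) _ _. Qed.

Lemma env_mul_comm t : comm t -> env_mul t = 0.
Proof.
have lz : linear (fun _ : E => 0 : A) by move=> a u v; rewrite scaler0 addr0.
move: t; apply: (span_ext env_mul_lin lz) => _ [a [t ->]].
move: t; apply: tens_ext => // [c u v|w m].
  by rewrite inner_l_lin inner_r_lin addrACA -scalerDr env_mul_lin.
by rewrite (linD env_mul_lin) inner_lE inner_rE !env_mulE dgmulA addxx.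
Qed.

Lemma comm_env_mul t : comm (t + tpure dgone (env_mul t)).
Proof.
elim: (tens_span t) => [|a g u [w [m ->]] _ IH].
  by rewrite (lin0 env_mul_lin) (lin0 (l2 _)) addr0; apply: span0.
rewrite env_mul_lin l2 addrACA -scalerDr; apply: span_lin IH; apply: span_gen.
exists w, (tpure dgone m); rewrite inner_lE inner_rE env_mulE dgmul1l.
exact: addrC.
Qed.

Lemma env_mul_lact a t : env_mul (lact a t) = dgmul a (env_mul t).
Proof.
move: t; apply: tens_ext => [c u v|c u v|w m].
- by rewrite (lact_bilin E).2 env_mul_lin.
- by rewrite env_mul_lin (dgmul_bilin A).2.
by rewrite env_lactE !env_mulE dgmulA.
Qed.

Lemma env_mul_ract t a : env_mul (ract t a) = dgmul (env_mul t) a.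
Proof.
move: t; apply: tens_ext => [c u v|c u v|w m].
- by rewrite (ract_bilin E).1 env_mul_lin.
- by rewrite env_mul_lin (dgmul_bilin A).1.
by rewrite env_ractE !env_mulE dgmulA.
Qed.

Definition augment (u : koszul_cell) : reg_bimod A := env_mul ((u : D) None).

Lemma augment_lin : linear augment.
Proof. by move=> a u v; apply: env_mul_lin. Qed.

Lemma augment_proj u : augment (proj u) = augment u.
Proof.
apply: addr_eq2; rewrite -(linD augment_lin) addrC; apply: env_mul_comm.
exact: (comm_diag _ br inner_rA inner_r1 (ma_ev mA) (ma_sum mA)).
Qed.

Lemma augment_gen g : proj_gen g -> augment g = 0.
Proof. by case=> u ->; rewrite (linB augment_lin) augment_proj subrr. Qed.

Definition res_aug : koszul_res -> reg_bimod A := qlift augment.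

Lemma res_augE u : res_aug (qpi proj_gen u) = augment u.
Proof. exact: (qliftE augment_lin augment_gen). Qed.

Lemma res_aug_map : dgmap res_aug.
Proof.
split; first exact: (qlift_lin augment_lin augment_gen).
- elim/quotP => u; rewrite [dif _]dif_qpi !res_augE [RHS]matched_dif.
  exact/env_mul_comm/comm_koszul0.
- move=> m; elim/quotP => u; rewrite [cmp _ _]cmp_qpi !res_augE [RHS]matched_cmp.
  rewrite /augment [dsum_val _ _](cell_cmpE m (u : D) None) /=.
  by case: ifP => // _; apply: lin0 env_mul_lin.
- by move=> a; elim/quotP => u; rewrite [lact _ _]lact_qpi !res_augE; apply: env_mul_lact.
by elim/quotP => u a; rewrite [ract _ _]ract_qpi !res_augE; apply: env_mul_ract.
Qed.

(** With zero differential the total complex splits, and acyclicity becomes exactness of the Koszul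
    complex itself, augmented by the inner commutator quotient. *)
Lemma env_acyclic G W : family G W -> comm G -> kos0 W = 0 ->
  (forall i j, chainN i j -> kos W i j = 0) ->
  exists (G' : E) (W' : nat -> nat -> E), G = kos0 W' /\ forall i j, chainN i j -> W i j = kos W' i j.
Proof.
have lz : linear (fun _ : E => 0 : E) by move=> a u v; rewrite scaler0 addr0.
move=> fGW cG kG kW.
have [||||G' [W' [_ _ e1 e2]]] := based_acyclic n_odd mA bl br (dgmul_bilin A)
  (fun a b m => dgmulA a b m) (@dgmul1l A) env_pr_bilin
  (fun a l m w => inner_lE a w m) (fun l m w a => inner_rE a w m)
  env_pr_span env_pr_univ (dT := fun=> 0) (dM := fun=> 0) (rk := fun=> 0%N)
  inner_lA inner_rA inner_lrC inner_r1 lz (fun=> erefl)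
  (fun a t => esym (il0 a)) (fun t a => esym (ir0 a))
  (fun a m => esym (lin0 ((dgmul_bilin A).2 a))) _ (s := 0) fGW _ _ _.
- by move=> l m w; rewrite /env_pr (lin0 (l2 w)) addr0; apply: span0.
- by rewrite add0r.
- by rewrite kG.
- by move=> i j ch; rewrite kW.
exists G', W'; rewrite {1}e1 add0r; split=> // i j ch.
by rewrite e2 // add0r.
Qed.

Lemma res_aug_quasi : quasi_iso res_aug.
Proof.
split; first exact: res_aug_map.
  elim/quotP => u du [b]; rewrite res_augE matched_dif => au.
  (* The class of u is a cycle only modulo the image of 1 - [proj]; its representative [proj u] is a
     cycle of the cell bimodule, so acyclicity applies to it. *)
  have dpu : cell_dif (proj u) = 0.
    rewrite -[LHS]proj_dif -res_inE.
    have -> : qpi proj_gen (dif u) = 0 by rewrite -[RHS]du [RHS]dif_qpi.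
    exact: lin0 res_in_lin.
  have comps_dif i j : chainN i j -> kos (comps (proj u)) i j = 0.
    move=> ch; have := congr1 (fun v => comps v i j) dpu.
    by rewrite /cell_dif comps_build // => ->; rewrite /comps if_same.
  have [||| |G [W [e1 e2]]] := @env_acyclic ((proj u : D) None) (comps (proj u)).
  - split.
    + exact: (corner_atK None).
    + by move=> i j; apply: comps_out.
    + move=> i j; case: (boolP (chainN i j)) => ch; last by rewrite comps_out.
      by rewrite comps_proj // /corner inner_lA (ma_ev mA) eqxx.
    + move=> i j; case: (boolP (chainN i j)) => ch; last by rewrite comps_out.
      by rewrite comps_proj // /corner inner_lrC inner_rA (ma_ev mA) eqxx.
  - have := comm_env_mul ((proj u : D) None).
    by rewrite -[env_mul _]/(augment (proj u)) augment_proj au (lin0 (l2 _)) addr0.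
  - exact: (congr1 (fun v : D => v None) dpu).
  - exact: comps_dif.
  exists (qpi proj_gen (build G W)); rewrite [RHS]dif_qpi -qpi_proj; congr qpi.
  apply: dsumP => -[[i j]|]; last first.
    by rewrite [LHS]e1 /=; apply/esym/eq_kos0 => i j; apply: comps_build.
  rewrite [RHS]/=; case: ifP => ch; last by rewrite /= ch.
  rewrite -[LHS](comps_ord _ ch) e2 //; apply/esym/eq_kos => // i' j'.
  exact: comps_build.
move=> a _; pose u := build (tpure dgone a) (fun _ _ => 0).
have u0 : cell_dif u = 0.
  apply: dsumP => -[[i j]|] /=; last by apply: kos00 => i j /comps_build ->.
  case: ifP => // ch; rewrite (eq_kos (W' := fun _ _ => 0)) //.
    by rewrite /koszul il0 ir0 addr0.
  by move=> i' j'; apply: comps_build.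
exists (qpi proj_gen u), 0; split; first by rewrite dif_qpi [dif _]u0 (lin0 (@qpi_lin _ _)).
by rewrite res_augE matched_dif addr0 /augment [RHS]env_mulE dgmul1l.
Qed.

Lemma matched_smooth : homologically_smooth A.
Proof.
exists koszul_res, res_aug; split; last exact: res_aug_quasi.
exists koszul_cell; first exact: koszul_cell_finite.
exact: koszul_res_retract.
Qed.

End Smooth.

(** * Tate cohomology of a symmetric square *)

Section Functional.
Variables (V : lmodType F2) (Z : V -> Prop) (x : V).

Lemma span_mono (G H : V -> Prop) z : (forall g, G g -> H g) -> span G z -> span H z.
Proof. by move=> GH; apply: (span_map (f := id)) => // g /GH; apply: span_gen. Qed.

(** A combination involves finitely many generators, hence a single member of the chain. The first
    alternative covers the empty chain. *)
Lemma span_chain (F : set (set V)) z : total_on F subset ->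
  span (fun v => Z v \/ (\bigcup_(X in F) X)%classic v) z ->
  span Z z \/ exists2 X, F X & span (fun v => Z v \/ X v) z.
Proof.
move=> Ftot; elim=> [|a g w Gg _ IH]; first by left; apply: span0.
have lift X w' : span Z w' -> span (fun v => Z v \/ X v) w'.
  by apply: span_mono => v; left.
case: Gg => [Zg|[Y FY Yg]]; last first.
  right; case: IH => [Zw|[X FX Xw]].
    by exists Y => //; apply: span_cons (lift _ _ Zw); right.
  have [XY|YX] := Ftot X Y FX FY.
    exists Y => //; apply: span_cons; first by right.
    by apply: span_mono Xw => v [|/XY]; [left|right].
  by exists X => //; apply: span_cons Xw; right; apply: YX.
case: IH => [Zw|[X FX Xw]]; first by left; apply: span_cons.
by right; exists X => //; apply: span_cons Xw; left.
Qed.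

Lemma F2_cases (a : F2) : a = 0 \/ a = 1.
Proof.
case: a => -[|[|m]] // i; [left|right]; exact/val_inj.
Qed.

(** A maximal H with x outside the span of Z and H gives a hyperplane: by maximality, v outside it
    implies x + v inside. Over F2 the indicator of the complement is then linear. *)
Lemma separating_functional : ~ span Z x ->
  exists l : V -> F2^o, [/\ linear l, forall z, Z z -> l z = 0 & l x = 1].
Proof.
move=> nZx; pose P (X : set V) := ~ span (fun v => Z v \/ X v) x.
have [F FP Ftot|H [PH Hmax]] := @Zorn_bigcup V P.
  by move=> /(span_chain Ftot) [//|[X /FP PX]].
pose G v := Z v \/ H v.
have Gx v : ~ span G v -> span G (x + v).
  move=> nGv; have /contrapT : ~ P (H `|` [set v])%classic.
    apply: Hmax; split; first by move=> u; left.
    by move=> /(_ v) Hv; apply: nGv; apply: span_gen; right; apply: Hv; right.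
  have -> : (fun u => Z u \/ (H `|` [set v])%classic u) = (fun u => G u \/ u = v).
    apply: funext => u; apply/propext; rewrite /G /setU /=; tauto.
  suff S w : span (fun u => G u \/ u = v) w -> span G w \/ span G (w + v).
    by case/S.
  elim=> [|a g w' [Gg|->] _ IH]; first by left; apply: span0.
    by case: IH => h; [left|right; rewrite -addrA]; apply: span_cons.
  have [->|->] := F2_cases a; first by rewrite scale0r add0r.
  rewrite scale1r; case: IH => h; [right|left]; last by rewrite addrC.
  by rewrite addrAC addxx add0r.
pose l v : F2^o := if `[< span G v >] then 0 else 1.
exists l; split.
- apply: Defs.additive_linear => u v; rewrite /l.
  case: asboolP => Guv; case: asboolP => Gu; case: asboolP => Gv;
    rewrite ?addr0 ?add0r //.
  + by case: Gv; rewrite -[v](addxK u); apply: spanD.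
  + by case: Gu; rewrite -[u](addxK v) (addrC v u); apply: spanD.
  + exact/val_inj.
  + by case: Guv; apply: spanD.
  have e : u + v = (x + u) + (x + v) by rewrite addrACA addxx add0r.
  by case: Guv; rewrite e; apply: spanD; apply: Gx.
- by move=> z Zz; rewrite /l asboolT //; apply: span_gen; left.
by rewrite /l asboolF.
Qed.

End Functional.

(* The Tate cohomology of the swap on the tensor square of T / span Z. *)
Section SymmetricSquare.
Variables (T Y : lmodType F2) (Z : T -> Prop) (b : T -> T -> Y) (tY : Y -> Y).
(** Y plays the tensor square of T / span Z: [b_span] gives surjectivity, and [b_dual] supplies the
    products of functionals, which are all that is used of injectivity. *)
Hypotheses (b_bilin : bilinear b) (bZ : forall z t, Z z -> b z t = 0)
  (b_Z : forall z t, Z z -> b t z = 0)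
  (tY_lin : linear tY) (tb : forall t u, tY (b t u) = b u t)
  (b_span : forall v, span (fun w => exists t u, w = b t u) v)
  (b_dual : forall l l' : T -> F2^o, linear l -> linear l' ->
     (forall z, Z z -> l z = 0) -> (forall z, Z z -> l' z = 0) ->
     exists2 P : Y -> F2^o, linear P & forall t u, P (b t u) = l t * l' u).

Lemma span_coef n (X : 'I_n -> T) t : span (fun w => Z w \/ exists i, w = X i) t ->
  exists (c : 'I_n -> F2) z, span Z z /\ t = \sum_i c i *: X i + z.
Proof.
elim=> [|a g u Gg _ [c [z [Zz ->]]]].
  exists (fun _ => 0), 0; split; first exact: span0.
  by rewrite big1 ?addr0 // => i _; rewrite scale0r.
case: Gg => [Zg|[i ->]].
  by exists c, (a *: g + z); split; [apply: span_cons|rewrite addrCA].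
exists (fun j => (if j == i then a else 0) + c j), z; split=> //.
under [in RHS]eq_bigr do rewrite scalerDl.
rewrite big_split /= -!addrA; congr (_ + _); rewrite (bigD1 i) //= eqxx big1 ?addr0 //.
by move=> j /negbTE ->; rewrite scale0r.
Qed.

Lemma b_spanZ z t : span Z z -> b z t = 0.
Proof.
elim=> [|a g u Zg _ IH]; first exact: lin0 (b_bilin.1 t).
by rewrite b_bilin.1 IH bZ // scaler0 addr0.
Qed.

Lemma b_span_Z z t : span Z z -> b t z = 0.
Proof.
elim=> [|a g u Zg _ IH]; first exact: lin0 (b_bilin.2 t).
by rewrite b_bilin.2 IH b_Z // scaler0 addr0.
Qed.

Lemma b_sum v : exists n (X W : 'I_n -> T), v = \sum_i b (X i) (W i).
Proof.
elim: (b_span v) => [|a g w [t [u ->]] _ [n [X [W ->]]]].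
  by exists 0%N, (fun _ => 0), (fun _ => 0); rewrite big_ord0.
exists n.+1, (fun i => if unlift ord0 i is Some j then X j else a *: t),
  (fun i => if unlift ord0 i is Some j then W j else u).
rewrite big_ord_recl unlift_none (linZ (b_bilin.1 u)); congr (_ + _).
by apply: eq_bigr => i _; rewrite liftK.
Qed.

Lemma sum_b_ker n (X W : 'I_n -> T) (l l' : T -> F2^o) :
  linear l -> linear l' -> (forall z, Z z -> l z = 0) -> (forall z, Z z -> l' z = 0) ->
  tY (\sum_i b (X i) (W i)) = \sum_i b (X i) (W i) ->
  \sum_i l (X i) * l' (W i) = \sum_i l (W i) * l' (X i) :> F2^o.
Proof.
move=> ll ll' lZ lZ' e; have [P lP PE] := b_dual ll ll' lZ lZ'.
have : P (tY (\sum_i b (X i) (W i))) = P (\sum_i b (X i) (W i)) by rewrite e.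
rewrite (lin_sum _ _ tY_lin) !(lin_sum _ _ lP).
under eq_bigr do rewrite tb PE; under [RHS]eq_bigr do rewrite PE.
by move=> ->.
Qed.

(** Induction on the number of terms of v. If the last left factor x depends on the others modulo Z,
    the last term is absorbed. Otherwise a functional l that is 1 on x and 0 on the others expresses
    the last right factor w through the X_i and x. *)
Lemma symmetric_square v : tY v = v ->
  exists t u, v = b t t + (u + tY u).
Proof.
have [n [X [W ->]]] := b_sum v; elim: n => [|n IH] in X W *.
  move=> _; exists 0, 0; rewrite big_ord0 (lin0 (b_bilin.1 0)) (lin0 tY_lin).
  by rewrite !addr0.
pose X' i := X (widen_ord (leqnSn n) i); pose W' i := W (widen_ord (leqnSn n) i).
pose x := X ord_max; pose w := W ord_max.
have eS : \sum_i b (X i) (W i) = \sum_i b (X' i) (W' i) + b x w.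
  by rewrite big_ord_recr.
move=> sv; have [h|h] := pselect (span (fun u => Z u \/ exists i, u = X' i) x).
  have [c [z [Zz ex]]] := span_coef h.
  have e : \sum_i b (X i) (W i) = \sum_i b (X' i) (W' i + c i *: w).
    rewrite eS ex (linD (b_bilin.1 w)) (b_spanZ _ Zz) addr0 (lin_sum _ _ (b_bilin.1 w)).
    rewrite -big_split; apply: eq_bigr => i _ /=.
    by rewrite (linD (b_bilin.2 _)) (linZ (b_bilin.1 w)) (linZ (b_bilin.2 _)).
  by rewrite e; apply: IH; rewrite -e.
have [l [ll lG lx]] := separating_functional h.
have lZ z : Z z -> l z = 0 by move=> Zz; apply: lG; left.
have lX i : l (X' i) = 0 by apply: lG; right; exists i.
pose z := \sum_i l (W' i) *: X' i.
(* Evaluating the symmetry of v at l (x) l' gives l'(w) = l'(z + l(w) x) for every l' vanishing on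
   Z, and such functionals separate points of T / span Z. *)
have Zw : span Z (w + (z + l w *: x)).
  have [//|nZ] := pselect (span Z (w + (z + l w *: x))).
  have [l' [ll' lZ' lx']] := separating_functional nZ.
  have := sum_b_ker ll ll' lZ lZ' sv; rewrite !big_ord_recr /= -/x -/w lx mul1r.
  rewrite big1 ?add0r => [e|i _]; last by rewrite -/(X' i) lX mul0r.
  have ez : l' z = \sum_i l (W' i) * l' (X' i).
    by rewrite (lin_sum _ _ ll'); apply: eq_bigr => i _; rewrite (linZ ll').
  have : l' (w + (z + l w *: x)) = 0.
    by rewrite !(linD ll') (linZ ll') ez e; apply: addxx.
  by rewrite lx' => /eqP; rewrite oner_eq0.
have ew : b x w = b x z + l w *: b x x.
  apply: addr_eq2; have := b_span_Z x Zw; rewrite !(linD (b_bilin.2 x)).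
  by rewrite (linZ (b_bilin.2 x)).
(* The shorter sum absorbs b(z, x), which the term b(x, z) needs to become (1 + tau) b(x, z). Then
   v' is again symmetric. *)
pose v' := \sum_i b (X' i) (W' i + l (W' i) *: x).
have ev' : v' = \sum_i b (X' i) (W' i) + b z x.
  rewrite /z (lin_sum _ _ (b_bilin.1 x)) -big_split; apply: eq_bigr => i _ /=.
  by rewrite (linD (b_bilin.2 _)) (linZ (b_bilin.1 x)) (linZ (b_bilin.2 _)).
have evv : \sum_i b (X i) (W i) = v' + ((b x z + tY (b x z)) + l w *: b x x).
  rewrite eS ew ev' tb [RHS](AC (2*(2*1)) ((2*4)*(1*(3*5))))%AC.
  by rewrite /= addxx add0r.
have sv' : tY v' = v'.
  move: sv; rewrite evv !(linD tY_lin) (linZ tY_lin) !tb (addrC (b z x)).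
  by move/addIr.
have [t [u et]] := IH _ _ sv'.
(* A scalar of F2 equals its square, so the leftover multiple of b(x, x) is a square and can be
   merged with b(t, t). *)
have sq : b (l w *: x) (l w *: x) = l w *: b x x.
  rewrite (linZ (b_bilin.1 _)) (linZ (b_bilin.2 _)).
  by have [->|->] := F2_cases (l w : F2); rewrite ?scale0r // !scale1r.
exists (t + l w *: x), (u + b x z + b t (l w *: x)).
rewrite evv (et : v' = _) !(linD tY_lin) (tb t) (linD (b_bilin.1 _)) !(linD (b_bilin.2 _)).
rewrite sq [RHS](AC ((2*2)*(3*3)) ((2*7)*((3*10)*((1*(5*8))*((6*9)*4)))))%AC.
by rewrite /= addxx add0r addxx add0r.
Qed.

(** If l is 1 on t and 0 on Z, the functional l (x) l is invariant under the swap, so it kills u +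
    tau u, yet it is 1 on b(t, t). *)
Lemma symmetric_square_inj t u : b t t = u + tY u -> span Z t.
Proof.
move=> e; have [//|nZ] := pselect (span Z t).
have [l [ll lZ lt]] := separating_functional nZ.
have [P lP PE] := b_dual ll ll lZ lZ.
have Pt w : P (tY w) = P w.
  move: w; have lPt : linear (fun w => P (tY w)) by move=> a p q; rewrite tY_lin lP.
  move=> w; apply: (span_ext lPt lP _ (b_span w)) => _ [p [q ->]].
  by rewrite tb !PE mulrC.
have : P (b t t) = 0 by rewrite e (linD lP) Pt addxx.
by rewrite PE lt mulr1 => /eqP; rewrite oner_eq0.
Qed.

End SymmetricSquare.

(** * Bases of cell bimodules *)

Section DsumLift.
Variables (I : choiceType) (V : I -> lmodType F2) (W : lmodType F2).
Variable h : forall i, V i -> W.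
Hypothesis lh : forall i, linear (@h i).

Definition dsum_lift (f : dsum V) : W :=
  \sum_(i <- undup (sval (cid (dsum_supp f)))) h (f i).

Lemma dsum_liftE (f : dsum V) (s : seq I) : uniq s ->
  (forall i, i \notin s -> f i = 0) -> dsum_lift f = \sum_(i <- s) h (f i).
Proof.
move=> us fs; rewrite /dsum_lift; case: cid => /= t0 ft0; set t := undup t0.
have ut : uniq t by exact: undup_uniq.
have ft i : i \notin t -> f i = 0 by rewrite mem_undup; apply: ft0.
rewrite (bigID (fun i => i \in s)) /= [X in _ + X]big1 ?addr0; last first.
  by move=> i /fs ->; apply: lin0.
rewrite [RHS](bigID (fun i => i \in t)) /= [X in _ = _ + X]big1 ?addr0; last first.
  by move=> i /ft ->; apply: lin0.
rewrite -big_filter -[RHS]big_filter; apply: perm_big.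
by apply: uniq_perm; rewrite ?filter_uniq // => i; rewrite !mem_filter andbC.
Qed.

Lemma dsum_lift_lin : linear dsum_lift.
Proof.
move=> a f g; have [s hs] := dsum_supp f; have [t ht] := dsum_supp g.
pose u := undup (s ++ t); have uu : uniq u by exact: undup_uniq.
have fu i : i \notin u -> f i = 0 by rewrite mem_undup mem_cat negb_or => /andP [/hs].
have gu i : i \notin u -> g i = 0 by rewrite mem_undup mem_cat negb_or => /andP [_ /ht].
rewrite (dsum_liftE uu fu) (dsum_liftE uu gu) (dsum_liftE uu); last first.
  by move=> i iu; rewrite dsum_linE fu // gu // scaler0 addr0.
rewrite scaler_sumr -big_split; apply: eq_bigr => i _ /=.
exact: lh.
Qed.

Lemma dsum_lift1 (f : dsum V) (i : I) : (forall j, j != i -> f j = 0) ->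
  dsum_lift f = h (f i).
Proof.
move=> hf; rewrite (@dsum_liftE f [:: i]) ?big_seq1 // => j.
by rewrite inE; apply: hf.
Qed.

End DsumLift.

Section CellBasis.
Variables (A : dgAlg) (C : dgBimod A).
Hypothesis dA : forall a : A, dif a = 0.
Local Notation E := (enveloping A).

Lemma enveloping_dif (t : E) : dif t = 0.
Proof.
have [l1 l2] := @tpure_bilin A A.
have lz : linear (fun _ : E => 0 : E) by move=> a u v; rewrite scaler0 addr0.
move: t; apply: (tens_ext (@dif_lin E) lz) => w m.
by rewrite [dif _]dif_tpure !dA (lin0 (l1 m)) (lin0 (l2 w)) addr0.
Qed.

Record layer (S S' : C -> Prop) := Layer {
  lay_I : choiceType;
  lay_n : lay_I -> int;
  lay_q : C -> dsum_bimod (fun j => shift_bimod (lay_n j) E);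
  lay_lin : forall a x y, S' x -> S' y -> lay_q (a *: x + y) = a *: lay_q x + lay_q y;
  lay_dif : forall x, S' x -> lay_q (dif x) = dif (lay_q x);
  lay_lact : forall a x, S' x -> lay_q (lact a x) = lact a (lay_q x);
  lay_ract : forall x a, S' x -> lay_q (ract x a) = ract (lay_q x) a;
  lay_surj : forall y, exists2 x, S' x & lay_q x = y;
  lay_ker : forall x, S' x -> (lay_q x = 0 <-> S x) }.

Arguments lay_q {S S'} _ _.
Arguments lay_n {S S'} _ _.
Arguments lay_surj {S S'} _ _.
Arguments lay_ker {S S'} _ {x} _.

Lemma layer_exists S S' F : (forall x, S' x -> S' (dif x)) ->
  (forall a x, S' x -> S' (lact a x)) -> (forall x a, S' x -> S' (ract x a)) ->
  (forall a x y, S' x -> S' y -> S' (a *: x + y)) ->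
  dg_free F -> subquot_iso S S' F -> exists _ : layer S S', True.
Proof.
move=> Sd Sl Sr Sp [I [n [f [g [[lf df _ alf arf] [lg _ _ _ _] fg gf]]]]].
move=> [q [[ql [qd _]] [qal qar] qs qk]].
have h1 a x y : S' x -> S' y -> f (q (a *: x + y)) = a *: f (q x) + f (q y).
  by move=> Sx Sy; rewrite ql // lf.
have h2 x : S' x -> f (q (dif x)) = dif (f (q x)) by move=> Sx; rewrite qd // df.
have h3 a x : S' x -> f (q (lact a x)) = lact a (f (q x)).
  by move=> Sx; rewrite qal // alf.
have h4 x a : S' x -> f (q (ract x a)) = ract (f (q x)) a.
  by move=> Sx; rewrite qar // arf.
have h5 y : exists2 x, S' x & f (q x) = y.
  by have [x Sx e] := qs (g y); exists x => //; rewrite e gf.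
have h6 x : S' x -> (f (q x) = 0 <-> S x).
  move=> Sx; rewrite -qk //; split=> [e|->]; last exact: lin0.
  by rewrite -[q x]fg e (lin0 lg).
by exists (@Layer S S' I n (fun x => f (q x)) h1 h2 h3 h4 h5 h6).
Qed.

Section Filtration.
Variable S : nat -> C -> Prop.
Hypotheses (S_sub : forall i, sub_bimod (S i)) (S_zero : forall x, S 0%N x <-> x = 0)
  (S_succ : forall i x, S i x -> S i.+1 x) (S_all : forall x, exists i, S i x).
Variable Ly : forall i, layer (S i) (S i.+1).

Local Notation I i := (lay_I (Ly i)).
Local Notation q i := (lay_q (Ly i)).
Local Notation D i := (dsum_bimod (fun j => shift_bimod (lay_n (Ly i) j) E) : dgBimod A).

Lemma S_lin i a x y : S i x -> S i y -> S i (a *: x + y).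
Proof. by have [[_ h] _ _ _ _] := S_sub i; apply: h. Qed.
Lemma S_0 i : S i 0. Proof. by have [[h _] _ _ _ _] := S_sub i. Qed.
Lemma S_lact i a x : S i x -> S i (lact a x).
Proof. by have [_ _ _ h _] := S_sub i; apply: h. Qed.
Lemma S_ract i x a : S i x -> S i (ract x a).
Proof. by have [_ _ _ _ h] := S_sub i; apply: h. Qed.
Lemma S_add i x y : S i x -> S i y -> S i (x + y).
Proof. by move=> Sx Sy; rewrite -[x]scale1r; apply: S_lin. Qed.
Lemma S_mono i j x : (i <= j)%N -> S i x -> S j x.
Proof.
move=> /subnKC <-; elim: (j - i)%N => [|m IH] Sx; first by rewrite addn0.
by rewrite addnS; apply/S_succ/IH.
Qed.

Lemma unit_supp i (j : I i) : exists s : seq (I i), forall j', j' \notin s ->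
  (if j' == j then tpure dgone dgone else 0) = 0 :> (shift_bimod (lay_n (Ly i) j') E : lmodType F2).
Proof. by exists [:: j] => j'; rewrite inE => /negbTE ->. Qed.

Definition unit_at i (j : I i) : dsum (fun j => shift_bimod (lay_n (Ly i) j) E : lmodType F2) :=
  DSum (unit_supp j).

Definition gen i (j : I i) : C := s2val (cid2 (lay_surj (Ly i) (unit_at j))).

Lemma gen_in i (j : I i) : S i.+1 (gen j).
Proof. by rewrite /gen; case: cid2. Qed.
Lemma gen_q i (j : I i) : q i (gen j) = unit_at j.
Proof. by rewrite /gen; case: cid2. Qed.

Lemma mono_q i (j : I i) a b j' :
  dsum_val (q i (lact a (ract (gen j) b))) j' = if j' == j then tpure a b else 0.
Proof.
have Sg := gen_in j; rewrite lay_lact ?lay_ract ?gen_q //; last exact: S_ract.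
transitivity (@lact A E a (@ract A E (if j' == j then tpure dgone dgone else 0) b)) => //.
case: eqP => _; last first.
  by rewrite (lin0 ((ract_bilin E).1 b)) (lin0 ((lact_bilin E).2 a)).
by rewrite [ract _ b](oractE (N := reg_bimod A)) [lact a _](olactE (M := reg_bimod A)) /= dgmul1l dgmul1r.
Qed.

Lemma act_bilin (x : C) : bilinear (fun a b => lact a (ract x b)).
Proof.
split=> [b a c c'|a c b b']; first exact: (lact_bilin C).1.
by rewrite (ract_bilin C).2 (lact_bilin C).2.
Qed.

Section Lift.
Variables (W : lmodType F2) (F : forall i, I i -> A -> A -> W).
Hypothesis bF : forall i (j : I i), bilinear (F j).

Definition top_lift i : D i -> W := dsum_lift (fun j => tlift (F j)).

End Lift.

Lemma top_lift_lin W F : (forall i (j : I i), bilinear (F i j)) ->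
  forall i, linear (@top_lift W F i).
Proof. by move=> bF i; apply: dsum_lift_lin => j; apply: tlift_lin. Qed.

Lemma top_lift_mono W F : (forall i (j : I i), bilinear (F i j)) ->
  forall i (j : I i) a b,
  @top_lift W F i (q i (lact a (ract (gen j) b))) = F i j a b.
Proof.
move=> bF i j a b; rewrite /top_lift (@dsum_lift1 _ _ _ _ _ _ j).
- by rewrite mono_q eqxx tliftE.
- by move=> j'; apply: tlift_lin.
by move=> j' /negbTE nj; rewrite mono_q nj.
Qed.

Definition mono i (j : I i) (a b : A) : C := lact a (ract (gen j) b).
(** A linear section of the projection onto the subquotient: a (x) b in the copy j goes to a gen_j
    b. *)
Definition top i : D i -> C := @top_lift C (@mono) i.

Lemma mono_bilin i (j : I i) : bilinear (mono j).
Proof. exact: act_bilin. Qed.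

Lemma mono_in i (j : I i) a b : S i.+1 (mono j a b).
Proof. exact/S_lact/S_ract/gen_in. Qed.

Lemma tlift_span (P : C -> Prop) (h : A -> A -> C) t : bilinear h -> P 0 ->
  (forall a x y, P x -> P y -> P (a *: x + y)) -> (forall a b, P (h a b)) ->
  P (tlift h t).
Proof.
move=> bh P0 Pl Ph; elim: (tens_span t) => [|a g u [w [m ->]] _ IH].
  by rewrite (lin0 (tlift_lin bh)).
by rewrite tlift_lin // tliftE //; apply: Pl.
Qed.

Lemma top_ind i (P : C -> Prop) (y : D i) : P 0 ->
  (forall a x y, P x -> P y -> P (a *: x + y)) -> (forall (j : I i) a b, P (mono j a b)) ->
  P (top y).
Proof.
move=> P0 Pl Pm; rewrite /top /top_lift /dsum_lift.
elim: (undup _) => [|j s IH]; first by rewrite big_nil.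
rewrite big_cons -[X in P (X + _)]scale1r; apply: (Pl); last exact: IH.
by apply: tlift_span => //; exact: mono_bilin.
Qed.

Lemma top_in i (y : D i) : S i.+1 (top y).
Proof. by apply: top_ind => [|a u v|j a b]; [exact: S_0|exact: S_lin|exact: mono_in]. Qed.

Lemma tmono_in i (j : I i) t : S i.+1 (tlift (mono j) t).
Proof.
apply: tlift_span; [exact: mono_bilin|exact: S_0| |exact: mono_in].
by move=> *; apply: S_lin.
Qed.

Lemma q_mono i (j : I i) (t : E) j' :
  dsum_val (q i (tlift (mono j) t)) j' = if j' == j then t else 0.
Proof.
have lm : linear (tlift (mono j)) := tlift_lin (mono_bilin j).
have Sm := tmono_in j.
move: t; apply: tens_ext => [a u v|a u v|a b].
- by rewrite lm lay_lin.
- by case: ifP => // _; rewrite scaler0 addr0.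
by rewrite tliftE ?mono_q //; exact: mono_bilin.
Qed.

Lemma q_top i (y : D i) : q i (top y) = y.
Proof.
have [s hs] := dsum_supp y; pose u := undup s.
have uu : uniq u by exact: undup_uniq.
have hu j : j \notin u -> dsum_val y j = 0 by rewrite mem_undup; apply: hs.
have lt j : linear (tlift (@mono i j)) by apply: tlift_lin; exact: mono_bilin.
rewrite /top /top_lift (dsum_liftE lt uu hu); apply: dsumP => j'.
have -> : q i (\sum_(j <- u) tlift (mono j) (dsum_val y j)) =
    \sum_(j <- u) q i (tlift (mono j) (dsum_val y j)).
  elim: (u) => [|j t IH].
    by rewrite !big_nil; apply/(lay_ker (Ly i)); exact: S_0.
  rewrite !big_cons -[tlift _ _]scale1r lay_lin ?scale1r ?IH //; first exact: tmono_in.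
  elim: (t) => [|l t' IHt]; first by rewrite big_nil; apply: S_0.
  by rewrite big_cons; apply: S_add => //; apply: tmono_in.
rewrite dsum_sumE; under eq_bigr do rewrite q_mono.
have [ju|ju] := boolP (j' \in u); last first.
  rewrite hu // big_seq big1 // => j jt; case: eqP => // e.
  by rewrite e jt in ju.
rewrite (bigD1_seq j') //= eqxx big1 ?addr0 // => j.
by rewrite eq_sym => /negbTE ->.
Qed.

Lemma top_lin i : linear (@top i).
Proof. by apply: top_lift_lin => i' j; apply: mono_bilin. Qed.

Lemma sub_top i c : S i.+1 c -> S i (c - top (q i c)).
Proof.
move=> Sc; rewrite oppxx -[c]scale1r.
apply/(lay_ker (Ly i)); first by apply: S_lin => //; apply: top_in.
rewrite lay_lin //; last exact: top_in.
by rewrite !scale1r q_top addxx.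
Qed.

Lemma q_lower i c : S i c -> q i c = 0.
Proof. by move=> Sc; apply/(lay_ker (Ly i)) => //; apply: S_succ. Qed.

Section LiftUpto.
Variables (W : lmodType F2) (F : forall i, I i -> A -> A -> W).
Hypothesis bF : forall i (j : I i), bilinear (F j).

(** Subtracting the section of its top component moves c one filtration step down, so an element of
    [S i] is exhausted after i steps. *)
Fixpoint lift_upto (i : nat) (c : C) : W :=
  if i is i'.+1 then @top_lift W F i' (q i' c) + lift_upto i' (c - top (q i' c)) else 0.

Lemma lift_upto_lin i a x y : S i x -> S i y ->
  lift_upto i (a *: x + y) = a *: lift_upto i x + lift_upto i y.
Proof.
elim: i x y => [|i IH] x y Sx Sy /=; first by rewrite scaler0 addr0.
rewrite lay_lin // (top_lift_lin bF) !(top_lin) scalerDr addrACA; congr (_ + _).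
rewrite -IH; [|exact: sub_top|exact: sub_top].
by congr lift_upto; rewrite scalerBr opprD addrACA.
Qed.

Lemma lift_upto0 i : lift_upto i 0 = 0.
Proof.
have := @lift_upto_lin i 1 0 0 (S_0 i) (S_0 i).
by rewrite !scale1r addr0 addxx.
Qed.

Lemma lift_upto_succ i c : S i c -> lift_upto i.+1 c = lift_upto i c.
Proof.
move=> Sc /=; rewrite q_lower // (lin0 (@top_lift_lin W F bF i)) (lin0 (@top_lin i)).
by rewrite subr0 add0r.
Qed.

Lemma lift_upto_mono i j c : (i <= j)%N -> S i c -> lift_upto j c = lift_upto i c.
Proof.
move=> /subnKC <- Sc; elim: (j - i)%N => [|m IH]; first by rewrite addn0.
by rewrite addnS lift_upto_succ ?IH //; apply: S_mono Sc; apply: leq_addr.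
Qed.

Definition lift_all (c : C) : W := lift_upto (sval (cid (S_all c))) c.

Lemma lift_allE i c : S i c -> lift_all c = lift_upto i c.
Proof.
move=> Sc; rewrite /lift_all; case: cid => j Sj /=.
have [ij|/ltnW ji] := leqP i j; first exact: lift_upto_mono.
by apply/esym/lift_upto_mono.
Qed.

Lemma lift_all_lin : linear lift_all.
Proof.
move=> a x y; have [i Sx] := S_all x; have [j Sy] := S_all y.
have Sx' := S_mono (leq_maxl i j) Sx; have Sy' := S_mono (leq_maxr i j) Sy.
rewrite (lift_allE Sx') (lift_allE Sy') (lift_allE (S_lin a Sx' Sy')).
exact: lift_upto_lin.
Qed.

Lemma lift_all_mono i (j : I i) a b : lift_all (mono j a b) = F j a b.
Proof.
rewrite (lift_allE (mono_in j a b)) /= (top_lift_mono bF).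
rewrite /top (top_lift_mono mono_bilin) subrr.
by rewrite lift_upto0 addr0.
Qed.

End LiftUpto.

Definition mono_lt (i : nat) (z : C) : Prop :=
  exists (l : {i : nat & I i}) a b, (tag l < i)%N /\ z = mono (tagged l) a b.

Lemma mono_lt_span i c : S i c -> span (mono_lt i) c.
Proof.
elim: i c => [|i IH] c Sc; first by move/S_zero: Sc => ->; apply: span0.
rewrite -[c](subrK (top (q i c))); apply: spanD.
  apply: (span_map (f := id)) (IH _ (sub_top Sc)) => // z [l [a [b [li ->]]]].
  by apply: span_gen; exists l, a, b; rewrite ltnW.
apply: top_ind => [|a x y|j a b]; first exact: span0.
  exact: span_lin.
by apply: span_gen; exists (existT _ i j), a, b.
Qed.

(** The subquotient is a sum of shifts of A^e and has zero differential because A has; so the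
    differential of a generator dies there. *)
Lemma gen_dif i (j : I i) : S i (dif (gen j)).
Proof.
have Sg := gen_in j.
have Sd : S i.+1 (dif (gen j)) by have [_ h _ _ _] := S_sub i.+1; apply: h.
apply/(lay_ker (Ly i)) => //; rewrite lay_dif // gen_q.
by apply: dsumP => j'; apply: enveloping_dif.
Qed.

End Filtration.

(** Extensions by free bimodules split once the differential is forgotten, so C is then free.
    Freeness is expressed by extension of bilinear maps, the form in which it serves to build
    functionals and operators. *)
Lemma cell_basis : cell C -> exists (Lam : Type) (g : Lam -> C) (rk : Lam -> nat),
  [/\ forall c, span (fun z => exists l a b, z = lact a (ract (g l) b)) c,
      forall (W : lmodType F2) (F : Lam -> A -> A -> W), (forall l, bilinear (F l)) ->
        exists2 L : C -> W, linear L & forall l a b, L (lact a (ract (g l) b)) = F l a b &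
      forall l, span (fun z => exists l' a b, (rk l' < rk l)%N /\
        z = lact a (ract (g l') b)) (dif (g l))].
Proof.
case=> S [S_sub S_zero S_succ S_free] S_all.
have ly i : exists _ : layer (S i) (S i.+1), True.
  have [[_ Sl] Sd _ Sla Sra] := S_sub i.+1; have [F Ff Fq] := S_free i.
  exact: layer_exists Ff Fq.
pose Ly i := sval (cid (ly i)).
exists {i : nat & lay_I (Ly i)}, (fun l => gen (tagged l)), (fun l => tag l).
split=> [c|W F bF|[i j]].
- have [i Sc] := S_all c.
  have := mono_lt_span S_sub S_zero Ly Sc; move: c {Sc} => c.
  apply: (span_map (f := id)) => // z [l [a [b [_ ->]]]].
  by apply: span_gen; exists l, a, b.
- pose F' i (j : lay_I (Ly i)) := F (existT _ i j).
  exists (lift_all S_all F'); first by apply: lift_all_lin => // i j; apply: bF.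
  by move=> [i j] a b; apply: (lift_all_mono S_sub S_succ S_all (F := F')) => ? ?; apply: bF.
by apply: mono_lt_span => //; apply: gen_dif.
Qed.

End CellBasis.

(** * The cyclic tensor square *)

Section TensorSpan.
Variables (A : dgAlg) (M N : dgBimod A).

Lemma tA_span (t : tensA M N) : span (fun z => exists x y, z = tA x y) t.
Proof.
elim/quotP: t => t; apply: (span_map (@qpi_lin _ _)) (tens_span t).
by move=> _ [x [y ->]]; apply: span_gen; exists x, y.
Qed.

Lemma hc_span (v : hc_cplx M N) : span (fun z => exists x y, z = hcpure x y) v.
Proof.
elim/quotP: v => t; apply: (span_map (@qpi_lin _ _)) (tens_span t).
by move=> _ [x [y ->]]; apply: span_gen; exists x, y.
Qed.

Lemma tA_cmp n i (x : M) (y : N) : hom i x -> cmp n (tA x y) = tA x (cmp (n - i) y).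
Proof. by move=> hx; rewrite [LHS]cmp_qpi [cmp n _](cmp_tpure _ _ hx). Qed.

Lemma hcpure_cmp n i (x : M) (y : N) : hom i x ->
  cmp n (hcpure x y) = hcpure x (cmp (n - i) y).
Proof. by move=> hx; rewrite [LHS]cmp_qpi (cmp_tpure _ _ hx). Qed.

End TensorSpan.

Section CyclicTensor.
Variables (A : dgAlg) (C M : dgBimod A).
Local Notation T := (tensA M C).
Local Notation Y := (hc_cplx C (derived_square C M)).

(** The element r (x) (m' (x) r' (x) m) of HC is the cyclic word m' r' m r. Reading it as the pair
    of t = m' (x) r' and u = m (x) r makes [tau] the exchange of t and u. *)
Definition cform (t : T) : T -> Y :=
  tA_lift (fun (m : M) (r : C) => hcpure (N := derived_square C M) r (tA t m)).

Let t1 := (@tA_bilin A T M).1.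
Let t2 := (@tA_bilin A T M).2.
Let h1 := (@hcpure_bilin A C (derived_square C M)).1.
Let h2 := (@hcpure_bilin A C (derived_square C M)).2.

Lemma cform_pre_bilin t :
  bilinear (fun (m : M) (r : C) => hcpure (N := derived_square C M) r (tA t m)).
Proof. by split=> [r a m m'|m]; rewrite ?t2 ?h2 //; apply: h1. Qed.

Lemma cform_pre_bal t (m : M) a (r : C) :
  hcpure (N := derived_square C M) r (tA t (ract m a)) =
  hcpure (N := derived_square C M) (lact a r) (tA t m).
Proof. by rewrite hcpure_cyc tA_ract. Qed.

Lemma cformE t m r : cform t (tA m r) = hcpure (N := derived_square C M) r (tA t m).
Proof. exact: tA_liftE (cform_pre_bilin t) (cform_pre_bal t) _ _. Qed.

Lemma cform_linr t : linear (cform t).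
Proof. exact: tA_lift_lin (cform_pre_bilin t) (cform_pre_bal t). Qed.

Lemma cform_bilin : bilinear cform.
Proof.
split=> [u a t t'|]; last exact: cform_linr.
move: u; apply: tA_ext; first exact: cform_linr.
  by apply: comb_lin; apply: cform_linr.
by move=> m r; rewrite !cformE t1 h2.
Qed.

Lemma cform_ract t a u : cform (ract t a) u = cform t (lact a u).
Proof.
move: u; apply: tA_ext => [|b u v|m r]; first exact: cform_linr.
  by rewrite (lact_bilin T).2 cform_linr.
by rewrite tA_lact !cformE tA_bal.
Qed.

Lemma cform_lact t a u : cform (lact a t) u = cform t (ract u a).
Proof.
move: u; apply: tA_ext => [|b u v|m r]; first exact: cform_linr.
  by rewrite (ract_bilin T).1 cform_linr.
by rewrite tA_ract !cformE hcpure_bal tA_lact.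
Qed.

Lemma tau_cform t u : tau (cform t u) = cform u t.
Proof.
move: t; apply: tA_ext => [a t t'||m r].
- by rewrite cform_bilin.1 tau_lin.
- exact: cform_linr.
move: u; apply: tA_ext => [a u u'|a u u'|m' r'].
- by rewrite cform_linr tau_lin.
- by rewrite cform_bilin.1.
by rewrite !cformE tauE.
Qed.

Lemma dif_cform t u : dif (cform t u) = cform (dif t) u + cform t (dif u).
Proof.
move: u; apply: tA_ext => [a u u'|a u u'|m r].
- by rewrite cform_linr dif_lin.
- by rewrite dif_lin !cform_linr scalerDr addrACA.
rewrite cformE dif_hc dif_tA dif_tA (linD (h2 _)) (linD (cform_linr _)) !cformE.
by rewrite addrC -addrA; congr (_ + _).
Qed.

Lemma cform_span v : span (fun z => exists t u, z = cform t u) v.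
Proof.
elim: (hc_span v) => [|a g w [r [d ->]] _ IH]; first exact: span0.
apply: span_lin IH; elim: (tA_span d) => [|b g' d' [t [m ->]] _ IH].
  by rewrite (lin0 (h2 r)); apply: span0.
by rewrite h2; apply: span_lin IH; apply: span_gen; exists t, (tA m r); rewrite cformE.
Qed.

Lemma cform_ext (W : lmodType F2) (f g : Y -> W) : linear f -> linear g ->
  (forall t u, f (cform t u) = g (cform t u)) -> forall v, f v = g v.
Proof.
move=> lf lg h v; apply: (span_ext lf lg _ (cform_span v)) => _ [t [u ->]].
exact: h.
Qed.

(** The two rules for moving an element of A around the cyclic word present HC completely. This
    yields both functoriality and the functionals that detect squares. *)
Lemma cform_univ (W : lmodType F2) (P : T -> T -> W) : bilinear P ->
  (forall t a u, P (ract t a) u = P t (lact a u)) ->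
  (forall t a u, P (lact a t) u = P t (ract u a)) ->
  exists2 L : Y -> W, linear L & forall t u, L (cform t u) = P t u.
Proof.
move=> [P1 P2] Pr Pl; have m1 := (@tA_bilin A M C).1; have m2 := (@tA_bilin A M C).2.
pose F r (t : T) (m : M) := P t (tA m r).
have bF r : bilinear (F r).
  by split=> [m a t t'|t a m m']; rewrite /F ?P1 ?m1 ?P2.
have Fb r t a m : F r (ract t a) m = F r t (lact a m).
  by rewrite /F Pr tA_lact.
pose G r (d : derived_square C M) := tA_lift (F r) d.
have GE r t m : G r (tA t m) = P t (tA m r) by rewrite /G tA_liftE.
have Gl r : linear (G r) by apply: tA_lift_lin.
have bG : bilinear G.
  split=> [d a r r'|//]; move: d; apply: tA_ext => [//||t m]; first exact: comb_lin.
  by rewrite !GE m2 P2.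
have Gb r a d : G (ract r a) d = G r (lact a d).
  move: d; apply: tA_ext => [//|b x y|t m]; first by rewrite (lact_bilin _).2 Gl.
  by rewrite tA_lact !GE Pl tA_ract.
have Gc r a d : G (lact a r) d = G r (ract d a).
  move: d; apply: tA_ext => [//|b x y|t m]; first by rewrite (ract_bilin _).1 Gl.
  by rewrite tA_ract !GE tA_bal.
exists (hc_lift G); first exact: hc_lift_lin.
move=> t u; move: u; apply: tA_ext => [a x y||m r].
- by rewrite cform_linr (hc_lift_lin bG Gb Gc).
- exact: P2.
by rewrite cformE (hc_liftE bG Gb Gc) GE.
Qed.

Lemma cform_cmp n i (t u : T) : hom i t -> cmp n (cform t u) = cform t (cmp (n - i) u).
Proof.
move=> ht; move: u; apply: tA_ext => [a x y|a x y|m r].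
- by rewrite cform_linr cmp_lin.
- by rewrite cmp_lin cform_linr.
move: m; apply: hom_ind => [|a x y ex ey|k m hm].
- by rewrite (lin0 ((@tA_bilin A M C).1 r)) !(lin0 (@cmp_lin _ _), lin0 (cform_linr t)).
- by rewrite (@tA_bilin A M C).1 !(cmp_lin, cform_linr) ex ey.
rewrite (tA_cmp _ _ hm) !cformE.
move: r; apply: hom_ind => [|a x y ex ey|l r hr].
- by rewrite (lin0 (h1 _)) !(lin0 (@cmp_lin _ _)) (lin0 (h1 _)).
- by rewrite h1 !cmp_lin h1 ex ey.
rewrite (hcpure_cmp _ _ hr) (tA_cmp _ _ ht) (cmp_hom _ hm) (cmp_hom _ hr).
have -> : (n - l - i == k) = (n - i - k == l) by rewrite !subr_eq (addrC l) (addrAC k).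
by case: eqP => _ //; rewrite (lin0 (t2 _)) (lin0 (h2 _)) (lin0 (h1 _)).
Qed.

Lemma cform_hom i j (t u : T) : hom i t -> hom j u -> hom (i + j) (cform t u).
Proof. by move=> ht hu; rewrite /hom (cform_cmp _ _ ht) addrC addKr hu. Qed.

Lemma tau_cmp n (v : Y) : tau (cmp n v) = cmp n (tau v).
Proof.
move: v; apply: cform_ext => [a x y|a x y|t u].
- by rewrite cmp_lin tau_lin.
- by rewrite tau_lin cmp_lin.
move: t; apply: hom_ind => [|a x y ex ey|i t ht].
- by rewrite (lin0 (cform_bilin.1 u)) !(lin0 (@cmp_lin _ _), lin0 (@tau_lin _ _ _)).
- by rewrite cform_bilin.1 !(cmp_lin, tau_lin) ex ey.
move: u; apply: hom_ind => [|a x y ex ey|j u hu].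
- by rewrite (lin0 (cform_linr t)) !(lin0 (@cmp_lin _ _), lin0 (@tau_lin _ _ _)).
- by rewrite cform_linr !(cmp_lin, tau_lin) ex ey.
rewrite tau_cform (cmp_hom _ (cform_hom ht hu)) (cmp_hom _ (cform_hom hu ht)) (addrC j).
by case: eqP => _; rewrite ?tau_cform // (lin0 (@tau_lin _ _ _)).
Qed.

End CyclicTensor.

(** * Functoriality in the second bimodule *)

Section Functoriality.
Variables (A : dgAlg) (M : dgBimod A).

Definition tA_map (C D : dgBimod A) (f : C -> D) : tensA M C -> tensA M D :=
  tA_lift (fun m r => tA m (f r)).

Section Map.
Variables (C D : dgBimod A) (f : C -> D).
Hypothesis df : dgmap f.

Let t1 := (@tA_bilin A M D).1.
Let t2 := (@tA_bilin A M D).2.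

Let pre_bilin : bilinear (fun (m : M) (r : C) => tA m (f r)).
Proof. by case: df => lf _ _ _ _; split=> [r a m m'|m a r r']; rewrite ?t1 ?lf ?t2. Qed.

Let pre_bal (m : M) a (r : C) : tA (ract m a) (f r) = tA m (f (lact a r)).
Proof. by case: df => _ _ _ fl _; rewrite fl tA_bal. Qed.

Lemma tA_mapE m r : tA_map f (tA m r) = tA m (f r).
Proof. exact: tA_liftE pre_bilin pre_bal _ _. Qed.

Lemma tA_map_lin : linear (tA_map f).
Proof. exact: tA_lift_lin pre_bilin pre_bal. Qed.

Lemma tA_map_lact a t : tA_map f (lact a t) = lact a (tA_map f t).
Proof.
move: t; apply: tA_ext => [b x y|b x y|m r].
- by rewrite (lact_bilin _).2 tA_map_lin.
- by rewrite tA_map_lin (lact_bilin _).2.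
by rewrite tA_lact !tA_mapE tA_lact.
Qed.

Lemma tA_map_ract t a : tA_map f (ract t a) = ract (tA_map f t) a.
Proof.
case: df => _ _ _ _ fr; move: t; apply: tA_ext => [b x y|b x y|m r].
- by rewrite (ract_bilin _).1 tA_map_lin.
- by rewrite tA_map_lin (ract_bilin _).1.
by rewrite tA_ract !tA_mapE fr tA_ract.
Qed.

Lemma tA_map_dif t : tA_map f (dif t) = dif (tA_map f t).
Proof.
case: df => _ fd _ _ _; move: t; apply: tA_ext => [b x y|b x y|m r].
- by rewrite dif_lin tA_map_lin.
- by rewrite tA_map_lin dif_lin.
by rewrite tA_mapE !dif_tA (linD tA_map_lin) !tA_mapE fd.
Qed.

End Map.

Local Notation Y C := (hc_cplx C (derived_square C M)).

Lemma hc_map_exists (C D : dgBimod A) (f : C -> D) : dgmap f ->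
  exists F : Y C -> Y D, [/\ linear F, forall v, F (dif v) = dif (F v),
    forall v, F (tau v) = tau (F v) &
    forall t u, F (cform t u) = cform (tA_map f t) (tA_map f u)].
Proof.
move=> df; have lf := tA_map_lin df.
have [F lF FE] : exists2 F : Y C -> Y D, linear F &
    forall t u, F (cform t u) = cform (tA_map f t) (tA_map f u).
  apply: cform_univ => [|t a u|t a u].
  - split=> [u a t t'|t a u u']; rewrite lf; last exact: cform_linr.
    exact: (@cform_bilin A D M).1.
  - by rewrite tA_map_ract // tA_map_lact // cform_ract.
  by rewrite tA_map_ract // tA_map_lact // cform_lact.
exists F; split=> // v; move: v; apply: cform_ext => [a x y|a x y|t u].
- by rewrite dif_lin lF.
- by rewrite lF dif_lin.
- by rewrite FE !dif_cform (linD lF) !FE !tA_map_dif.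
- by rewrite tau_lin lF.
- by rewrite lF tau_lin.
by rewrite FE !tau_cform FE.
Qed.

End Functoriality.

(** * Invariants of the cyclic square over a cell bimodule *)

Section CellForm.
Variables (A : dgAlg) (C M : dgBimod A) (Lam : Type) (g : Lam -> C) (rk : Lam -> nat).
Hypothesis dA : forall a : A, dif a = 0.
Hypotheses
  (g_span : forall c, span (fun z => exists l a b, z = lact a (ract (g l) b)) c)
  (g_univ : forall (W : lmodType F2) (F : Lam -> A -> A -> W), (forall l, bilinear (F l)) ->
     exists2 L : C -> W, linear L & forall l a b, L (lact a (ract (g l) b)) = F l a b)
  (g_dif : forall l, span (fun z => exists l' a b, (rk l' < rk l)%N /\
     z = lact a (ract (g l') b)) (dif (g l))).
Local Notation T := (tensA M C).
Local Notation Y := (hc_cplx C (derived_square C M)).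
Local Notation B := (@cform A C M).
Local Notation comm := (@comm A T lact ract).

Definition cell_pr (l : Lam) (m : M) (w : A) : T := tA m (ract (g l) w).

Let t1 := (@tA_bilin A M C).1.
Let t2 := (@tA_bilin A M C).2.

Lemma cell_pr_bilin l : bilinear (cell_pr l).
Proof.
by split=> [w a m m'|m a w w']; rewrite /cell_pr ?(ract_bilin C).2 ?t1 ?t2.
Qed.

Lemma cell_la_pr a l m w : lact a (cell_pr l m w) = cell_pr l (lact a m) w.
Proof. exact: tA_lact. Qed.

Lemma cell_ra_pr l m w a : ract (cell_pr l m w) a = cell_pr l m (dgmul w a).
Proof. by rewrite tA_ract ractA. Qed.

Lemma cell_pr_span t : span (fun z => exists l m w, z = cell_pr l m w) t.
Proof.
elim: (tA_span t) => [|b z u [m [c ->]] _ IH]; first exact: span0.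
apply: span_lin IH; apply: (span_map (t2 m)) (g_span c) => _ [l [a [w ->]]].
by apply: span_gen; exists l, (ract m a), w; rewrite -tA_bal.
Qed.

Lemma cell_pr_univ (W : lmodType F2) (F : Lam -> M -> A -> W) :
  (forall l, bilinear (F l)) ->
  exists2 L : T -> W, linear L & forall l m w, L (cell_pr l m w) = F l m w.
Proof.
move=> bF; have ex m : exists L : C -> W, linear L /\
    forall l a b, L (lact a (ract (g l) b)) = F l (ract m a) b.
  case: (g_univ (F := fun l a b => F l (ract m a) b)) => [l|L]; last by exists L.
  split=> [b c a a'|a c b b']; first by rewrite (ract_bilin M).2 (bF l).1.
  exact: (bF l).2.
have [L hL] := choice ex.
have lL m := (hL m).1; have LE m := (hL m).2.
have bL : bilinear L.
  split=> [c a m m'|//].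
  apply: (span_ext (lL (a *: m + m')) (comb_lin a (lL m) (lL m')) _ (g_span c)).
  by move=> _ [l [a' [b ->]]]; rewrite !LE (ract_bilin M).1 (bF l).1.
have Lb m x c : L (ract m x) c = L m (lact x c).
  have lx : linear (fun c => L m (lact x c)).
    by move=> a u v; rewrite (lact_bilin C).2 lL.
  apply: (span_ext (lL (ract m x)) lx _ (g_span c)).
  by move=> _ [l [a [b ->]]]; rewrite lactA !LE ractA.
exists (tA_lift L); first exact: tA_lift_lin.
by move=> l m w; rewrite /cell_pr tA_liftE // -[ract _ w]lact1 LE ract1.
Qed.

Lemma cell_triangular l m w :
  fil cell_pr rk (rk l) (dif (cell_pr l m w) + cell_pr l (dif m) w).
Proof.
have -> : dif (cell_pr l m w) + cell_pr l (dif m) w = tA m (ract (dif (g l)) w).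
  rewrite dif_tA ract_dif dA (lin0 ((ract_bilin C).2 _)) addr0 addrAC addxx.
  by rewrite add0r.
apply: (span_map (f := fun c => tA m (ract c w))) (g_dif l).
  by move=> a u v; rewrite (ract_bilin C).1 t2.
move=> _ [l' [a [b [ll' ->]]]]; apply: span_gen; exists l', (ract m a), (dgmul b w).
by split=> //; rewrite /cell_pr lractC ractA tA_bal.
Qed.

Local Notation J := (@fold A T M lact Lam cell_pr (lact_bilin M) cell_pr_bilin cell_pr_univ).
Let JE := foldE (lact_bilin M) cell_pr_bilin cell_pr_univ.
Let lJ := fold_lin (lact_bilin M) cell_pr_bilin cell_pr_univ.

Lemma cell_comm_fold t : comm (t + J t).
Proof.
exact: (comm_fold _ _ cell_la_pr cell_ra_pr cell_pr_span).
Qed.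

Lemma cell_fold_comm t : comm t -> J t = 0.
Proof.
exact: (fold_comm (lact_bilin T) (ract_bilin T) _ (@lactA A M) _ cell_la_pr cell_ra_pr cell_pr_span).
Qed.

(** Unlike [B], this form depends only on classes modulo [A, T], as [symmetric_square] requires. On
    the diagonal it differs from [B] by elements of the image of 1 + [tau]. *)
Definition folded_form t u := B (J t) (J u).

(** Moving w and w' around the cyclic word turns B(m g w, m' g' w') into B(w' m g, w m' g'), a value
    of the folded form: whence the exchange of w and w' in the witnesses. *)
Lemma folded_form_span v : span (fun w => exists t u, w = folded_form t u) v.
Proof.
elim: (cform_span v) => [|a z u [t [t' ->]] _ IH]; first exact: span0.
apply: span_lin IH; move: t'; have [b1 b2] := @cform_bilin A C M.
elim: (cell_pr_span t) => [|b z' t0 [l [m [w ->]]] _ IH] t'.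
  by rewrite (lin0 (b1 _)); apply: span0.
rewrite b1; apply: span_lin (IH _); elim: (cell_pr_span t') => [|c z'' t1' [l' [m' [w' ->]]] _ IH'].
  by rewrite (lin0 (b2 _)); apply: span0.
rewrite b2; apply: span_lin IH'; apply: span_gen.
exists (cell_pr l m w'), (cell_pr l' m' w); rewrite /folded_form !JE.
have -> : cell_pr l m w = ract (cell_pr l m dgone) w by rewrite cell_ra_pr dgmul1l.
rewrite cform_ract cell_la_pr.
have -> : cell_pr l' (lact w m') w' = ract (cell_pr l' (lact w m') dgone) w'.
  by rewrite cell_ra_pr dgmul1l.
by rewrite -cform_lact cell_la_pr.
Qed.

Lemma fun_comm (l : T -> F2^o) : linear l ->
  (forall z, @comm_gen A T lact ract z -> l z = 0) -> forall t a, l (ract t a) = l (lact a t).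
Proof.
move=> ll lZ t a; apply: addr_eq2; rewrite -(linD ll); apply: lZ.
by exists a, t; rewrite addrC.
Qed.

(* On generators the functional is
   (pr l m w, pr l' m' w') |-> l (pr l (w' m) 1) * l' (pr l' (w m') 1); w and w'
   are separated from m and m' by the map split. *)
Lemma folded_form_dual (l l' : T -> F2^o) : linear l -> linear l' ->
  (forall z, @comm_gen A T lact ract z -> l z = 0) ->
  (forall z, @comm_gen A T lact ract z -> l' z = 0) ->
  exists2 P : Y -> F2^o, linear P & forall t u, P (folded_form t u) = l t * l' u.
Proof.
move=> ll ll' lZ lZ'; have [p1 p2] := @tpure_bilin T A.
have [split lsp spE] : exists2 S : T -> tens T A, linear S &
    forall i m w, S (cell_pr i m w) = tpure (cell_pr i m dgone) w.
  apply: (cell_pr_univ (F := fun i m w => tpure (cell_pr i m dgone) w)) => i.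
  by split=> [w a m m'|m a w w']; rewrite ?(cell_pr_bilin i).1 ?p1 ?p2.
pose F s w s' w' : F2^o := l (lact w' s) * l' (lact w s').
have bF s w : bilinear (F s w).
  split=> [w' a u v|s' a u v]; rewrite /F.
    by rewrite (lact_bilin T).2 ll' mulrDr scalerAr.
  by rewrite (lact_bilin T).1 ll mulrDl scalerAl.
pose G s w := tlift (F s w).
have lG s w : linear (G s w) by apply: tlift_lin.
have GE s w s' w' : G s w (tpure s' w') = F s w s' w' by rewrite /G tliftE.
have bG v : bilinear (fun s w => G s w v).
  split=> [w a s s'|s a w w']; move: v; apply: tens_ext => [//||s2 w2].
  - exact: comb_lin.
  - by rewrite !GE /F (lact_bilin T).2 ll mulrDl scalerAl.
  - exact: comb_lin.
  by rewrite !GE /F (lact_bilin T).1 ll' mulrDr scalerAr.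
pose P t u := tlift (fun s w => G s w (split u)) (split t).
have PE i m w i' m' w' : P (cell_pr i m w) (cell_pr i' m' w') =
    l (cell_pr i (lact w' m) dgone) * l' (cell_pr i' (lact w m') dgone).
  by rewrite /P !spE tliftE // GE /F !cell_la_pr.
have bP : bilinear P.
  split=> [u a t t'|t a u u']; rewrite /P; first by rewrite lsp tlift_lin.
  move: (split t); apply: tens_ext => [||s w]; first exact: tlift_lin.
    by apply: comb_lin; apply: tlift_lin.
  by rewrite !tliftE // lsp lG.
have ext (f f' : T -> T -> F2^o) : bilinear f -> bilinear f' ->
    (forall i m w i' m' w', f (cell_pr i m w) (cell_pr i' m' w') =
       f' (cell_pr i m w) (cell_pr i' m' w')) -> forall t u, f t u = f' t u.
  move=> bf bf' h t u; apply: (span_ext (bf.1 u) (bf'.1 u) _ (cell_pr_span t)).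
  move=> _ [i [m [w ->]]].
  apply: (span_ext (bf.2 _) (bf'.2 _) _ (cell_pr_span u)) => _ [i' [m' [w' ->]]].
  exact: h.
have lact_l a : linear (fun t : T => lact a t) := (lact_bilin T).2 a.
have ract_l a : linear (fun t : T => ract t a) := (ract_bilin T).1 a.
have Pr t a u : P (ract t a) u = P t (lact a u).
  apply: (ext (fun t u => P (ract t a) u) (fun t u => P t (lact a u))).
  - by split=> [v b x y|v b x y]; rewrite ?ract_l ?bP.1 ?bP.2.
  - by split=> [v b x y|v b x y]; rewrite ?lact_l ?bP.1 ?bP.2.
  by move=> i m w i' m' w'; rewrite cell_ra_pr cell_la_pr !PE lactA.
have Pl t a u : P (lact a t) u = P t (ract u a).
  apply: (ext (fun t u => P (lact a t) u) (fun t u => P t (ract u a))).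
  - by split=> [v b x y|v b x y]; rewrite ?lact_l ?bP.1 ?bP.2.
  - by split=> [v b x y|v b x y]; rewrite ?ract_l ?bP.1 ?bP.2.
  by move=> i m w i' m' w'; rewrite cell_ra_pr cell_la_pr !PE lactA.
have [L lL LE] := cform_univ bP Pr Pl; exists L => // t u.
have lfold (k : T -> F2^o) : linear k -> (forall z, @comm_gen A T lact ract z -> k z = 0) ->
    forall i m w, k (cell_pr i (lact w m) dgone) = k (cell_pr i m w).
  by move=> lk kZ i m w; rewrite -cell_la_pr -(fun_comm lk kZ) cell_ra_pr dgmul1l.
apply: (ext (fun t u => L (folded_form t u)) (fun t u => l t * l' u)) => [||i m w i' m' w'].
- by split=> [v b x y|v b x y]; rewrite /folded_form lJ LE ?bP.1 ?bP.2 -!LE.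
- split=> [v b x y|v b x y]; first by rewrite ll mulrDl scalerAl.
  by rewrite ll' mulrDr scalerAr.
by rewrite /folded_form LE !JE PE !lact1 !lfold.
Qed.

Let tD (x y : Y) : tau (x + y) = tau x + tau y.
Proof. exact: (linD (@tau_lin A C M)). Qed.

(** The squares of a t and of t a are both B(t, a t a), so they cancel in the square of a commutator
    and leave the cross term and its image under [tau]. *)
Lemma comm_square t : comm t -> exists z, B t t = z + tau z.
Proof.
have [b1 b2] := @cform_bilin A C M.
elim=> [|b z0 u [a [t0 ->]] _ [z ez]].
  by exists 0; rewrite (lin0 (b1 _)) (lin0 (@tau_lin A C M)) addr0.
set s := lact a t0 + ract t0 a; have [b0|b1'] := F2_cases b.
  by exists z; rewrite b0 scale0r add0r.
have es : B s s = B (lact a t0) (ract t0 a) + tau (B (lact a t0) (ract t0 a)).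
  rewrite /s (square_add (@cform_bilin A C M) (@tau_cform A C M)).
  have -> : B (lact a t0) (lact a t0) = B (ract t0 a) (ract t0 a).
    by rewrite cform_lact cform_ract lractC.
  by rewrite addxx add0r.
exists (B (lact a t0) (ract t0 a) + z + B s u).
rewrite b1' scale1r (square_add (@cform_bilin A C M) (@tau_cform A C M)) es ez !tD.
rewrite -!addrA; congr (_ + _).
by rewrite [LHS](AC (1*(1*(1*(1*1)))) (2*(4*(1*(3*5)))))%AC.
Qed.

Lemma comm_square_eq t u : comm (t + u) -> exists z, B t t = B u u + (z + tau z).
Proof.
move=> /comm_square [z ez]; exists (z + B (t + u) u).
have -> : t = (t + u) + u by rewrite -addrA addxx addr0.
rewrite (square_add (@cform_bilin A C M) (@tau_cform A C M)).
have -> : t + u + u + u = t + u by rewrite -addrA addxx addr0.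
by rewrite ez tD [LHS](AC ((2*1)*2) (3*((1*4)*(2*5))))%AC.
Qed.

Lemma cell_symmetric (v : Y) : tau v = v -> exists t u, v = B t t + (u + tau u).
Proof.
move=> sv; have [|||||t [u ->]] := @symmetric_square T Y (@comm_gen A T lact ract)
    folded_form (@tau A C M) _ _ _ _ _ folded_form_span folded_form_dual v sv.
- split=> [u a t t'|t a u u']; rewrite /folded_form lJ; last exact: cform_linr.
  exact: (@cform_bilin A C M).1.
- move=> z t Zz; rewrite /folded_form (cell_fold_comm (span_gen Zz)).
  exact: lin0 ((@cform_bilin A C M).1 _).
- move=> z t Zz; rewrite /folded_form (cell_fold_comm (span_gen Zz)).
  exact: lin0 (cform_linr _).
- exact: tau_lin.
- by move=> t u; apply: tau_cform.
by exists (J t), u.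
Qed.

Lemma cell_symmetric_inj t u : B t t = u + tau u -> comm t.
Proof.
move=> e; have [z ez] := comm_square_eq (cell_comm_fold t).
apply: (@symmetric_square_inj T Y (@comm_gen A T lact ract)
    folded_form (@tau A C M) _ _ folded_form_span folded_form_dual t (u + z)).
- exact: tau_lin.
- by move=> ? ?; apply: tau_cform.
by rewrite tD addrACA -e ez -addrA addxx addr0.
Qed.

End CellForm.

(** * Collapse of the spectral sequence *)

Section ShortChains.
Variables (A : dgAlg) (T : lmodType F2) (la : A -> T -> T) (ra : T -> A -> T) (dT : T -> T).
Hypotheses (la_bilin : bilinear la) (ra_bilin : bilinear ra) (dT_lin : linear dT).
Variables (N : nat) (x : nat -> A) (W : nat -> nat -> T).
Hypothesis x0 : x 0%N = 0.
Hypotheses (W0 : forall i j, ~~ chain N i j -> W i j = 0)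
  (dW : forall i j, chain N i j -> dT (W i j) = koszul la ra x W i j).

(** The component on the d arrows x_r ... x_(r+d-1), indexed by its first arrow as in the formulas
    for the explicit cycle; the index 0 stands for no chain. *)
Definition chains (d r : nat) : T := if r is r'.+1 then W r' (r' + d)%N else 0.

Lemma dT_chains d r : (0 < d)%N -> dT (chains d r) =
  la (x (r + d)%N) (chains d.+1 r) + ra (chains d.+1 r.-1) (x r.-1).
Proof.
have la_0 a : la a 0 = 0 := lin0 (la_bilin.2 a).
have ra_0 a : ra 0 a = 0 := lin0 (ra_bilin.1 a).
case: d => // d _; case: r => [|r] /=; first by rewrite (lin0 dT_lin) la_0 ra_0 addr0.
have [rN|rN] := boolP (chain N r (r + d.+1)); last first.
  have NW e : (d.+1 <= e)%N -> W r (r + e)%N = 0.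
    move=> de; apply: W0; apply: contra rN => /andP [_ rN].
    by rewrite /chain -addSnnS leq_addr (leq_trans _ rN) // addSnnS leq_add2l.
  rewrite !NW // (lin0 dT_lin) la_0 add0r; case: r rN {NW} => [|r] rN /=; first by rewrite ra_0.
  rewrite W0 ?ra_0 //; apply: contra rN => /andP [_ rN].
  by rewrite /chain -{1}addSnnS leq_addr addSnnS.
rewrite dW // /koszul addrC addSn -addnS; congr (_ + _).
case: r {rN} => [|r] /=; first by rewrite x0 !(lin0 (ra_bilin.2 _)).
by rewrite addSnnS.
Qed.

End ShortChains.

(* If v, x1, x2 is the start of a cycle of the bicomplex, surviving to E^3, then
   v is the leading term of a permanent cycle. *)
Definition cycle_lifting (V : lmodType F2) (d t : V -> V) : Prop := forall v x1 x2,
  v + t v = 0 -> d v + (x1 + t x1) = 0 -> d x1 + (x2 + t x2) = 0 ->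
  exists y1 y2 y3, [/\ d v + (y1 + t y1) = 0, d y1 + (y2 + t y2) = 0,
    d y2 + (y3 + t y3) = 0 & d y3 = 0].

Lemma lin_comp (U V W : lmodType F2) (f : U -> V) (g : V -> W) :
  linear f -> linear g -> linear (fun x => g (f x)).
Proof. by move=> lf lg a x y; rewrite lf lg. Qed.

Lemma retract_lifting (U V : lmodType F2) (dU tU : U -> U) (dV tV : V -> V)
    (i : U -> V) (p : V -> U) : linear i -> linear p ->
  {morph i : u / dU u >-> dV u} -> {morph i : u / tU u >-> tV u} ->
  {morph p : v / dV v >-> dU v} -> {morph p : v / tV v >-> tU v} -> cancel i p ->
  cycle_lifting dV tV -> cycle_lifting dU tU.
Proof.
move=> li lp di ti dp tp ip lift v x1 x2 e0 e1 e2.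
have [|||y1 [y2 [y3 [h1 h2 h3 h4]]]] := lift (i v) (i x1) (i x2).
- by rewrite -ti -(linD li) e0 (lin0 li).
- by rewrite -ti -di -!(linD li) e1 (lin0 li).
- by rewrite -ti -di -!(linD li) e2 (lin0 li).
exists (p y1), (p y2), (p y3); split.
- by rewrite -[v in LHS]ip -dp -tp -!(linD lp) h1 (lin0 lp).
- by rewrite -dp -tp -!(linD lp) h2 (lin0 lp).
- by rewrite -dp -tp -!(linD lp) h3 (lin0 lp).
by rewrite -dp h4 (lin0 lp).
Qed.

Section Tate.
Variables (n : nat) (A : dgAlg) (ev : 'I_n.+1 -> A) (y : nat -> A).
Hypotheses (n_odd : odd n) (mA : matched_alg ev y).
Local Notation N := (n.*2.+1).
Local Notation x := (chain_arrow n y).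
Local Notation dA := (matched_dif mA).

Let lact0 (P : dgBimod A) (a : A) : lact a (0 : P) = 0.
Proof. exact: lin0 ((lact_bilin P).2 a). Qed.
Let lact0l (P : dgBimod A) (t : P) : lact (0 : A) t = 0.
Proof. exact: lin0 ((lact_bilin P).1 t). Qed.
Let ract0 (P : dgBimod A) (a : A) : ract (0 : P) a = 0.
Proof. exact: lin0 ((ract_bilin P).1 a). Qed.
Let ract0r (P : dgBimod A) (t : P) : ract t (0 : A) = 0.
Proof. exact: lin0 ((ract_bilin P).2 t). Qed.

Lemma lact_dif0 (P : dgBimod A) (a : A) (t : P) : dif (lact a t) = lact a (dif t).
Proof. by rewrite lact_dif dA lact0l add0r. Qed.
Lemma ract_dif0 (P : dgBimod A) (a : A) (t : P) : dif (ract t a) = ract (dif t) a.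
Proof. by rewrite ract_dif dA ract0r addr0. Qed.

Lemma koszul_cycle (C M : dgBimod A) (G : tensA M C) (W : nat -> nat -> tensA M C) :
  (forall i j, ~~ chain N i j -> W i j = 0) ->
  dif G = koszul0 lact ract N x W ->
  (forall i j, chain N i j -> dif (W i j) = koszul lact ract x W i j) ->
  exists y1 y2 y3 : hc_cplx C (derived_square C M),
    [/\ dif (cform G G) = y1 + tau y1, dif y1 = y2 + tau y2,
        dif y2 = y3 + tau y3 & dif y3 = 0].
Proof.
move=> W0 eG eW; set T := tensA M C in G W W0 eG eW *.
pose g := chains W 1; pose q := chains W 2; pose p := chains W 3.
have x0 : x 0%N = 0 := chain_arrow0 n y.
have xN : forall r, (N < r)%N -> x r = 0 := @chain_arrow_out n A y.
have xx : forall r, dgmul (x r) (x r.+1) = 0 := chain_arrow_mul n_odd mA.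
have bl := lact_bilin T; have br := ract_bilin T.
have ld := @dif_lin T.
have dg r : dif (g r) = lact (x r.+1) (q r) + ract (q r.-1) (x r.-1).
  by rewrite (dT_chains bl br ld x0 W0 eW r (ltn0Sn 0)) addn1.
have dq r : dif (q r) = lact (x r.+2) (p r) + ract (p r.-1) (x r.-1).
  by rewrite (dT_chains bl br ld x0 W0 eW r (ltn0Sn 1)) addn2.
have dG : dif G = \sum_(r < N.+2) (lact (x r) (g r) + ract (g r) (x r)).
  rewrite eG; apply: eq_bigr => -[[|r] rN] _; first by rewrite x0 !lact0l !ract0r.
  by have -> : g r.+1 = W r r.+1 by rewrite /g /chains addn1.
set Y := hc_cplx C (derived_square C M).
have bB := @cform_bilin A C M.
have Br := @cform_ract A C M; have Bl := @cform_lact A C M.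
have tB := @tau_cform A C M; have dB := @dif_cform A C M.
have lY := @dif_lin Y; have lt := @tau_lin A C M.
have dl : forall a (t : T), dif (lact a t) = lact a (dif t) by exact: lact_dif0.
have dr (t : T) a : dif (ract t a) = ract (dif t) a by exact: ract_dif0.
have lA := @lactA A T; have rA := @ractA A T; have lrC := @lractC A T.
exists (cyc1 lact ract (@cform A C M) N x G g), (cyc2 ract (@cform A C M) N x g),
  (cyc3 ract (@cform A C M) N x g q); split.
- exact: (dcyc0 bB Br Bl tB dB dG).
- exact: (dcyc1 bl br lA rA lrC ld dl dr lY lt bB Br Bl tB dB x0 xN xx dG dg).
- exact: (dcyc2 br rA lrC dr lY lt bB Br Bl tB dB x0 xN xx dg).
exact: (dcyc3 br rA lrC dr lY bB Br Bl dB x0 xN xx dg dq).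
Qed.

Lemma cell_lifting (C M : dgBimod A) : cell C ->
  cycle_lifting (@dif (hc_cplx C (derived_square C M))) (@tau A C M).
Proof.
move=> /(cell_basis dA) [Lam [gn [rk [g_span g_univ g_dif]]]] v x1 x2 ev0 e1 e2.
set T := tensA M C; set Y := hc_cplx C _ in v x1 x2 ev0 e1 e2 *.
pose B := @cform A C M; pose t := @tau A C M.
have sym := cell_symmetric (M := M) g_span g_univ.
have inj := cell_symmetric_inj (M := M) g_span g_univ.
have bB : bilinear B := @cform_bilin A C M.
have tB : forall p q, t (B p q) = B q p := @tau_cform A C M.
have dB : forall p q, dif (B p q) = B (dif p) q + B p (dif q) := @dif_cform A C M.
have dD (p q : Y) : dif (p + q) = dif p + dif q := linD (@dif_lin Y) p q.
have tD (p q : Y) : t (p + q) = t p + t q := linD (@tau_lin A C M) p q.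
have td (p : Y) : t (dif p) = dif (t p) := tau_dif p.
have [s [u vE]] := sym _ (esym (addr_eq2 ev0)).
have sq p : dif (B p p) = B (dif p) p + t (B (dif p) p) := dY_square tB dB p.
(* As v = B(s, s) + (1 + tau) u, the element B(ds, s) + du is already a solution of the first
   equation; its difference with x1 is invariant. *)
pose w : Y := x1 + B (dif s) s + dif u.
have tw : t w = w.
  apply/esym/addr_eq2; rewrite /w !tD td -[RHS]e1 vE !dD sq.
  by rewrite [LHS](AC ((2*1)*(2*1)) (((2*5)*(3*6))*(1*4)))%AC.
have [s2 [u2 ew]] := sym _ tw.
(* Compute dw twice, from the definition of w and from its decomposition as an invariant: B(ds, ds)
   falls into the image of 1 + tau, which puts ds in [A, T]. *)
have dd : B (dif s) (dif s) = (x2 + B (dif s2) s2 + dif u2) + t (x2 + B (dif s2) s2 + dif u2).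
  have : dif w = dif x1 + B (dif s) (dif s).
    by rewrite /w !dD dB !dif_dif (lin0 (bB.1 _)) add0r addr0.
  rewrite ew !dD sq -td (addr_eq2 e2) => e.
  rewrite -[LHS](addxK (x2 + t x2)) -e !tD.
  by rewrite [LHS](AC (2*(2*2)) (((1*3)*5)*((2*4)*6)))%AC.
have cds := inj _ _ dd.
(* Since ds lies in [A, T], the triple (s, 0, 0) is a cycle of the augmented total complex, and
   acyclicity replaces s by G. *)
have fam0 : family lact ract ev N (chain_src ev) (chain_tgt ev) (0 : T) (fun _ _ => 0).
  split=> [|i j|i j|i j]; [|by []|exact: lact0|exact: ract0].
  by rewrite /diag big1 // => e _; rewrite ract0 lact0.
have cds0 : comm lact ract (dif s + (0 : T)) by rewrite addr0.
have d0 : dif (0 : T) = 0 := lin0 (@dif_lin T).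
have eG0 : dif (0 : T) = koszul0 lact ract N x (fun _ _ => 0).
  by rewrite d0 /koszul0 big1 // => r _; rewrite lact0 ract0 addr0.
have eW0 i j : chain N i j -> dif (0 : T) = koszul lact ract x (fun _ _ => 0) i j.
  by rewrite d0 /koszul lact0 ract0 addr0.
have dl : forall a (p : T), dif (lact a p) = lact a (dif p) by exact: lact_dif0.
have dr (p : T) a : dif (ract p a) = ract (dif p) a by exact: ract_dif0.
have [G [W [[_ W0 _ _] cG eG eW]]] := based_acyclic n_odd mA (lact_bilin T) (ract_bilin T)
  (lact_bilin M) (@lactA A M) (@lact1 A M) (@cell_pr_bilin A C M Lam gn) (@cell_la_pr A C M Lam gn)
  (@cell_ra_pr A C M Lam gn) (cell_pr_span g_span) (cell_pr_univ g_span g_univ)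
  (@lactA A T) (@ractA A T) (@lractC A T) (@ract1 A T) (@dif_lin T) (@dif_dif T) dl dr
  (@lact_dif0 M) (cell_triangular dA g_dif) fam0 cds0 eG0 eW0.
have [z ez] := comm_square_eq cG.
have [y1 [y2 [y3 [h1 h2 h3 h4]]]] := koszul_cycle W0 (addr_eq2 (esym eG))
  (fun i j c => addr_eq2 (esym (eW i j c))).
(* v and B(G, G) differ by (1 + tau)(z + u), whose differential is corrected by d(z + u) and
   contributes nothing further. *)
exists (y1 + dif (z + u)), y2, y3; split=> //.
- have -> : v = B G G + ((z + u) + t (z + u)) by rewrite vE ez tD [LHS](AC ((1*2)*2) (1*((2*4)*(3*5))))%AC.
  rewrite -/t !dD !tD !dD h1 -/t -!td.
  by rewrite [X in X + _]addrACA addxx.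
- by rewrite dD dif_dif addr0 h2 addxx.
- by rewrite h3 addxx.
Qed.

Lemma cell_retract_lifting (R M : dgBimod A) : cell_retract R ->
  cycle_lifting (@dif (hc_cplx R (derived_square R M))) (@tau A R M).
Proof.
case=> C cC [i [p [di dp ip]]].
have [I [lI Id It IE]] := hc_map_exists M di.
have [P [lP Pd Pt PE]] := hc_map_exists M dp.
have tK : cancel (@tA_map A M R C i) (@tA_map A M C R p).
  apply: (tA_ext (lin_comp (tA_map_lin di) (tA_map_lin dp)) (fun _ _ _ => erefl)) => m r.
  by rewrite (tA_mapE di) (tA_mapE dp) ip.
apply: (@retract_lifting _ _ _ _ (@dif (hc_cplx C (derived_square C M))) (@tau A C M)
  I P lI lP Id It Pd Pt _ (cell_lifting cC)).
apply: (cform_ext (lin_comp lI lP) (fun _ _ _ => erefl)) => t u.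
by rewrite IE PE !tK.
Qed.

End Tate.

(** * From cycle lifting to collapse *)

Section Collapse.
Variables (A : dgAlg) (R M : dgBimod A).
Local Notation Y := (hc_cplx R (derived_square R M)).
Local Notation dh := (fun v : Y => v + tau v).
Local Notation D := (hv_dif (@dif Y) dh).
Hypothesis lift : cycle_lifting (@dif Y) (@tau A R M).

Let tau0 : tau (0 : Y) = 0 := lin0 (@tau_lin A R M).
Let dif0 : dif (0 : Y) = 0 := lin0 (@dif_lin Y).
Let cmp0 q : cmp q (0 : Y) = 0 := lin0 (@cmp_lin Y q).
Let cmpD q (u v : Y) : cmp q (u + v) = cmp q u + cmp q v := linD (@cmp_lin Y q) u v.

Definition four_term (p0 : int) (v y1 y2 y3 : Y) (p : int) : Y :=
  if p == p0 then v else if p == p0 + 1 then y1 else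
  if p == p0 + 2 then y2 else if p == p0 + 3 then y3 else 0.

Lemma four_term_cycle p0 v y1 y2 y3 p : v + tau v = 0 -> dif v + (y1 + tau y1) = 0 ->
  dif y1 + (y2 + tau y2) = 0 -> dif y2 + (y3 + tau y3) = 0 -> dif y3 = 0 ->
  D (four_term p0 v y1 y2 y3) p = 0.
Proof.
move=> e0 e1 e2 e3 e4; rewrite /hv_dif; set f := four_term _ _ _ _ _.
have f0 : f p0 = v by rewrite /f /four_term eqxx.
have f1 : f (p0 + 1) = y1.
  by rewrite /f /four_term eqxx (_ : (p0 + 1 == p0) = false) //; lia.
have f2 : f (p0 + 1 + 1) = y2.
  rewrite /f /four_term (_ : (p0 + 1 + 1 == p0) = false); last by lia.
  rewrite (_ : (p0 + 1 + 1 == p0 + 1) = false); last by lia.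
  by rewrite (_ : (p0 + 1 + 1 == p0 + 2) = true); last by lia.
have f3 : f (p0 + 1 + 1 + 1) = y3.
  rewrite /f /four_term (_ : (p0 + 1 + 1 + 1 == p0) = false); last by lia.
  rewrite (_ : (p0 + 1 + 1 + 1 == p0 + 1) = false); last by lia.
  rewrite (_ : (p0 + 1 + 1 + 1 == p0 + 2) = false); last by lia.
  by rewrite (_ : (p0 + 1 + 1 + 1 == p0 + 3) = true); last by lia.
have fn q : q <> p0 -> q <> p0 + 1 -> q <> p0 + 1 + 1 -> q <> p0 + 1 + 1 + 1 -> f q = 0.
  move=> n0 n1 n2 n3; rewrite /f /four_term (_ : (q == p0) = false); last by lia.
  rewrite (_ : (q == p0 + 1) = false); last by lia.
  rewrite (_ : (q == p0 + 2) = false); last by lia.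
  by rewrite (_ : (q == p0 + 3) = false); last by lia.
have [n0|n0] := eqVneq p p0; first by rewrite n0 f0 f1.
have [n1|n1] := eqVneq p (p0 + 1); first by rewrite n1 f1 f2.
have [n2|n2] := eqVneq p (p0 + 1 + 1); first by rewrite n2 f2 f3.
have [n3|n3] := eqVneq p (p0 + 1 + 1 + 1).
  by rewrite n3 f3 e4 fn ?tau0 ?addr0 //; lia.
rewrite (fn p); [|lia..]; rewrite dif0 add0r.
have [n4|n4] := eqVneq (p + 1) p0; first by rewrite n4 f0.
by rewrite fn ?tau0 ?addr0 //; lia.
Qed.

(** A permanent cycle x' with the leading term of x is subtracted: x + x' has the same total
    differential as x and lies in filtration s - 1, so this differential is already a boundary on
    the page r. *)
Lemma collapse : hv_collapses_at (fun _ q => @hom Y q) (@dif Y) dh 3.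
Proof.
move=> r r3 s n x [[hx sx] [hd sd]]; pose p0 := n - s.
have x0 p : p < p0 -> x p = 0 by move=> pp; apply: sx; rewrite /p0 in pp; lia.
(* With r >= 3 the total differential of x vanishes at the three places p0 - 1, p0 and p0 + 1: these
   are the hypotheses of [cycle_lifting]. *)
have d0 p : p0 - 1 <= p -> p <= p0 + 1 -> D x p = 0.
  by move=> h1 h2; apply: sd; rewrite /p0 in h1 h2; lia.
have hp0 : hom s (x p0) by have := hx p0; rewrite (_ : n - p0 = s) // /p0; lia.
have [|||y1 [y2 [y3 [h1 h2 h3 h4]]]] := @lift (x p0) (x (p0 + 1)) (x (p0 + 1 + 1)).
- have := d0 (p0 - 1); rewrite /hv_dif subrK x0; last by lia.
  by rewrite dif0 add0r; apply; lia.
- by apply: (d0 p0); lia.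
- by apply: (d0 (p0 + 1)); lia.
have e0 : x p0 + tau (x p0) = 0.
  have := d0 (p0 - 1); rewrite /hv_dif subrK x0; last by lia.
  by rewrite dif0 add0r; apply; lia.
(* The lifted elements need not be homogeneous. Their components in degrees s - 1, s - 2 and s - 3
   satisfy the same equations, since [dif] lowers the degree by one and [tau] preserves it. *)
have cut q (u w : Y) : dif u + (w + tau w) = 0 ->
    dif (cmp q u) + (cmp (q - 1) w + tau (cmp (q - 1) w)) = 0.
  by move=> e; rewrite dif_cmp tau_cmp -!cmpD e cmp0.
have k1 := cut s _ _ h1; rewrite hp0 in k1; have k2 := cut (s - 1) _ _ h2.
have k3 := cut (s - 1 - 1) _ _ h3.
have k4 : dif (cmp (s - 1 - 1 - 1) y3) = 0 by rewrite dif_cmp h4 cmp0.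
pose x' := four_term p0 (x p0) (cmp (s - 1) y1) (cmp (s - 1 - 1) y2) (cmp (s - 1 - 1 - 1) y3).
have Dx' p : D x' p = 0 by apply: four_term_cycle.
pose z p := x p + x' p.
have Dz p : D z p = D x p.
  rewrite -[RHS]addr0 -(Dx' p) /hv_dif /z (linD (@dif_lin Y)) (linD (@tau_lin A R M)).
  by rewrite [LHS](AC (2*(2*2)) ((1*(3*5))*(2*(4*6))))%AC.
exists (fun _ => 0), z; split.
- have D0 p : D (fun _ => 0) p = 0 by rewrite /hv_dif dif0 tau0 !addr0.
  by split; split=> [p|p _]; rewrite ?D0 //; apply: (@hom0 Y).
- split; split=> [p|p hp].
  + rewrite subrK /z -[x p]scale1r; apply: hom_lin => //; rewrite /x' /four_term.
    case: eqP => [->|_]; first exact: hx.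
    case: eqP => [->|_]; first by rewrite (_ : n - _ = s - 1) ?/p0; [exact: hom_cmp|lia].
    case: eqP => [->|_]; first by rewrite (_ : n - _ = s - 1 - 1) ?/p0; [exact: hom_cmp|lia].
    case: eqP => [->|_]; last exact: hom0.
    by rewrite (_ : n - _ = s - 1 - 1 - 1) ?/p0; [exact: hom_cmp|lia].
  + have pp : p <= p0 by rewrite /p0; lia.
    rewrite /z /x' /four_term; case: eqP => [->|np]; first exact: addxx.
    rewrite x0 ?add0r; last by lia.
    by do 3 (case: eqP => [?|_]; first by lia).
  + by rewrite Dz subrK; apply: hd.
  by rewrite Dz; apply: sd; lia.
by move=> p; rewrite add0r Dz.
Qed.

End Collapse.

Theorem theorem7 (k : nat) (hk : (1 <= k)%N) : pi_formal (antipodal_alg k).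
Proof.
have mA := antipodal_matched hk.
have n_odd : odd k.*2.-1 by case: k hk {mA} => // k _; rewrite doubleS /= odd_double.
split; [exact: matched_smooth n_odd mA|exact: matched_proper n_odd mA|].
move=> R f [cR _] M; apply: collapse.
exact: (@cell_retract_lifting _ _ _ _ n_odd mA R M cR).
Qed.
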